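(* Let $s:\mathbb{C}\to\mathbb{P}^1$ be a meromorphic function, $s\not\equiv\infty$. There exists a family $\{Z^u\}_{u\in\mathbb{C}(z)}$ (indexed by the entire functions $u$ of one variable) of holomorphic vector fields on $\mathbb{C}^2\setminus \mathrm{graph}(s)$ which are complete, of type $\mathbb{C}^*$, and whose trajectories are contained in vertical lines $\{z=\text{const}\}$. Moreover, each $Z^u$ extends to $\mathbb{C}\times\mathbb{P}^1$ as a complete holomorphic vector field of type $\mathbb{C}^*$, vanishing only along the graphs of $s$ and $s_\infty$.
   Context: $\mathbb{C}(z)$ denotes the ring of entire functions of one complex variable $z$ (not rational functions). Coordinates on $\mathbb{C}^2$ and $\mathbb{C}\times\mathbb{P}^1$ are $(z,w)$. $s_\infty:\mathbb{C}\to\mathbb{P}^1$ is the constant map $\infty$. The graph of $s$ in $\mathbb{C}\times\mathbb{P}^1$ is $\{(z,s(z))\}$; its intersection with $\mathbb{C}^2$ is meant by $\mathrm{graph}(s)$ when writing $\mathbb{C}^2\setminus\mathrm{graph}(s)$. A holomorphic vector field $X$ on a complex surface $M$ is complete if its solution through every point is defined for all complex times $t\in\mathbb{C}$. The trajectory $C_p$ of $X$ through $p$ is the image of the maximal solution through $p$. A (non-constant) trajectory is of type $\mathbb{C}$ (resp. $\mathbb{C}^*$) if it is, as a Riemann surface, isomorphic to $\mathbb{C}$ (resp. $\mathbb{C}^*$). A complete $X$ is of type $\mathbb{C}$ (resp. $\mathbb{C}^*$) if all trajectories $C_p$ with $p$ outside some pluripolar subset of $M$ invariant by the flow are of type $\mathbb{C}$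 (resp. $\mathbb{C}^*$). *)

(* Defs.v *)
From Stdlib Require Export Reals.
From Coquelicot Require Export Coquelicot.

Open Scope C_scope.

(* [ex_derive] over the field [C_AbsRing] is complex differentiability. *)
Definition holomorphic_at (f : C -> C) (z : C) : Prop :=
  ex_derive (K := C_AbsRing) (V := C_NormedModule) f z.

Definition entire (f : C -> C) : Prop := forall z, holomorphic_at f z.

Definition entire_function := {u : C -> C | entire u}.

Definition C2_NormedModule : NormedModule C_AbsRing :=
  prod_NormedModule C_AbsRing C_NormedModule C_NormedModule.

(* Complex Frechet differentiability; on an open set this is holomorphy. *)
Definition holomorphic2_at (F : C * C -> C * C) (a : C * C) : Prop :=
  ex_filterdiff (K := C_AbsRing) (U := C2_NormedModule) (V := C2_NormedModule)
    F (locally (T := C2_NormedModule) a).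

Inductive P1 : Type :=
| aff (w : C)
| infty.

(* The two coordinates of P^1.  The values at [infty], resp. at [aff 0], are
   junk: [coord_w] is only used near finite points, [coord_v] near points
   different from [aff 0]. *)
Definition coord_w (x : P1) : C :=
  match x with aff w => w | infty => 0 end.

Definition coord_v (x : P1) : C :=
  match x with aff w => / w | infty => 0 end.

(* [f] is complex differentiable at [t] as a map to P^1, with derivative [b]
   read in the coordinate w if [f t] is finite, and in v = 1/w otherwise. *)
Definition is_derive_P1 (f : C -> P1) (t b : C) : Prop :=
  match f t with
  | aff _ =>
      locally t (fun t' => f t' <> infty) /\
      is_derive (K := C_AbsRing) (V := C_NormedModule)
        (fun t' => coord_w (f t')) t b
  | infty =>
      locally t (fun t' => f t' <> aff 0) /\
      is_derive (K := C_AbsRing) (V := C_NormedModule)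
        (fun t' => coord_v (f t')) t b
  end.

(* Meromorphic functions, including the constant [infty], are the holomorphic
   maps from C to P^1. *)
Definition meromorphic (s : C -> P1) : Prop :=
  forall z, exists b, is_derive_P1 s z b.

Definition surface : Type := (C * P1)%type.

Definition chart_w (a : C * C) : surface := (fst a, aff (snd a)).

Definition chart_v (a : C * C) : surface :=
  (fst a, if Ceq_dec (snd a) 0 then infty else aff (/ snd a)).

Definition whole : surface -> Prop := fun _ => True.

Definition graph (s : C -> P1) : surface -> Prop := fun p => snd p = s (fst p).

Definition s_infty : C -> P1 := fun _ => infty.

(* C^2 is the open subset of C x P^1 where w is finite. *)
Definition C2_minus_graph (s : C -> P1) : surface -> Prop :=
  fun p => snd p <> infty /\ ~ graph s p.

(* The value at (z, aff w) is given by its components along d/dz and d/dw,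
   the value at (z, infty) by its components along d/dz and d/dv, v = 1/w.
   Only the values on the open subset [M] under consideration matter. *)
Definition vector_field : Type := surface -> C * C.

Definition field_in_w (X : vector_field) (a : C * C) : C * C := X (chart_w a).

(* d/dw = - v^2 d/dv. *)
Definition field_in_v (X : vector_field) (a : C * C) : C * C :=
  let v := snd a in
  let b := X (chart_v a) in
  if Ceq_dec v 0 then b else (fst b, - (v * v) * snd b).

Definition holomorphic_field (M : surface -> Prop) (X : vector_field) : Prop :=
  (forall a, M (chart_w a) -> holomorphic2_at (field_in_w X) a) /\
  (forall a, M (chart_v a) -> holomorphic2_at (field_in_v X) a).

Definition has_velocity (g : C -> surface) (t : C) (b : C * C) : Prop :=
  is_derive (K := C_AbsRing) (V := C_NormedModule)
    (fun t' => fst (g t')) t (fst b) /\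
  is_derive_P1 (fun t' => snd (g t')) t (snd b).

(* Solutions of [X] in [M] defined for all complex times. *)
Definition global_solution (M : surface -> Prop) (X : vector_field)
    (g : C -> surface) : Prop :=
  forall t, M (g t) /\ has_velocity g t (X (g t)).

Definition complete (M : surface -> Prop) (X : vector_field) : Prop :=
  forall p, M p -> exists g, global_solution M X g /\ g 0 = p.

(* The trajectory C_p of a complete field: its maximal solutions are the ones
   defined for all times. *)
Definition trajectory (M : surface -> Prop) (X : vector_field) (p : surface)
    : surface -> Prop :=
  fun q => exists g, global_solution M X g /\ g 0 = p /\ exists t, g t = q.

(* The trajectory of [p] is isomorphic, as a Riemann surface, to the open
   subset [S] of C: [k] and [h] are inverse bijections between them.  The
   complex structure of a non-constant trajectory is the one for which the
   solution [g] is a local isomorphism from C, so that [k] is holomorphic iff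
   [k o g] is entire, and [h] is holomorphic iff it locally factors as
   [g o tau] with [tau] holomorphic.  A constant trajectory satisfies this for
   no nonempty open [S]. *)
Definition trajectory_of_type (S : C -> Prop) (M : surface -> Prop)
    (X : vector_field) (p : surface) : Prop :=
  exists (g : C -> surface) (k : surface -> C) (h : C -> surface),
    global_solution M X g /\ g 0 = p /\
    (forall q, trajectory M X p q -> S (k q) /\ h (k q) = q) /\
    (forall x, S x -> trajectory M X p (h x) /\ k (h x) = x) /\
    entire (fun t => k (g t)) /\
    (forall x, S x -> exists tau : C -> C,
        locally x (fun y => holomorphic_at tau y /\ h y = g (tau y))).

Definition Cstar : C -> Prop := fun x => x <> 0.

(* The last condition is the sub-mean value inequality on the circles
   a + exp(i theta) b.  The Lebesgue integral of the upper semicontinuous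
   function theta |-> v (a + exp(i theta) b), which may be -oo, is the infimum
   of the integrals of its continuous majorants. *)
Definition plurisubharmonic (D : C * C -> Prop) (v : C * C -> Rbar) : Prop :=
  (forall a, D a -> v a <> p_infty) /\
  (forall a, D a -> forall c : R, Rbar_lt (v a) c ->
     locally (T := C2_NormedModule) a (fun x => Rbar_lt (v x) c)) /\
  (forall a b : C * C,
     (forall l : C, (Cmod l <= 1)%R -> D (fst a + l * fst b, snd a + l * snd b)) ->
     forall psi : R -> R,
       (forall theta, continuous psi theta) ->
       (forall theta : R, (0 <= theta <= 2 * PI)%R ->
          let l : C := (cos theta, sin theta) in
          Rbar_le (v (fst a + l * fst b, snd a + l * snd b)) (psi theta)) ->
       Rbar_le (v a) (RInt psi 0 (2 * PI) / (2 * PI))%R).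

Definition polydisc (a : C * C) (r : R) : C * C -> Prop :=
  fun x => (Cmod (fst x - fst a) < r)%R /\ (Cmod (snd x - snd a) < r)%R.

Definition pluripolar_in_chart (chart : C * C -> surface)
    (M E : surface -> Prop) : Prop :=
  forall a, M (chart a) ->
    exists (r : R) (v : C * C -> Rbar),
      (0 < r)%R /\
      (forall x, polydisc a r x -> M (chart x)) /\
      plurisubharmonic (polydisc a r) v /\
      (exists x, polydisc a r x /\ v x <> m_infty) /\
      (forall x, polydisc a r x -> E (chart x) -> v x = m_infty).

Definition pluripolar (M E : surface -> Prop) : Prop :=
  (forall p, E p -> M p) /\
  pluripolar_in_chart chart_w M E /\ pluripolar_in_chart chart_v M E.

Definition flow_invariant (M : surface -> Prop) (X : vector_field)
    (E : surface -> Prop) : Prop :=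
  forall p, E p -> forall q, trajectory M X p q -> E q.

Definition of_type (S : C -> Prop) (M : surface -> Prop) (X : vector_field)
    : Prop :=
  complete M X /\
  exists E : surface -> Prop,
    pluripolar M E /\ flow_invariant M X E /\
    forall p, M p -> ~ E p -> trajectory_of_type S M X p.

(* Main.v *)
(* Write s = f/g with f, g entire without common zeros (Weierstrass) and put
   Z^u = e^u (g w - f) d/dw.  On the fibre over z this is the affine field w' = A w - B with
   A = e^u g, B = e^u f.  If g(z) <> 0 its solutions are w = s(z) + c exp(A t), so the fibre minus
   s(z) and infinity is one trajectory, isomorphic to C^*.  Over the poles of s the field is
   constant; these fibres and the zeros of the field form the exceptional set, on which
   log |g (g w - f)|, respectively log |g v (g - f v)| with v = 1/w, is -oo.

   The quotient f/g is built on larger and larger discs.  Two representations of s on a disc differ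
   by a factor exp L, and approximating L by a polynomial on a smaller disc makes the correction
   factors converge. *)
Require Import Defs.
From Stdlib Require Import Lra Lia Psatz Classical ClassicalEpsilon List Wf_nat
  FunctionalExtensionality.

(** * Complex differentiation *)

(** Multiplying by the denominator g makes the field holomorphic across the poles of s, and the
    absence of common zeros keeps its zero set equal to the two graphs: at a pole g w - f is the
    nonzero constant -f. Being of degree one in w, the field reads v (B v - A) d/dv in the
    coordinate v = 1/w, so it extends over infinity with a zero there. One formula thus serves both
    surfaces, and only stability under the fibrewise flow and openness are checked for each. A
    trajectory is defined through all global solutions, which are maps to P^1 that could a priori
    pass through infinity; this is excluded because the times spent at infinity form a clopen set.
    Clopen sets of the plane are handled through functions with derivative zero, the tool that also
    proves uniqueness for the affine equation. Plurisubharmonicity is tested against arbitrary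
    continuous majorants psi on [0, 2 pi], possibly with psi(0) <> psi(2 pi). Hence log |Phi| is
    compared with Riemann sums of psi, through products of rotates and Cauchy's formula for entire
    functions. *)

Notation is_Cderive f z l :=
  (is_derive (K := C_AbsRing) (V := C_NormedModule) f z (l%C : C)).

Notation Ccontinuous f x := (continuous (U := C_UniformSpace) f x).

(** Paths have a real parameter and are differentiated with [C] as a real normed module, while
    [is_Cderive] works over the field [C]. *)
Notation is_path_derive f t l :=
  (is_derive (K := R_AbsRing) (V := C_R_NormedModule) f t (l%C : C)).

Definition disc (c : C) (r : R) (z : C) : Prop := (Cmod (z - c) < r)%R.

Definition holomorphic_on (U : C -> Prop) (f : C -> C) : Prop :=
  forall z, U z -> holomorphic_at f z.

Lemma Cmod_sym (x y : C) : Cmod (x - y) = Cmod (y - x).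
Proof. rewrite <- Cmod_opp. f_equal. ring. Qed.

Lemma Cmod_minus_triangle (x y z : C) : (Cmod (x - z) <= Cmod (x - y) + Cmod (y - z))%R.
Proof. replace (x - z) with ((x - y) + (y - z)) by ring. apply Cmod_triangle. Qed.

Lemma Cmod_triangle_inv (x y : C) : (Cmod x - Cmod y <= Cmod (x - y))%R.
Proof.
  assert (H := Cmod_triangle (x - y) y).
  replace (x - y + y) with x in H by ring. lra.
Qed.

Lemma Cmod_minus_le (x y : C) : (Cmod (x - y) <= Cmod x + Cmod y)%R.
Proof.
  assert (H := Cmod_triangle x (- y)). rewrite Cmod_opp in H. exact H.
Qed.

Lemma Cmod_minus_self (x : C) : Cmod (x - x) = 0%R.
Proof. replace (x - x) with (RtoC 0) by ring. apply Cmod_0. Qed.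

Lemma Cmod_scal (r : R) (x : C) : Cmod (r * x) = (Rabs r * Cmod x)%R.
Proof. rewrite Cmod_mult, Cmod_R. reflexivity. Qed.

Lemma disc_center (z : C) (d : R) : (0 < d)%R -> disc z d z.
Proof. intros Hd. unfold disc. rewrite Cmod_minus_self. exact Hd. Qed.

Lemma disc_sub (c : C) (r r' : R) (z : C) : (r <= r')%R -> disc c r z -> disc c r' z.
Proof. unfold disc. intros; lra. Qed.

Lemma Cminus_eq_0 (x y : C) : x - y = 0 -> x = y.
Proof. intros Z. transitivity ((x - y) + y); [ring|]. rewrite Z. ring. Qed.

Lemma Cminus_neq_0 (x y : C) : x <> y -> x - y <> 0.
Proof. intros N Z. apply N, Cminus_eq_0, Z. Qed.

Lemma norm_C_R (x : C) : norm (V := C_R_NormedModule) x = Cmod x.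
Proof.
  unfold norm; simpl. unfold prod_norm, Cmod, norm; simpl. unfold abs; simpl.
  f_equal. rewrite !Rmult_1_r. rewrite <- !Rabs_mult.
  rewrite !Rabs_pos_eq by apply Rle_0_sqr. reflexivity.
Qed.

(** The explicit estimates below are made in this form, with [Cmod] in place of the abstract norms
    and balls. *)
Lemma is_Cderive_iff (f : C -> C) (z l : C) :
  is_Cderive f z l <->
  forall eps, (0 < eps)%R -> exists d, (0 < d)%R /\
    forall y, disc z d y -> (Cmod (f y - f z - l * (y - z)) <= eps * Cmod (y - z))%R.
Proof.
  split.
  - intros [_ H] eps Heps.
    destruct (H z (fun P HP => HP) (mkposreal eps Heps)) as [d Hd].
    exists d; split; [apply cond_pos|]. intros y Hy.
    specialize (Hd y Hy). simpl in Hd.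
    rewrite (Cmult_comm l). exact Hd.
  - intros H. split.
    + apply is_linear_scal_l.
    + intros x Hx.
      assert (E := is_filter_lim_locally_unique (V := AbsRing_NormedModule C_AbsRing) z x Hx).
      subst x. intros eps. destruct (H eps (cond_pos eps)) as [d [Hd H1]].
      exists (mkposreal d Hd). intros y Hy. specialize (H1 y Hy).
      rewrite (Cmult_comm l) in H1. exact H1.
Qed.

Lemma is_path_derive_iff (f : R -> C) (t : R) (l : C) :
  is_path_derive f t l <->
  forall eps, (0 < eps)%R -> exists d, (0 < d)%R /\
    forall s, (Rabs (s - t) < d)%R ->
      (Cmod (f s - f t - l * RtoC (s - t)) <= eps * Rabs (s - t))%R.
Proof.
  assert (E : forall s, minus (minus (f s) (f t)) (scal (V := C_R_NormedModule) (minus s t) l)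
                = f s - f t - l * RtoC (s - t)).
  { intros s. unfold minus, plus, opp, scal; simpl.
    unfold prod_plus, prod_opp, prod_scal, scal; simpl; unfold mult; simpl.
    unfold plus, opp; simpl.
    destruct (f s), (f t), l.
    unfold Cminus, Cplus, Copp, Cmult, RtoC; simpl. f_equal; ring. }
  split.
  - intros [_ H] eps Heps.
    destruct (H t (fun P HP => HP) (mkposreal eps Heps)) as [d Hd].
    exists d; split; [apply cond_pos|]. intros y Hy.
    specialize (Hd y Hy). simpl in Hd. rewrite <- E, <- norm_C_R. exact Hd.
  - intros H. split.
    + apply is_linear_scal_l.
    + intros x Hx.
      assert (E' := is_filter_lim_locally_unique (V := AbsRing_NormedModule R_AbsRing) t x Hx).
      subst x. intros eps. destruct (H eps (cond_pos eps)) as [d [Hd H1]].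
      exists (mkposreal d Hd). intros y Hy. specialize (H1 y Hy).
      rewrite <- E, <- norm_C_R in H1. exact H1.
Qed.

Lemma locally_disc (z : C) (P : C -> Prop) :
  locally z P <-> exists d, (0 < d)%R /\ forall y, disc z d y -> P y.
Proof.
  split.
  - intros H. apply locally_C in H. destruct H as [d H]. exists d; split; [apply cond_pos|exact H].
  - intros [d [Hd H]]. apply locally_C. exists (mkposreal d Hd). exact H.
Qed.

Lemma Ccontinuous_iff {T : UniformSpace} (f : T -> C) (x : T) :
  Ccontinuous f x <->
  forall eps, (0 < eps)%R -> locally x (fun y => (Cmod (f y - f x) < eps)%R).
Proof.
  split.
  - intros H eps Heps. apply (H (fun w => (Cmod (w - f x) < eps)%R)).
    apply locally_disc. exists eps; split; auto.
  - intros H P HP. apply locally_disc in HP. destruct HP as [d [Hd HP]].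
    unfold filtermap. generalize (H d Hd). apply filter_imp. intros y Hy. apply HP. exact Hy.
Qed.

(** The rules for the identity, products and composition concern [C] as a module over its own
    absolute ring. Both structures have the norm [Cmod], so only the linearity clause has to be
    proved again. *)
Lemma is_Cderive_bridge (f : C -> C) (z l : C) :
  is_derive (K := C_AbsRing) (V := AbsRing_NormedModule C_AbsRing) f z l <->
  is_Cderive f z l.
Proof. split; intros [_ H]; (split; [apply is_linear_scal_l|exact H]). Qed.

Lemma is_Cderive_const (c z : C) : is_Cderive (fun _ => c) z 0.
Proof. apply (is_derive_const (V := C_NormedModule)). Qed.

Lemma is_Cderive_id (z : C) : is_Cderive (fun x => x) z 1.
Proof. apply is_Cderive_bridge. apply (is_derive_id (K := C_AbsRing)). Qed.

Lemma is_Cderive_plus (f g : C -> C) (z a b : C) :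
  is_Cderive f z a -> is_Cderive g z b -> is_Cderive (fun x => f x + g x) z (a + b).
Proof. apply (is_derive_plus (V := C_NormedModule)). Qed.

Lemma is_Cderive_minus (f g : C -> C) (z a b : C) :
  is_Cderive f z a -> is_Cderive g z b -> is_Cderive (fun x => f x - g x) z (a - b).
Proof. apply (is_derive_minus (V := C_NormedModule)). Qed.

Lemma is_Cderive_opp (f : C -> C) (z a : C) :
  is_Cderive f z a -> is_Cderive (fun x => - f x) z (- a).
Proof. apply (is_derive_opp (V := C_NormedModule)). Qed.

Lemma is_Cderive_mult (f g : C -> C) (z a b : C) :
  is_Cderive f z a -> is_Cderive g z b ->
  is_Cderive (fun x => f x * g x) z (a * g z + f z * b).
Proof.
  intros Hf Hg. apply is_Cderive_bridge.
  apply (is_derive_mult (K := C_AbsRing)); try (apply is_Cderive_bridge; assumption).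
  intros; apply Cmult_comm.
Qed.

Lemma is_Cderive_comp (f g : C -> C) (z a b : C) :
  is_Cderive f (g z) a -> is_Cderive g z b -> is_Cderive (fun x => f (g x)) z (b * a).
Proof.
  intros Hf Hg. apply (is_derive_comp (V := C_NormedModule)); [exact Hf|].
  apply is_Cderive_bridge. exact Hg.
Qed.

Lemma is_Cderive_unique (f : C -> C) (z a b : C) :
  is_Cderive f z a -> is_Cderive f z b -> a = b.
Proof.
  intros Ha Hb. rewrite <- (is_C_derive_unique f z a Ha). apply is_C_derive_unique. exact Hb.
Qed.

Lemma is_Cderive_eq (f : C -> C) (z a b : C) :
  is_Cderive f z a -> a = b -> is_Cderive f z b.
Proof. intros H E. subst b. exact H. Qed.

Lemma is_Cderive_ext_disc (f g : C -> C) (z a : C) (d : R) :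
  (0 < d)%R -> (forall y, disc z d y -> f y = g y) -> is_Cderive f z a -> is_Cderive g z a.
Proof.
  intros Hd H. apply (is_derive_ext_loc (V := C_NormedModule)).
  exists (mkposreal d Hd). intros y Hy. apply H. exact Hy.
Qed.

Lemma disc_open (c z : C) (r : R) :
  disc c r z -> exists d, (0 < d)%R /\ forall y, disc z d y -> disc c r y.
Proof.
  intros H. unfold disc in *. exists (r - Cmod (z - c))%R; split; [lra|].
  intros y Hy. assert (T := Cmod_minus_triangle y z c). lra.
Qed.

Lemma is_Cderive_continuous (f : C -> C) (z a : C) : is_Cderive f z a -> Ccontinuous f z.
Proof.
  intros H. apply Ccontinuous_iff. intros eps Heps.
  rewrite is_Cderive_iff in H. destruct (H 1%R Rlt_0_1) as [d [Hd H1]].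
  apply locally_disc.
  assert (HA := Cmod_ge_0 a).
  assert (Q : (0 < eps / (1 + Cmod a))%R) by (apply Rdiv_lt_0_compat; lra).
  exists (Rmin d (eps / (1 + Cmod a))). split; [apply Rmin_pos; assumption|].
  intros y Hy. unfold disc in Hy.
  assert (Hy1 := Rlt_le_trans _ _ _ Hy (Rmin_l _ _)).
  assert (Hy2 := Rlt_le_trans _ _ _ Hy (Rmin_r _ _)).
  specialize (H1 y Hy1).
  replace (f y - f z) with ((f y - f z - a * (y - z)) + a * (y - z)) by ring.
  eapply Rle_lt_trans; [apply Cmod_triangle|]. rewrite Cmod_mult.
  apply Rmult_lt_compat_r with (r := (1 + Cmod a)%R) in Hy2; [|lra].
  replace (eps / (1 + Cmod a) * (1 + Cmod a))%R with eps in Hy2 by (field; lra).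
  lra.
Qed.

Lemma holomorphic_continuous (f : C -> C) (z : C) : holomorphic_at f z -> Ccontinuous f z.
Proof. intros [a H]. exact (is_Cderive_continuous f z a H). Qed.

Lemma Ccontinuous_lower_bound {T : UniformSpace} (f : T -> C) (x : T) :
  Ccontinuous f x -> f x <> 0 ->
  locally x (fun y => (Cmod (f x) / 2 < Cmod (f y))%R).
Proof.
  intros H N. apply Cmod_gt_0 in N.
  generalize (proj1 (Ccontinuous_iff f x) H (Cmod (f x) / 2)%R ltac:(lra)).
  apply filter_imp. intros y Hy.
  assert (T1 := Cmod_triangle_inv (f x) (f y)). rewrite Cmod_sym in T1. lra.
Qed.

Lemma Ccontinuous_neq0 {T : UniformSpace} (f : T -> C) (x : T) :
  Ccontinuous f x -> f x <> 0 -> locally x (fun y => f y <> 0).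
Proof.
  intros H N. generalize (Ccontinuous_lower_bound f x H N). apply filter_imp.
  intros y Hy E. rewrite E, Cmod_0 in Hy. apply Cmod_gt_0 in N. lra.
Qed.

Lemma Cinv_neq_0 (x : C) : x <> 0 -> / x <> 0.
Proof. intros H Q. apply C1_nz. rewrite <- (Cinv_r x H), Q. ring. Qed.

Lemma is_Cderive_inv (z : C) : z <> 0 -> is_Cderive Cinv z (- / (z * z)).
Proof.
  intros Hz. assert (Hm := proj1 (Cmod_gt_0 z) Hz).
  set (m := Cmod z) in *.
  apply is_Cderive_iff. intros eps Heps.
  assert (Q : (0 < eps * (m * m * m) / 2)%R).
  { assert (0 < m * m)%R by nra. assert (0 < m * m * m)%R by nra. nra. }
  (* The error is (y - z)^2 / (z^2 y). The first radius gives |y| > m / 2, so it is at most |y -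
     z|^2 * 2 / m^3, and the second radius makes this at most eps |y - z|. *)
  exists (Rmin (m / 2) (eps * (m * m * m) / 2)). split; [apply Rmin_pos; lra|].
  intros y Hy. unfold disc in Hy.
  assert (Hy1 := Rlt_le_trans _ _ _ Hy (Rmin_l _ _)).
  assert (Hy2 := Rlt_le_trans _ _ _ Hy (Rmin_r _ _)).
  assert (T := Cmod_triangle_inv z y). rewrite Cmod_sym in T.
  fold m in T.
  assert (Hmy : (m / 2 < Cmod y)%R) by lra.
  assert (Hy0 : y <> 0) by (apply Cmod_gt_0; lra).
  replace (/ y - / z - - / (z * z) * (y - z)) with ((y - z) * (y - z) * / (z * z * y)) 
    by (field; auto).
  rewrite !Cmod_mult, Cmod_inv by (repeat apply Cmult_neq_0; auto).
  rewrite !Cmod_mult. fold m. set (q := Cmod (y - z)) in *.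
  assert (0 <= q)%R by apply Cmod_ge_0.
  assert (Hi : (/ (m * m * Cmod y) <= 2 / (m * m * m))%R).
  { replace (2 / (m * m * m))%R with (/ (m * m * (m / 2)))%R by (field; lra).
    apply Rinv_le_contravar.
    - assert (0 < m * m)%R by nra. nra.
    - apply Rmult_le_compat_l; nra. }
  assert (q * (2 / (m * m * m)) <= eps)%R.
  { apply Rle_trans with (eps * (m * m * m) / 2 * (2 / (m * m * m)))%R.
    - apply Rmult_le_compat_r; [|lra]. apply Rlt_le, Rdiv_lt_0_compat; [lra|].
      assert (0 < m * m)%R by nra. nra.
    - right. field. lra. }
  assert (0 <= q * q)%R by nra.
  assert (q * q * / (m * m * Cmod y) <= q * q * (2 / (m * m * m)))%R
    by (apply Rmult_le_compat_l; assumption).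
  nra.
Qed.

Lemma is_Cderive_div (f g : C -> C) (z a b : C) :
  is_Cderive f z a -> is_Cderive g z b -> g z <> 0 ->
  is_Cderive (fun x => f x / g x) z ((a * g z - f z * b) / (g z * g z)).
Proof.
  intros Hf Hg N. unfold Cdiv at 1.
  eapply is_Cderive_eq.
  - apply is_Cderive_mult; [exact Hf|].
    apply (is_Cderive_comp Cinv g); [apply is_Cderive_inv; exact N|exact Hg].
  - cbv beta. field. exact N.
Qed.

Lemma holomorphic_const (c z : C) : holomorphic_at (fun _ => c) z.
Proof. exists (RtoC 0). apply is_Cderive_const. Qed.

Lemma holomorphic_id (z : C) : holomorphic_at (fun x => x) z.
Proof. exists (RtoC 1). apply is_Cderive_id. Qed.

Lemma holomorphic_plus (f g : C -> C) (z : C) :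
  holomorphic_at f z -> holomorphic_at g z -> holomorphic_at (fun x => f x + g x) z.
Proof. intros [a Ha] [b Hb]. eexists. apply (is_Cderive_plus f g); eassumption. Qed.

Lemma holomorphic_minus (f g : C -> C) (z : C) :
  holomorphic_at f z -> holomorphic_at g z -> holomorphic_at (fun x => f x - g x) z.
Proof. intros [a Ha] [b Hb]. eexists. apply (is_Cderive_minus f g); eassumption. Qed.

Lemma holomorphic_opp (f : C -> C) (z : C) :
  holomorphic_at f z -> holomorphic_at (fun x => - f x) z.
Proof. intros [a Ha]. eexists. apply (is_Cderive_opp f); eassumption. Qed.

Lemma holomorphic_mult (f g : C -> C) (z : C) :
  holomorphic_at f z -> holomorphic_at g z -> holomorphic_at (fun x => f x * g x) z.
Proof. intros [a Ha] [b Hb]. eexists. apply (is_Cderive_mult f g); eassumption. Qed.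

Lemma holomorphic_div (f g : C -> C) (z : C) :
  holomorphic_at f z -> holomorphic_at g z -> g z <> 0 ->
  holomorphic_at (fun x => f x / g x) z.
Proof. intros [a Ha] [b Hb] N. eexists. apply (is_Cderive_div f g); eassumption. Qed.

Lemma holomorphic_comp (f g : C -> C) (z : C) :
  holomorphic_at f (g z) -> holomorphic_at g z -> holomorphic_at (fun x => f (g x)) z.
Proof. intros [a Ha] [b Hb]. eexists. apply (is_Cderive_comp f g); eassumption. Qed.

Lemma holomorphic_pow (f : C -> C) (n : nat) (z : C) :
  holomorphic_at f z -> holomorphic_at (fun x => f x ^ n) z.
Proof.
  intros H. induction n as [|n IH]; simpl.
  - apply holomorphic_const.
  - apply (holomorphic_mult f (fun x => f x ^ n)); assumption.
Qed.

Lemma holomorphic_ext_disc (f g : C -> C) (z : C) (d : R) :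
  (0 < d)%R -> (forall y, disc z d y -> f y = g y) -> holomorphic_at f z -> holomorphic_at g z.
Proof. intros Hd H [a Ha]. exists a. eapply is_Cderive_ext_disc; eassumption. Qed.

Lemma holomorphic_ext (f g : C -> C) (z : C) :
  (forall y, f y = g y) -> holomorphic_at f z -> holomorphic_at g z.
Proof. intros H. apply (holomorphic_ext_disc f g z 1 Rlt_0_1). auto. Qed.

Lemma path_derive_comp (f : C -> C) (p : R -> C) (t : R) (a b : C) :
  is_Cderive f (p t) a -> is_path_derive p t b -> is_path_derive (fun s => f (p s)) t (a * b).
Proof.
  rewrite is_Cderive_iff, !is_path_derive_iff. intros Hf Hp eps Heps.
  assert (HA := Cmod_ge_0 a). assert (HB := Cmod_ge_0 b).
  (* The error of the composition is at most e1 |p s - p t| + |a| e2 h, where |p s - p t| <= (|b| +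
     1) h because e2 <= 1; each term is kept below eps h / 2. *)
  set (e1 := (eps / (2 * (Cmod b + 1)))%R).
  set (e2 := Rmin 1 (eps / (2 * (Cmod a + 1)))).
  assert (He1 : (0 < e1)%R) by (apply Rdiv_lt_0_compat; lra).
  assert (He2 : (0 < e2)%R) by (apply Rmin_pos; [lra|apply Rdiv_lt_0_compat; lra]).
  destruct (Hf e1 He1) as [d1 [Hd1 H1]].
  destruct (Hp e2 He2) as [d2 [Hd2 H2]].
  assert (Q : (0 < d1 / (Cmod b + 1))%R) by (apply Rdiv_lt_0_compat; lra).
  exists (Rmin d2 (d1 / (Cmod b + 1))). split; [apply Rmin_pos; assumption|].
  intros s Hs.
  assert (Hs1 := Rlt_le_trans _ _ _ Hs (Rmin_l _ _)).
  assert (Hs2 := Rlt_le_trans _ _ _ Hs (Rmin_r _ _)).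
  specialize (H2 s Hs1). set (h := Rabs (s - t)) in *.
  assert (0 <= h)%R by apply Rabs_pos.
  assert (L : (Cmod (p s - p t) <= (Cmod b + 1) * h)%R).
  { replace (p s - p t) with ((p s - p t - b * RtoC (s - t)) + b * RtoC (s - t)) by ring.
    eapply Rle_trans; [apply Cmod_triangle|]. rewrite Cmod_mult, Cmod_R. fold h.
    assert (e2 <= 1)%R by apply Rmin_l. nra. }
  assert (L2 : (Cmod (p s - p t) < d1)%R).
  { eapply Rle_lt_trans; [exact L|].
    apply Rmult_lt_compat_r with (r := (Cmod b + 1)%R) in Hs2; [|lra].
    replace (d1 / (Cmod b + 1) * (Cmod b + 1))%R with d1 in Hs2 by (field; lra). lra. }
  specialize (H1 (p s) L2).
  replace (f (p s) - f (p t) - a * b * RtoC (s - t)) with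
    ((f (p s) - f (p t) - a * (p s - p t)) + a * (p s - p t - b * RtoC (s - t))) by ring.
  eapply Rle_trans; [apply Cmod_triangle|]. rewrite Cmod_mult.
  assert (E1 : (e1 * ((Cmod b + 1) * h) = eps / 2 * h)%R) by (unfold e1; field; lra).
  assert (E2 : (e2 * (Cmod a + 1) <= eps / 2)%R).
  { apply Rle_trans with (eps / (2 * (Cmod a + 1)) * (Cmod a + 1))%R.
    - apply Rmult_le_compat_r; [lra|apply Rmin_r].
    - right. field. lra. }
  assert (K1 : (e1 * Cmod (p s - p t) <= eps / 2 * h)%R).
  { rewrite <- E1. apply Rmult_le_compat_l; lra. }
  assert (K2 : (Cmod a * Cmod (p s - p t - b * RtoC (s - t)) <= eps / 2 * h)%R).
  { apply Rle_trans with (Cmod a * (e2 * h))%R; [apply Rmult_le_compat_l; assumption|].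
    apply Rle_trans with ((e2 * (Cmod a + 1)) * h)%R; [nra|].
    apply Rmult_le_compat_r; assumption. }
  lra.
Qed.

Lemma path_derive_line (a b : C) (t : R) :
  is_path_derive (fun s => a + RtoC s * b) t b.
Proof.
  apply is_path_derive_iff. intros eps Heps. exists 1%R; split; [lra|]. intros s _.
  replace (a + s * b - (a + t * b) - b * RtoC (s - t)) with (RtoC 0)
    by (rewrite RtoC_minus; ring).
  rewrite Cmod_0. apply Rmult_le_pos; [lra|apply Rabs_pos].
Qed.

Lemma im_le_Cmod (x : C) : (Rabs (Im x) <= Cmod x)%R.
Proof. eapply Rle_trans; [apply Rmax_r|apply Rmax_Cmod]. Qed.

(** [phi] stands for [Re] or [Im], a real-linear functional of norm at most 1. *)
Lemma path_derive_component (phi : C -> R) (f : R -> C) (t : R) (l : C) :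
  (forall x, (Rabs (phi x) <= Cmod x)%R) ->
  (forall x y z (k : R), phi (x - y - z * k) = (phi x - phi y - k * phi z)%R) ->
  is_path_derive f t l -> is_derive (fun s => phi (f s)) t (phi l).
Proof.
  intros Hb Hl H. rewrite is_path_derive_iff in H.
  split; [apply is_linear_scal_l|]. intros x Hx.
  assert (E' := is_filter_lim_locally_unique (V := AbsRing_NormedModule R_AbsRing) t x Hx).
  subst x. intros eps. destruct (H eps (cond_pos eps)) as [d [Hd H1]].
  exists (mkposreal d Hd). intros y Hy. specialize (H1 y Hy).
  eapply Rle_trans; [|exact H1]. eapply Rle_trans; [|apply Hb]. rewrite Hl. right. reflexivity.
Qed.

Lemma real_derive_zero (f : R -> R) (a b : R) :
  (a <= b)%R -> (forall t, (a <= t <= b)%R -> is_derive f t 0%R) -> f a = f b.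
Proof.
  intros Hab H.
  destruct (MVT_gen f a b (fun _ => 0%R)) as [c [_ Hc]].
  - intros t. rewrite Rmin_left, Rmax_right by assumption. intros Ht. apply H. lra.
  - intros t. rewrite Rmin_left, Rmax_right by assumption. intros Ht.
    apply continuity_pt_filterlim.
    apply (ex_derive_continuous (V := R_NormedModule)). exists 0%R. apply H, Ht.
  - lra.
Qed.

Lemma path_derive_zero (f : R -> C) (a b : R) :
  (a <= b)%R -> (forall t, (a <= t <= b)%R -> is_path_derive f t 0) -> f a = f b.
Proof.
  intros Hab H.
  assert (E1 : Re (f a) = Re (f b)).
  { apply (real_derive_zero (fun s => Re (f s)) a b Hab). intros t Ht.
    apply (path_derive_component Re f t 0 re_le_Cmod); [|apply H, Ht].
    intros x y z k. unfold Re; simpl. ring. }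
  assert (E2 : Im (f a) = Im (f b)).
  { apply (real_derive_zero (fun s => Im (f s)) a b Hab). intros t Ht.
    apply (path_derive_component Im f t 0 im_le_Cmod); [|apply H, Ht].
    intros x y z k. unfold Im; simpl. ring. }
  unfold Re, Im in *. destruct (f a), (f b); simpl in *. subst; reflexivity.
Qed.

Lemma disc_convex (c a b : C) (r t : R) :
  disc c r a -> disc c r b -> (0 <= t <= 1)%R -> disc c r (a + RtoC t * (b - a)).
Proof.
  unfold disc. intros Ha Hb Ht.
  replace (a + RtoC t * (b - a) - c) with (RtoC (1 - t) * (a - c) + RtoC t * (b - c))
    by (rewrite RtoC_minus; ring).
  eapply Rle_lt_trans; [apply Cmod_triangle|]. rewrite !Cmod_scal.
  rewrite !Rabs_pos_eq by lra.
  destruct (Req_dec t 0) as [E|E]; [subst; lra|].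
  assert (t * Cmod (b - c) < t * r)%R by (apply Rmult_lt_compat_l; lra).
  assert ((1 - t) * Cmod (a - c) <= (1 - t) * r)%R by (apply Rmult_le_compat_l; lra).
  lra.
Qed.

(** Along the segment from a to b, which stays in the disc, f is a path with derivative zero. *)
Lemma derive_zero_const (c : C) (r : R) (f : C -> C) (a b : C) :
  (forall z, disc c r z -> is_Cderive f z 0) -> disc c r a -> disc c r b -> f a = f b.
Proof.
  intros H Ha Hb.
  assert (E : (fun s => f (a + RtoC s * (b - a))) 0%R = (fun s => f (a + RtoC s * (b - a))) 1%R).
  { apply (path_derive_zero (fun s => f (a + RtoC s * (b - a))) 0 1); [lra|]. intros t Ht.
    replace (RtoC 0) with (0 * (b - a)) by ring.
    apply (path_derive_comp f); [|apply path_derive_line].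
    apply H. apply disc_convex; assumption. }
  simpl in E. replace (a + 0 * (b - a)) with a in E by ring.
  replace (a + 1 * (b - a)) with b in E by ring. exact E.
Qed.

Lemma entire_derive_zero_const (f : C -> C) (a b : C) :
  (forall z, is_Cderive f z 0) -> f a = f b.
Proof.
  intros H. assert (Ha := Cmod_ge_0 (b - a)).
  apply (derive_zero_const a (Cmod (b - a) + 1) f); [auto| |].
  - apply disc_center. lra.
  - unfold disc. lra.
Qed.

(* The indicator function of a clopen set has derivative zero. *)
Lemma clopen_plane (P : C -> Prop) (a b : C) :
  (forall z, P z -> locally z P) -> (forall z, ~ P z -> locally z (fun y => ~ P y)) ->
  P a -> P b.
Proof.
  intros H1 H2 Pa. apply NNPP. intros Pb.
  set (f := fun z => if excluded_middle_informative (P z) then RtoC 1 else RtoC 0).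
  assert (E : f a = f b).
  { apply entire_derive_zero_const. intros z.
    destruct (classic (P z)) as [Q|Q].
    - destruct (proj1 (locally_disc _ _) (H1 z Q)) as [d [Hd H]].
      apply (is_Cderive_ext_disc (fun _ => RtoC 1) f z 0 d Hd); [|apply is_Cderive_const].
      intros y Hy. unfold f. destruct excluded_middle_informative as [G|G]; [reflexivity|].
      destruct (G (H y Hy)).
    - destruct (proj1 (locally_disc _ _) (H2 z Q)) as [d [Hd H]].
      apply (is_Cderive_ext_disc (fun _ => RtoC 0) f z 0 d Hd); [|apply is_Cderive_const].
      intros y Hy. unfold f. destruct excluded_middle_informative as [G|G]; [|reflexivity].
      destruct (H y Hy G). }
  unfold f in E. destruct excluded_middle_informative as [G|G]; [|auto].
  destruct excluded_middle_informative as [G'|G']; [auto|]. exact (C1_nz E).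
Qed.

(** * The exponential and integrals of complex paths *)

Definition Cexp (z : C) : C := ((exp (Re z) * cos (Im z))%R, (exp (Re z) * sin (Im z))%R).

Lemma Cexp_0 : Cexp 0 = 1.
Proof.
  unfold Cexp, Re, Im; simpl. rewrite exp_0, cos_0, sin_0. unfold RtoC. f_equal; ring.
Qed.

Lemma Cexp_plus (a b : C) : Cexp (a + b) = Cexp a * Cexp b.
Proof.
  unfold Cexp, Re, Im, Cplus, Cmult; simpl. rewrite exp_plus, cos_plus, sin_plus.
  f_equal; ring.
Qed.

Lemma Cexp_opp_r (a : C) : Cexp a * Cexp (- a) = 1.
Proof. rewrite <- Cexp_plus. replace (a + - a) with (RtoC 0) by ring. apply Cexp_0. Qed.

Lemma Cexp_neq_0 (a : C) : Cexp a <> 0.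
Proof.
  intros E. assert (H := Cexp_opp_r a). rewrite E in H.
  replace (0 * Cexp (- a)) with (RtoC 0) in H by ring.
  apply (f_equal fst) in H. simpl in H. lra.
Qed.

Lemma Cmult_Cexp_eq_0 (x a : C) : x * Cexp a = 0 -> x = 0.
Proof. intros E. apply NNPP. intros N. exact (Cmult_neq_0 _ _ N (Cexp_neq_0 a) E). Qed.

Lemma Cmod_Cexp (a : C) : Cmod (Cexp a) = exp (Re a).
Proof.
  unfold Cmod, Cexp; simpl.
  assert (H := sin2_cos2 (Im a)). unfold Rsqr in H.
  replace (exp (Re a) * cos (Im a) * (exp (Re a) * cos (Im a) * 1) +
    exp (Re a) * sin (Im a) * (exp (Re a) * sin (Im a) * 1))%R
    with (Rsqr (exp (Re a))).
  - apply sqrt_Rsqr. left; apply exp_pos.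
  - unfold Rsqr. transitivity (exp (Re a) * exp (Re a) * (sin (Im a) * sin (Im a) + cos (Im a) *
    cos (Im a)))%R.
    + rewrite H. ring.
    + ring.
Qed.

Lemma derivable_pt_lim_0_bound (f : R -> R) (l : R) :
  derivable_pt_lim f 0 l ->
  forall eps, (0 < eps)%R -> exists d, (0 < d)%R /\
    forall x, (Rabs x < d)%R -> (Rabs (f x - f 0 - l * x) <= eps * Rabs x)%R.
Proof.
  intros H eps Heps. destruct (H eps Heps) as [d Hd].
  exists d; split; [apply cond_pos|]. intros x Hx.
  destruct (Req_dec x 0) as [E|E].
  - subst x. replace (f 0 - f 0 - l * 0)%R with 0%R by ring. rewrite Rabs_R0. lra.
  - specialize (Hd x E Hx). rewrite Rplus_0_l in Hd.
    replace (f x - f 0 - l * x)%R with (((f x - f 0) / x - l) * x)%R by (field; exact E).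
    rewrite Rabs_mult. apply Rmult_le_compat_r; [apply Rabs_pos|lra].
Qed.

Lemma Cmod_le_abs (x : C) : (Cmod x <= Rabs (Re x) + Rabs (Im x))%R.
Proof.
  replace x with (RtoC (Re x) + Ci * RtoC (Im x)) at 1.
  - eapply Rle_trans; [apply Cmod_triangle|]. rewrite Cmod_mult, Cmod_Ci, !Cmod_R. lra.
  - destruct x. unfold Cplus, Cmult, Ci, RtoC, Re, Im; simpl. f_equal; ring.
Qed.

(** Since exp (z + h) = exp z exp h, only the behaviour at 0 matters, and there it follows from the
    derivatives of the real exp, cos and sin. *)
Lemma is_Cderive_Cexp (z : C) : is_Cderive Cexp z (Cexp z).
Proof.
  apply is_Cderive_iff. intros eps Heps.
  assert (HK : (0 < Cmod (Cexp z))%R) by (rewrite Cmod_Cexp; apply exp_pos).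
  set (K := Cmod (Cexp z)) in *.
  (* With K = |exp z| factored out, the error at 0 will be at most 10 e |h|; the constant 20 leaves
     a margin of 2. *)
  set (e := Rmin 1 (eps / (K * 20))).
  assert (He : (0 < e)%R) by (apply Rmin_pos; [lra|apply Rdiv_lt_0_compat; nra]).
  destruct (derivable_pt_lim_0_bound exp 1) with (eps := e) as [d1 [Hd1 H1]]; auto.
  { assert (G := derivable_pt_lim_exp 0). rewrite exp_0 in G. exact G. }
  destruct (derivable_pt_lim_0_bound cos 0) with (eps := e) as [d2 [Hd2 H2]]; auto.
  { assert (G := derivable_pt_lim_cos 0). rewrite sin_0, Ropp_0 in G. exact G. }
  destruct (derivable_pt_lim_0_bound sin 1) with (eps := e) as [d3 [Hd3 H3]]; auto.
  { assert (G := derivable_pt_lim_sin 0). rewrite cos_0 in G. exact G. }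
  set (d := Rmin (Rmin d1 d2) (Rmin d3 e)).
  assert (Hd : (0 < d)%R) by (apply Rmin_pos; apply Rmin_pos; assumption).
  exists d; split; [exact Hd|]. intros y Hy. unfold disc in Hy.
  assert (Hm1 : (d <= d1)%R) by (unfold d; eapply Rle_trans; [apply Rmin_l|apply Rmin_l]).
  assert (Hm2 : (d <= d2)%R) by (unfold d; eapply Rle_trans; [apply Rmin_l|apply Rmin_r]).
  assert (Hm3 : (d <= d3)%R) by (unfold d; eapply Rle_trans; [apply Rmin_r|apply Rmin_l]).
  assert (Hm4 : (d <= e)%R) by (unfold d; eapply Rle_trans; [apply Rmin_r|apply Rmin_r]).
  set (h := y - z) in *.
  replace y with (z + h) by (unfold h; ring).
  rewrite Cexp_plus.
  replace (Cexp z * Cexp h - Cexp z - Cexp z * h) with (Cexp z * (Cexp h - 1 - h)) by ring.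
  rewrite Cmod_mult. fold K.
  assert (Hx := re_le_Cmod h). assert (Hi := im_le_Cmod h).
  set (m := Cmod h) in *. set (x := Re h) in *. set (t := Im h) in *.
  assert (He1 : (e <= 1)%R) by apply Rmin_l.
  assert (A1 : (Rabs (exp x - 1 - x) <= e * m)%R).
  { assert (G := H1 x ltac:(lra)). rewrite exp_0, Rmult_1_l in G.
    eapply Rle_trans; [exact G|]. apply Rmult_le_compat_l; lra. }
  assert (A2 : (Rabs (cos t - 1) <= e * m)%R).
  { assert (G := H2 t ltac:(lra)). rewrite cos_0, Rmult_0_l, Rminus_0_r in G.
    eapply Rle_trans; [exact G|]. apply Rmult_le_compat_l; lra. }
  assert (A3 : (Rabs (sin t - t) <= e * m)%R).
  { assert (G := H3 t ltac:(lra)). rewrite sin_0, Rmult_1_l, Rminus_0_r in G.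
    eapply Rle_trans; [exact G|]. apply Rmult_le_compat_l; lra. }
  assert (M0 : (0 <= m)%R) by apply Cmod_ge_0.
  assert (A4 : (Rabs (exp x - 1) <= 2 * m)%R).
  { replace (exp x - 1)%R with ((exp x - 1 - x) + x)%R by ring.
    eapply Rle_trans; [apply Rabs_triang|]. nra. }
  assert (A5 : (Rabs (exp x) <= 3)%R).
  { replace (exp x)%R with ((exp x - 1) + 1)%R by ring.
    eapply Rle_trans; [apply Rabs_triang|]. rewrite Rabs_R1. lra. }
  assert (B : (Cmod (Cexp h - 1 - h) <= e * m * 10)%R).
  { eapply Rle_trans; [apply Cmod_le_abs|].
    assert (P1 : Re (Cexp h - 1 - h) = (exp x * (cos t - 1) + (exp x - 1 - x))%R).
    { unfold x, t, Cexp, Cminus, Cplus, Copp, Re, Im; simpl. ring. }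
    assert (P2 : Im (Cexp h - 1 - h) = (exp x * (sin t - t) + t * (exp x - 1))%R).
    { unfold x, t, Cexp, Cminus, Cplus, Copp, Re, Im; simpl. ring. }
    rewrite P1, P2.
    assert (Q1 := Rabs_triang (exp x * (cos t - 1)) (exp x - 1 - x)).
    assert (Q2 := Rabs_triang (exp x * (sin t - t)) (t * (exp x - 1))).
    rewrite Rabs_mult in Q1. rewrite !Rabs_mult in Q2.
    assert (Rabs (exp x) * Rabs (cos t - 1) <= 3 * (e * m))%R
      by (apply Rmult_le_compat; auto; apply Rabs_pos).
    assert (Rabs (exp x) * Rabs (sin t - t) <= 3 * (e * m))%R
      by (apply Rmult_le_compat; auto; apply Rabs_pos).
    assert (Rabs t * Rabs (exp x - 1) <= e * (2 * m))%R
      by (apply Rmult_le_compat; auto; try apply Rabs_pos; lra).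
    assert (0 <= e * m)%R by (apply Rmult_le_pos; lra). lra. }
  apply Rle_trans with (K * (e * m * 10))%R; [apply Rmult_le_compat_l; lra|].
  assert (e * (K * 20) <= eps)%R.
  { apply Rle_trans with (eps / (K * 20) * (K * 20))%R.
    - apply Rmult_le_compat_r; [nra|apply Rmin_r].
    - right. field. lra. }
  assert (0 <= e * K)%R by nra. nra.
Qed.

Lemma holomorphic_Cexp (f : C -> C) (z : C) :
  holomorphic_at f z -> holomorphic_at (fun x => Cexp (f x)) z.
Proof. apply (holomorphic_comp Cexp f). exists (Cexp (f z)). apply is_Cderive_Cexp. Qed.

(** l = ln |c| + i t, where t is the arc cosine of Re c / |c|, with its sign reversed when Im c <
    0. *)
Lemma Cexp_surj (c : C) : c <> 0 -> exists l, Cexp l = c.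
Proof.
  intros N. assert (Hm := proj1 (Cmod_gt_0 c) N).
  set (x := (Re c / Cmod c)%R). set (y := (Im c / Cmod c)%R).
  assert (U : (x * x + y * y = 1)%R).
  { unfold x, y. assert (H := Cmod2_alt c). simpl in H.
    replace (Re c / Cmod c * (Re c / Cmod c) + Im c / Cmod c * (Im c / Cmod c))%R
      with ((Re c * (Re c * 1) + Im c * (Im c * 1)) / (Cmod c * (Cmod c * 1)))%R by (field; lra).
    rewrite <- H. field. lra. }
  assert (Hx : (-1 <= x <= 1)%R) by nra.
  assert (T : exists t, cos t = x /\ sin t = y).
  { assert (C1 := cos_acos x Hx). assert (S1 := sin_acos x Hx).
    assert (S2 : (sqrt (1 - Rsqr x) = Rabs y)%R).
    { replace (1 - Rsqr x)%R with (Rsqr y) by (unfold Rsqr; lra). apply sqrt_Rsqr_abs. }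
    destruct (Rle_dec 0 y) as [Hy|Hy].
    - exists (acos x). split; [exact C1|]. rewrite S1, S2. apply Rabs_pos_eq. exact Hy.
    - exists (- acos x)%R. rewrite cos_neg, sin_neg. split; [exact C1|].
      rewrite S1, S2, Rabs_left by lra. ring. }
  destruct T as [t [Ht1 Ht2]].
  exists (ln (Cmod c), t). unfold Cexp, Re, Im; simpl.
  rewrite exp_ln by exact Hm. rewrite Ht1, Ht2. unfold x, y.
  destruct c as [u v]. unfold Re, Im; simpl. f_equal; field; lra.
Qed.

(** * Continuity of complex-valued functions *)

Lemma Ccontinuous_const {T : UniformSpace} (c : C) (x : T) : Ccontinuous (fun _ : T => c) x.
Proof. apply continuous_const. Qed.

Lemma Ccontinuous_plus {T : UniformSpace} (f g : T -> C) (x : T) :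
  Ccontinuous f x -> Ccontinuous g x -> Ccontinuous (fun t => f t + g t) x.
Proof.
  intros Hf Hg. apply (continuous_plus (V := C_NormedModule)); assumption.
Qed.

Lemma Ccontinuous_minus {T : UniformSpace} (f g : T -> C) (x : T) :
  Ccontinuous f x -> Ccontinuous g x -> Ccontinuous (fun t => f t - g t) x.
Proof. apply (continuous_minus (V := C_NormedModule)). Qed.

Lemma Ccontinuous_comp {T : UniformSpace} (f : C -> C) (g : T -> C) (x : T) :
  Ccontinuous g x -> continuous (T := C_UniformSpace) (U := C_UniformSpace) f (g x) -> Ccontinuous
    (fun t => f (g t)) x.
Proof. apply (continuous_comp (U := T) (V := C_UniformSpace) (W := C_UniformSpace)). Qed.

Lemma Ccontinuous_mult {T : UniformSpace} (f g : T -> C) (x : T) :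
  Ccontinuous f x -> Ccontinuous g x -> Ccontinuous (fun t => f t * g t) x.
Proof.
  intros Hf Hg. rewrite Ccontinuous_iff in *. intros eps Heps.
  assert (HA := Cmod_ge_0 (f x)). assert (HB := Cmod_ge_0 (g x)).
  set (D := (Cmod (f x) + Cmod (g x) + 1)%R).
  set (e := Rmin 1 (eps / D)).
  assert (He : (0 < e)%R) by (apply Rmin_pos; [lra|apply Rdiv_lt_0_compat; unfold D; lra]).
  assert (HeD : (e * D <= eps)%R).
  { apply Rle_trans with (eps / D * D)%R.
    - apply Rmult_le_compat_r; [unfold D; lra|apply Rmin_r].
    - right. field. unfold D; lra. }
  generalize (filter_and _ _ (Hf e He) (Hg e He)). apply filter_imp. intros y [H1 H2].
  replace (f y * g y - f x * g x)
    with ((f y - f x) * (g y - g x) + (f y - f x) * g x + f x * (g y - g x)) by ring.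
  eapply Rle_lt_trans; [apply Cmod_triangle|].
  assert (T1 := Cmod_triangle ((f y - f x) * (g y - g x)) ((f y - f x) * g x)).
  rewrite !Cmod_mult in *.
  assert (e <= 1)%R by apply Rmin_l.
  assert (0 <= Cmod (f y - f x))%R by apply Cmod_ge_0.
  assert (0 <= Cmod (g y - g x))%R by apply Cmod_ge_0.
  unfold D in HeD. nra.
Qed.

Lemma Ccontinuous_inv {T : UniformSpace} (f : T -> C) (x : T) :
  Ccontinuous f x -> f x <> 0 -> Ccontinuous (fun t => / f t) x.
Proof.
  intros Hf N. apply (Ccontinuous_comp Cinv f x Hf).
  apply (is_Cderive_continuous Cinv _ _ (is_Cderive_inv (f x) N)).
Qed.

Lemma Ccontinuous_div {T : UniformSpace} (f g : T -> C) (x : T) :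
  Ccontinuous f x -> Ccontinuous g x -> g x <> 0 -> Ccontinuous (fun t => f t / g t) x.
Proof. intros Hf Hg N. apply Ccontinuous_mult; [exact Hf|apply Ccontinuous_inv; assumption]. Qed.

Lemma path_derive_continuous (f : R -> C) (t : R) (l : C) :
  is_path_derive f t l -> Ccontinuous f t.
Proof.
  intros H. apply (ex_derive_continuous (V := C_R_NormedModule)). exists l. exact H.
Qed.

Lemma Ccontinuous_line (a b : C) (t : R) : Ccontinuous (fun s : R => a + RtoC s * b) t.
Proof. exact (path_derive_continuous _ _ _ (path_derive_line a b t)). Qed.

(** * Integrals of complex-valued functions of a real variable *)

Notation is_Cint f a b l := (is_RInt (V := C_R_NormedModule) f a b (l%C : C)).
Notation ex_Cint f a b := (ex_RInt (V := C_R_NormedModule) f a b).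
Notation Cint f a b := (RInt (V := C_R_CompleteNormedModule) f a b : C).

Lemma Cint_correct (f : R -> C) (a b : R) : ex_Cint f a b -> is_Cint f a b (Cint f a b).
Proof. apply (RInt_correct (V := C_R_CompleteNormedModule)). Qed.

Lemma Cint_unique (f : R -> C) (a b : R) (l : C) : is_Cint f a b l -> Cint f a b = l.
Proof. apply (is_RInt_unique (V := C_R_CompleteNormedModule)). Qed.

Lemma ex_Cint_continuous (f : R -> C) (a b : R) : (a <= b)%R ->
  (forall t, (a <= t <= b)%R -> Ccontinuous f t) -> ex_Cint f a b.
Proof.
  intros Hab H. apply (ex_RInt_continuous (V := C_R_CompleteNormedModule)).
  intros t. rewrite Rmin_left, Rmax_right by exact Hab. apply H.
Qed.

(** The integral is taken in [C] as a real module, where linearity pulls out real factors; for a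
    complex factor the real and imaginary parts are treated separately. *)
Lemma is_Cint_scal (f : R -> C) (a b : R) (k l : C) :
  is_Cint f a b l -> is_Cint (fun t => k * f t) a b (k * l).
Proof.
  intros H.
  assert (H1 := is_RInt_fct_extend_fst (U := R_NormedModule) (V := R_NormedModule) _ _ _ _ H).
  assert (H2 := is_RInt_fct_extend_snd (U := R_NormedModule) (V := R_NormedModule) _ _ _ _ H).
  destruct k as [k1 k2], l as [l1 l2].
  apply (is_RInt_fct_extend_pair (U := R_NormedModule) (V := R_NormedModule)); simpl in *.
  - apply (is_RInt_minus (V := R_NormedModule)
      (fun t => k1 * fst (f t))%R (fun t => k2 * snd (f t))%R a b (k1 * l1)%R (k2 * l2)%R).
    + apply (is_RInt_scal (V := R_NormedModule) _ a b k1 l1 H1).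
    + apply (is_RInt_scal (V := R_NormedModule) _ a b k2 l2 H2).
  - apply (is_RInt_plus (V := R_NormedModule)
      (fun t => k1 * snd (f t))%R (fun t => k2 * fst (f t))%R a b (k1 * l2)%R (k2 * l1)%R).
    + apply (is_RInt_scal (V := R_NormedModule) _ a b k1 l2 H2).
    + apply (is_RInt_scal (V := R_NormedModule) _ a b k2 l1 H1).
Qed.

Lemma Cint_scal (f : R -> C) (a b : R) (k : C) :
  ex_Cint f a b -> Cint (fun t => k * f t) a b = k * Cint f a b.
Proof. intros H. apply Cint_unique, is_Cint_scal, Cint_correct, H. Qed.

Lemma Cint_plus (f g : R -> C) (a b : R) :
  ex_Cint f a b -> ex_Cint g a b -> Cint (fun t => f t + g t) a b = Cint f a b + Cint g a b.
Proof. apply (RInt_plus (V := C_R_CompleteNormedModule)). Qed.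

Lemma Cint_minus (f g : R -> C) (a b : R) :
  ex_Cint f a b -> ex_Cint g a b -> Cint (fun t => f t - g t) a b = Cint f a b - Cint g a b.
Proof. apply (RInt_minus (V := C_R_CompleteNormedModule)). Qed.

Lemma Cint_ext (f g : R -> C) (a b : R) : (a <= b)%R ->
  (forall t, (a <= t <= b)%R -> f t = g t) -> Cint f a b = Cint g a b.
Proof.
  intros Hab H. apply (RInt_ext (V := C_R_CompleteNormedModule)).
  intros t. rewrite Rmin_left, Rmax_right by exact Hab. intros Ht. apply H. lra.
Qed.

Lemma Cmod_Cint_le (f : R -> C) (a b M : R) : (a <= b)%R -> ex_Cint f a b ->
  (forall t, (a <= t <= b)%R -> (Cmod (f t) <= M)%R) -> (Cmod (Cint f a b) <= (b - a) * M)%R.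
Proof.
  intros Hab He H. rewrite <- norm_C_R.
  apply (norm_RInt_le_const (V := C_R_NormedModule) f a b _ M Hab).
  - intros t Ht. rewrite norm_C_R. apply H, Ht.
  - apply Cint_correct, He.
Qed.

Lemma Cint_derive (f df : R -> C) (a b : R) : (a <= b)%R ->
  (forall t, (a <= t <= b)%R -> is_path_derive f t (df t)) ->
  (forall t, (a <= t <= b)%R -> Ccontinuous df t) ->
  Cint df a b = f b - f a.
Proof.
  intros Hab H1 H2. apply Cint_unique.
  apply (is_RInt_derive (V := C_R_CompleteNormedModule) f df a b);
    intros t; rewrite Rmin_left, Rmax_right by exact Hab; auto.
Qed.

Lemma ex_Cint_circle (f : R -> C) : (forall t, Ccontinuous f t) -> ex_Cint f 0 (2 * PI).
Proof. intros H. assert (P := PI_RGT_0). apply ex_Cint_continuous; [lra|auto]. Qed.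

Lemma Cint_const (a b : R) (k : C) : Cint (fun _ => k) a b = RtoC (b - a) * k.
Proof.
  rewrite (RInt_const (V := C_R_CompleteNormedModule)).
  unfold scal; simpl. unfold prod_scal, scal; simpl; unfold mult; simpl.
  destruct k. unfold Cmult, RtoC; simpl. f_equal; ring.
Qed.

(** * Goursat's theorem and primitives *)

(** The integral of f(z) dz along the straight segment from a to b. *)
Definition seg (f : C -> C) (a b : C) : C :=
  (b - a) * Cint (fun t => f (a + RtoC t * (b - a))) 0 1.

Definition continuous_on (U : C -> Prop) (f : C -> C) : Prop :=
  forall z, U z -> Ccontinuous f z.

Lemma holomorphic_on_continuous (U : C -> Prop) (f : C -> C) :
  holomorphic_on U f -> continuous_on U f.
Proof. intros H z Hz. apply holomorphic_continuous, H, Hz. Qed.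

Section Segments.

Variables (c : C) (r : R).

Lemma seg_continuous (f : C -> C) (a b : C) :
  continuous_on (disc c r) f -> disc c r a -> disc c r b ->
  forall t, (0 <= t <= 1)%R -> Ccontinuous (fun t => f (a + RtoC t * (b - a))) t.
Proof.
  intros H Ha Hb t Ht. apply (Ccontinuous_comp f).
  - apply Ccontinuous_line.
  - apply H, disc_convex; assumption.
Qed.

Lemma ex_seg (f : C -> C) (a b : C) :
  continuous_on (disc c r) f -> disc c r a -> disc c r b ->
  ex_Cint (fun t => f (a + RtoC t * (b - a))) 0 1.
Proof. intros H Ha Hb. apply ex_Cint_continuous; [lra|]. apply seg_continuous; assumption. Qed.

Lemma seg_derive (f F : C -> C) (a b : C) :
  continuous_on (disc c r) f ->
  (forall z, disc c r z -> is_Cderive F z (f z)) ->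
  disc c r a -> disc c r b -> seg f a b = F b - F a.
Proof.
  intros Hf HF Ha Hb. unfold seg. rewrite <- Cint_scal by (apply ex_seg; assumption).
  rewrite (Cint_derive (fun t => F (a + RtoC t * (b - a)))).
  - f_equal; [f_equal; ring|]. f_equal. f_equal. ring.
  - lra.
  - intros t Ht. rewrite Cmult_comm. apply (path_derive_comp F); [|apply path_derive_line].
    apply HF, disc_convex; assumption.
  - intros t Ht. apply Ccontinuous_mult; [apply Ccontinuous_const|].
    apply seg_continuous; assumption.
Qed.

Lemma seg_minus (f g : C -> C) (a b : C) :
  continuous_on (disc c r) f -> continuous_on (disc c r) g -> disc c r a -> disc c r b ->
  seg (fun z => f z - g z) a b = seg f a b - seg g a b.
Proof.
  intros Hf Hg Ha Hb. unfold seg. rewrite Cint_minus by (apply ex_seg; assumption). ring.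
Qed.

Lemma seg_bound (f : C -> C) (a b : C) (M : R) :
  continuous_on (disc c r) f -> disc c r a -> disc c r b ->
  (forall t, (0 <= t <= 1)%R -> (Cmod (f (a + RtoC t * (b - a))%C) <= M)%R) ->
  (Cmod (seg f a b) <= M * Cmod (b - a))%R.
Proof.
  intros Hf Ha Hb H. unfold seg. rewrite Cmod_mult.
  assert (G := Cmod_Cint_le _ 0 1 M ltac:(lra) (ex_seg f a b Hf Ha Hb) H).
  rewrite Rmult_comm. apply Rmult_le_compat_r; [apply Cmod_ge_0|]. lra.
Qed.

Lemma Cint_comp_lin (f : R -> C) (u v a b : R) :
  ex_Cint f (u * a + v) (u * b + v) ->
  Cint (fun t => RtoC u * f (u * t + v)%R) a b = Cint f (u * a + v) (u * b + v).
Proof.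
  intros H. rewrite <- (RInt_comp_lin (V := C_R_CompleteNormedModule) f u v a b H).
  apply (RInt_ext (V := C_R_CompleteNormedModule)). intros t _.
  unfold scal; simpl. unfold prod_scal, scal; simpl; unfold mult; simpl.
  destruct (f (u * t + v)%R). unfold Cmult, RtoC; simpl. f_equal; ring.
Qed.

(** Substitution t -> 1 - t; swapping the bounds of the integral gives one sign and the factor a - b
    the other form of the same segment. *)
Lemma seg_rev (f : C -> C) (a b : C) :
  continuous_on (disc c r) f -> disc c r a -> disc c r b -> seg f b a = - seg f a b.
Proof.
  intros Hf Ha Hb. unfold seg.
  assert (Hm1 : RtoC (-1) = - RtoC 1) by (unfold RtoC, Copp; simpl; f_equal; ring).
  assert (E := Cint_comp_lin (fun t => f (a + RtoC t * (b - a))) (-1) 1 0 1).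
  replace (-1 * 0 + 1)%R with 1%R in E by ring. replace (-1 * 1 + 1)%R with 0%R in E by ring.
  assert (W := opp_RInt_swap (V := C_R_CompleteNormedModule) _ _ _ (ex_seg f a b Hf Ha Hb)).
  assert (E' := E (ex_RInt_swap (V := C_R_NormedModule) _ _ _ (ex_seg f a b Hf Ha Hb))).
  rewrite <- W in E'.
  change (Cint (fun t => RtoC (-1) * f (a + RtoC (-1 * t + 1) * (b - a))) 0 1
    = - Cint (fun t => f (a + RtoC t * (b - a))) 0 1) in E'.
  rewrite <- (Cint_ext (fun t => RtoC (-1) * f (b + RtoC t * (a - b)))) in E'; [|lra|].
  - rewrite Cint_scal in E' by (apply ex_seg; assumption).
    assert (E2 : Cint (fun t => f (b + RtoC t * (a - b))) 0 1
      = Cint (fun t => f (a + RtoC t * (b - a))) 0 1).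
    { set (X := Cint (fun t => f (b + RtoC t * (a - b))) 0 1) in *.
      set (Y := Cint (fun t => f (a + RtoC t * (b - a))) 0 1) in *.
      replace X with (- (RtoC (-1) * X)) by (rewrite Hm1; ring).
      rewrite E'. ring. }
    rewrite E2. ring.
  - intros t _. f_equal. f_equal. rewrite RtoC_plus, RtoC_mult, Hm1. ring.
Qed.

(** The parameter interval is split at 1/2, and t -> t / 2 and t -> (t + 1) / 2 rescale the two
    halves. *)
Lemma seg_mid (f : C -> C) (a b : C) :
  continuous_on (disc c r) f -> disc c r a -> disc c r b ->
  seg f a b = seg f a ((a + b) / 2) + seg f ((a + b) / 2) b.
Proof.
  intros Hf Ha Hb. unfold seg.
  set (g := fun t => f (a + RtoC t * (b - a))).
  assert (Hg : forall t u, (0 <= t)%R -> (t <= u)%R -> (u <= 1)%R -> ex_Cint g t u).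
  { intros t u H1 H2 H3. apply ex_Cint_continuous; [exact H2|]. intros x Hx.
    apply seg_continuous; try assumption. lra. }
  assert (E1 := Cint_comp_lin g (1/2) 0 0 1).
  assert (E2 := Cint_comp_lin g (1/2) (1/2) 0 1).
  replace (1 / 2 * 0 + 0)%R with 0%R in E1 by field.
  replace (1 / 2 * 1 + 0)%R with (1/2)%R in E1 by field.
  replace (1 / 2 * 0 + 1/2)%R with (1/2)%R in E2 by field.
  replace (1 / 2 * 1 + 1/2)%R with 1%R in E2 by field.
  specialize (E1 (Hg 0 (1/2) ltac:(lra) ltac:(lra) ltac:(lra)))%R.
  specialize (E2 (Hg (1/2) 1 ltac:(lra) ltac:(lra) ltac:(lra)))%R.
  assert (S : Cint g 0 1 = Cint g 0 (1/2) + Cint g (1/2) 1).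
  { symmetry. apply (RInt_Chasles (V := C_R_CompleteNormedModule)); apply Hg; lra. }
  assert (Hhalf : RtoC (1 / 2) = / 2).
  { unfold Rdiv. rewrite RtoC_mult, RtoC_inv by lra. ring. }
  assert (Hm : disc c r ((a + b) / 2)).
  { replace ((a + b) / 2) with (a + RtoC (1/2) * (b - a)) by (rewrite Hhalf; field).
    apply disc_convex; auto; lra. }
  rewrite S, <- E1, <- E2.
  rewrite (Cint_ext (fun t => RtoC (1/2) * g (1 / 2 * t + 0)%R)
    (fun t => RtoC (1/2) * f (a + RtoC t * ((a + b) / 2 - a)))).
  rewrite (Cint_ext (fun t => RtoC (1/2) * g (1 / 2 * t + 1 / 2)%R)
    (fun t => RtoC (1/2) * f ((a + b) / 2 + RtoC t * (b - (a + b) / 2)))).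
  - rewrite !Cint_scal by (apply ex_seg; assumption). rewrite Hhalf. field.
  - lra.
  - intros t _. unfold g. f_equal. f_equal. rewrite RtoC_plus, RtoC_mult, Hhalf. field.
  - lra.
  - intros t _. unfold g. f_equal. f_equal. rewrite RtoC_plus, RtoC_mult, Hhalf. field.
Qed.

End Segments.

(** * Geometric estimates and dependent choice *)

Lemma geometric_small (A q eps : R) :
  (0 <= A)%R -> (0 <= q < 1)%R -> (0 < eps)%R -> exists N, (A * q ^ N < eps)%R.
Proof.
  intros HA Hq He.
  destruct (pow_lt_1_zero q ltac:(rewrite Rabs_pos_eq; lra) (eps / (A + 1))
    ltac:(apply Rdiv_lt_0_compat; lra)) as [N HN].
  exists N. specialize (HN N (Nat.le_refl N)). rewrite Rabs_pos_eq in HN by (apply pow_le; lra).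
  apply Rmult_lt_compat_r with (r := (A + 1)%R) in HN; [|lra].
  replace (eps / (A + 1) * (A + 1))%R with eps in HN by (field; lra).
  assert (0 <= q ^ N)%R by (apply pow_le; lra). nra.
Qed.

(** Completeness of C with a rate. It gives the point to which the nested triangles shrink and,
    later, the sum of the logarithmic corrections. *)
Lemma geometric_limit (u : nat -> C) (K : R) :
  (forall n, (Cmod (u (S n) - u n) <= K * (1 / 2) ^ n)%R) ->
  exists p, forall n, (Cmod (p - u n) <= 2 * K * (1 / 2) ^ n)%R.
Proof.
  intros H.
  assert (K0 : (0 <= K)%R).
  { assert (G := H 0%nat). simpl in G. assert (G1 := Cmod_ge_0 (u 1%nat - u 0%nat)). lra. }
  assert (B : forall n m, (Cmod (u (n + m)%nat - u n) <= 2 * K * (1 / 2) ^ n)%R).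
  { intros n m.
    (* The factor 1 - (1/2)^m strengthens the bound so that the induction on m closes. *)
    apply Rle_trans with (2 * K * (1 / 2) ^ n * (1 - (1/2) ^ m))%R.
    - induction m as [|m IH].
      + rewrite Nat.add_0_r, Cmod_minus_self. simpl. lra.
      + rewrite Nat.add_succ_r. eapply Rle_trans; [apply (Cmod_minus_triangle _ (u (n + m)%nat))|].
        assert (G := H (n + m)%nat). rewrite pow_add in G.
        set (a := ((1/2) ^ n)%R) in *. simpl pow. set (b := ((1/2) ^ m)%R) in *. lra.
    - assert (0 <= (1/2) ^ m)%R by (apply pow_le; lra).
      assert (0 <= K * (1/2) ^ n)%R by (apply Rmult_le_pos; [lra|apply pow_le; lra]). nra. }
  assert (L : forall phi : C -> R, (forall x y, (Rabs (phi x - phi y) <= Cmod (x - y))%R) ->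
    exists l, Un_cv (fun n => phi (u n)) l).
  { intros phi Hphi. destruct (Rcomplete.R_complete (fun n => phi (u n))) as [l Hl].
    2: { exists l. exact Hl. }
    intros eps Heps.
    destruct (geometric_small (4 * K) (1/2) eps) as [N HN]; [lra|lra|exact Heps|].
    exists N. intros n m Hn Hm. unfold Rdist.
    eapply Rle_lt_trans; [apply Hphi|].
    eapply Rle_lt_trans; [apply (Cmod_minus_triangle _ (u N))|].
    assert (G1 := B N (n - N)%nat). assert (G2 := B N (m - N)%nat).
    replace (N + (n - N))%nat with n in G1 by lia.
    replace (N + (m - N))%nat with m in G2 by lia.
    rewrite (Cmod_sym (u N)). lra. }
  destruct (L Re) as [x Hx]; [intros y z; apply (re_le_Cmod (y - z))|].
  destruct (L Im) as [y Hy]; [intros z w; apply (im_le_Cmod (z - w))|].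
  exists (x, y). intros n. apply le_epsilon. intros eps Heps.
  destruct (Hx (eps / 2)%R ltac:(lra)) as [N1 H1].
  destruct (Hy (eps / 2)%R ltac:(lra)) as [N2 H2].
  set (m := (N1 + N2)%nat).
  specialize (H1 (n + m)%nat ltac:(unfold m; lia)). specialize (H2 (n + m)%nat ltac:(unfold m;
    lia)).
  unfold Rdist in H1, H2. rewrite Rabs_minus_sym in H1. rewrite Rabs_minus_sym in H2.
  eapply Rle_trans; [apply (Cmod_minus_triangle _ (u (n + m)%nat))|].
  assert (G := B n m). assert (D := Cmod_le_abs ((x, y) - u (n + m)%nat)).
  change (Cmod ((x, y) - u (n + m)%nat) <= Rabs (x - Re (u (n + m)%nat)) + Rabs (y - Im (u (n +
    m)%nat)))%R
    in D. lra.
Qed.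

Lemma dependent_choice {A : Type} (R : A -> A -> Prop) (x : A) :
  (forall a, exists b, R a b) ->
  exists u : nat -> A, u 0%nat = x /\ forall n, R (u n) (u (S n)).
Proof.
  intros H.
  set (next := fun a => proj1_sig (constructive_indefinite_description _ (H a))).
  exists (fun n => Nat.iter n next x). split; [reflexivity|].
  intros n. exact (proj2_sig (constructive_indefinite_description _ (H (Nat.iter n next x)))).
Qed.

(** * Integrals over triangles *)

Definition tri_int (f : C -> C) (a b c : C) : C := seg f a b + seg f b c + seg f c a.

Lemma two_neq_0 : RtoC 2 <> 0.
Proof. intros K. apply (f_equal fst) in K. simpl in K. lra. Qed.

Lemma Cmod_half (x : C) : Cmod (x / 2) = (Cmod x / 2)%R.
Proof. rewrite Cmod_div by apply two_neq_0. rewrite Cmod_R, Rabs_pos_eq by lra. reflexivity. Qed.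

Lemma disc_mid (o a b : C) (r : R) : disc o r a -> disc o r b -> disc o r ((a + b) / 2).
Proof.
  unfold disc. intros Ha Hb.
  replace ((a + b) / 2 - o) with ((a - o) / 2 + (b - o) / 2) by field.
  eapply Rle_lt_trans; [apply Cmod_triangle|]. rewrite !Cmod_half. lra.
Qed.

Local Ltac half :=
  right; rewrite <- Cmod_half; f_equal;
  repeat match goal with x := _ |- context [?y] => constr_eq x y; unfold x end; field.

(** Midpoint subdivision: the inner sides cancel, so one of the four half-size triangles carries at
    least a quarter of the integral. The bound on |a' - a| makes the first vertices converge. *)
Lemma triangle_step (f : C -> C) (o : C) (r : R) (a b c : C) :
  continuous_on (disc o r) f -> disc o r a -> disc o r b -> disc o r c ->
  exists a' b' c', disc o r a' /\ disc o r b' /\ disc o r c' /\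
    (Cmod (b' - a') <= Cmod (b - a) / 2)%R /\
    (Cmod (c' - b') <= Cmod (c - b) / 2)%R /\
    (Cmod (a' - c') <= Cmod (a - c) / 2)%R /\
    (Cmod (a' - a) <= (Cmod (b - a) + Cmod (c - b) + Cmod (a - c)) / 2)%R /\
    (Cmod (tri_int f a b c) <= 4 * Cmod (tri_int f a' b' c'))%R.
Proof.
  intros Hf Ha Hb Hc.
  set (p := (a + b) / 2). set (q := (b + c) / 2). set (s := (c + a) / 2).
  assert (Hp : disc o r p) by (apply disc_mid; assumption).
  assert (Hq : disc o r q) by (apply disc_mid; assumption).
  assert (Hs : disc o r s) by (apply disc_mid; assumption).
  assert (E : tri_int f a b c =
    (tri_int f a p s + tri_int f p b q) + (tri_int f s q c + tri_int f q s p)).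
  { unfold tri_int.
    rewrite (seg_mid o r f a b), (seg_mid o r f b c), (seg_mid o r f c a) by assumption.
    fold p q s.
    rewrite (seg_rev o r f p s), (seg_rev o r f q p), (seg_rev o r f s q) by assumption.
    ring. }
  assert (T : (Cmod (tri_int f a b c) <=
    (Cmod (tri_int f a p s) + Cmod (tri_int f p b q)) +
    (Cmod (tri_int f s q c) + Cmod (tri_int f q s p)))%R).
  { rewrite E. eapply Rle_trans; [apply Cmod_triangle|].
    apply Rplus_le_compat; apply Cmod_triangle. }
  assert (L0 := Cmod_ge_0 (b - a)). assert (L1 := Cmod_ge_0 (c - b)). assert (L2 := Cmod_ge_0 (a -
    c)).
  destruct (Rle_dec (Cmod (tri_int f a b c)) (4 * Cmod (tri_int f a p s))) as [D|D].
  { exists a, p, s. repeat split; try assumption.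
    - half.
    - half.
    - half.
    - rewrite Cmod_minus_self. lra. }
  destruct (Rle_dec (Cmod (tri_int f a b c)) (4 * Cmod (tri_int f p b q))) as [D1|D1].
  { exists p, b, q. repeat split; try assumption.
    - half.
    - half.
    - half.
    - replace (p - a) with ((b - a) / 2) by (unfold p; field). rewrite Cmod_half. lra. }
  destruct (Rle_dec (Cmod (tri_int f a b c)) (4 * Cmod (tri_int f s q c))) as [D2|D2].
  { exists s, q, c. repeat split; try assumption.
    - half.
    - half.
    - half.
    - rewrite Cmod_sym. replace (a - s) with ((a - c) / 2) by (unfold s; field). rewrite Cmod_half.
      lra. }
  (* Each of the other three carries less than a quarter, so the middle triangle carries at least
     the rest. Its vertices are ordered so that its sides are parallel to those of a, b, c in
     turn. *)
  exists q, s, p. repeat split; try assumption.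
  - rewrite Cmod_sym. half.
  - rewrite Cmod_sym. half.
  - rewrite Cmod_sym. half.
  - replace (q - a) with ((b - a) / 2 + - ((a - c) / 2)) by (unfold q; field).
    eapply Rle_trans; [apply Cmod_triangle|]. rewrite Cmod_opp, !Cmod_half. lra.
  - lra.
Qed.

Lemma tri_int_bound (f : C -> C) (o : C) (r : R) (a b c : C) (M : R) :
  continuous_on (disc o r) f -> disc o r a -> disc o r b -> disc o r c ->
  (forall z, disc o r z -> (Cmod (f z) <= M)%R) ->
  (Cmod (tri_int f a b c) <= M * (Cmod (b - a) + Cmod (c - b) + Cmod (a - c)))%R.
Proof.
  intros Hf Ha Hb Hc H. unfold tri_int.
  eapply Rle_trans; [apply Cmod_triangle|].
  assert (T := Cmod_triangle (seg f a b) (seg f b c)).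
  assert (B : forall x y, disc o r x -> disc o r y -> (Cmod (seg f x y) <= M * Cmod (y - x))%R).
  { intros x y Hx Hy. apply (seg_bound o r); auto. intros t Ht. apply H, disc_convex; assumption. }
  assert (B1 := B a b Ha Hb). assert (B2 := B b c Hb Hc). assert (B3 := B c a Hc Ha). lra.
Qed.

(** Triangles are halved towards a point p. There f differs from its affine approximation by a small
    multiple of the distance, and the affine part has a primitive, so the integrals decay faster
    than 4^-n. *)
Theorem goursat (f : C -> C) (o : C) (R : R) (a b c : C) :
  holomorphic_on (disc o R) f -> disc o R a -> disc o R b -> disc o R c ->
  tri_int f a b c = 0.
Proof.
  intros Hf Ha Hb Hc.
  assert (Hcont := holomorphic_on_continuous _ _ Hf).
  (* The limit p of the vertices is only known to lie in the closure of a disc that contains them;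
     the smaller radius r keeps it inside the given open disc. *)
  assert (Hr : exists r, (r < R)%R /\ disc o r a /\ disc o r b /\ disc o r c).
  { unfold disc in *.
    set (m := Rmax (Cmod (a - o)) (Rmax (Cmod (b - o)) (Cmod (c - o)))).
    assert (Hm : (m < R)%R) by (repeat apply Rmax_lub_lt; assumption).
    assert (M1 := Rmax_l (Cmod (a - o)) (Rmax (Cmod (b - o)) (Cmod (c - o)))).
    assert (M2 := Rmax_r (Cmod (a - o)) (Rmax (Cmod (b - o)) (Cmod (c - o)))).
    assert (M3 := Rmax_l (Cmod (b - o)) (Cmod (c - o))).
    assert (M4 := Rmax_r (Cmod (b - o)) (Cmod (c - o))).
    fold m in M1, M2. exists ((m + R) / 2)%R. repeat split; lra. }
  destruct Hr as [r [HrR [Ha' [Hb' Hc']]]]. clear Ha Hb Hc.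
  assert (Sub : forall z, disc o r z -> disc o R z) by (unfold disc; intros; lra).
  assert (Hcr : continuous_on (disc o r) f) by (intros z Hz; apply Hcont, Sub, Hz).
  (* The added 1 keeps the division by K^2 legitimate for a degenerate triangle. *)
  set (K := (Cmod (b - a) + Cmod (c - b) + Cmod (a - c) + 1)%R).
  set (good := fun t : C * C * C =>
    let '(x, y, z) := t in disc o r x /\ disc o r y /\ disc o r z).
  destruct (dependent_choice (A := {t | good t})
    (fun s t => let '(x, y, z) := proj1_sig s in let '(x', y', z') := proj1_sig t in
      (Cmod (y' - x') <= Cmod (y - x) / 2)%R /\
      (Cmod (z' - y') <= Cmod (z - y) / 2)%R /\
      (Cmod (x' - z') <= Cmod (x - z) / 2)%R /\
      (Cmod (x' - x) <= (Cmod (y - x) + Cmod (z - y) + Cmod (x - z)) / 2)%R /\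
      (Cmod (tri_int f x y z) <= 4 * Cmod (tri_int f x' y' z'))%R)
    (exist good (a, b, c) (conj Ha' (conj Hb' Hc')))) as [u [Hu0 Hu]].
  { intros [[[x y] z] [G1 [G2 G3]]]. simpl.
    destruct (triangle_step f o r x y z Hcr G1 G2 G3) as (x' & y' & z' & I1 & I2 & I3 & I).
    exists (exist good (x', y', z') (conj I1 (conj I2 I3))). simpl. exact I. }
  set (A := fun n => fst (fst (proj1_sig (u n)))).
  set (B := fun n => snd (fst (proj1_sig (u n)))).
  set (D := fun n => snd (proj1_sig (u n))).
  assert (HA0 : A 0%nat = a) by (unfold A; rewrite Hu0; reflexivity).
  assert (HB0 : B 0%nat = b) by (unfold B; rewrite Hu0; reflexivity).
  assert (HD0 : D 0%nat = c) by (unfold D; rewrite Hu0; reflexivity).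
  assert (G : forall n, disc o r (A n) /\ disc o r (B n) /\ disc o r (D n)).
  { intros n. unfold A, B, D. destruct (u n) as [[[x y] z] I]. exact I. }
  assert (S : forall n,
      (Cmod (B (S n) - A (S n)) <= Cmod (B n - A n) / 2)%R /\
      (Cmod (D (S n) - B (S n)) <= Cmod (D n - B n) / 2)%R /\
      (Cmod (A (S n) - D (S n)) <= Cmod (A n - D n) / 2)%R /\
      (Cmod (A (S n) - A n) <= (Cmod (B n - A n) + Cmod (D n - B n) + Cmod (A n - D n)) / 2)%R /\
      (Cmod (tri_int f (A n) (B n) (D n)) <= 4 * Cmod (tri_int f (A (S n)) (B (S n)) (D (S n))))%R).
  { intros n. generalize (Hu n). unfold A, B, D.
    destruct (proj1_sig (u n)) as [[x y] z]. destruct (proj1_sig (u (Datatypes.S n))) as [[x' y']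
      z'].
    simpl. tauto. }
  clearbody A B D. clear u Hu0 Hu good.
  assert (L : forall n, (Cmod (B n - A n) + Cmod (D n - B n) + Cmod (A n - D n) <= K * (1/2)^n)%R).
  { intros n. induction n as [|n IH].
    - rewrite HA0, HB0, HD0. unfold K. simpl. lra.
    - destruct (S n) as (S1 & S2 & S3 & _). simpl. lra. }
  assert (Tn : forall n, (Cmod (tri_int f a b c) <= 4 ^ n * Cmod (tri_int f (A n) (B n) (D n)))%R).
  { intros n. induction n as [|n IH].
    - rewrite HA0, HB0, HD0. simpl. lra.
    - destruct (S n) as (_ & _ & _ & _ & S5). simpl.
      eapply Rle_trans; [exact IH|].
      assert (0 < 4 ^ n)%R by (apply pow_lt; lra). nra. }
  destruct (geometric_limit A K) as [p Hp].
  { intros n. destruct (S n) as (_ & _ & _ & S4 & _). eapply Rle_trans; [exact S4|].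
    assert (Ln := L n).
    assert (P1 := Cmod_ge_0 (B n - A n)). assert (P2 := Cmod_ge_0 (D n - B n)).
    assert (P3 := Cmod_ge_0 (A n - D n)). lra. }
  assert (HK : (1 <= K)%R).
  { unfold K. assert (P1 := Cmod_ge_0 (b - a)). assert (P2 := Cmod_ge_0 (c - b)).
    assert (P3 := Cmod_ge_0 (a - c)). lra. }
  assert (small : forall e, (0 < e)%R -> exists n, (K * (1/2) ^ n < e)%R)
    by (intros e He; apply geometric_small; lra).
  assert (Hpd : disc o R p).
  { unfold disc. destruct (small ((R - r) / 2)%R ltac:(lra)) as [n Hn].
    assert (T := Cmod_minus_triangle p (A n) o). destruct (G n) as [G1 _]. unfold disc in G1.
    specialize (Hp n). lra. }
  destruct (Hf p Hpd) as [l Hl].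
  assert (Z : Cmod (tri_int f a b c) = 0%R); [|apply Cmod_eq_0, Z].
  apply Rle_antisym; [|apply Cmod_ge_0]. apply le_epsilon. intros eps Heps.
  rewrite Rplus_0_l. rewrite is_Cderive_iff in Hl.
  (* The n-th triangle has perimeter at most h = K / 2^n and lies within 4 h of p. With e = eps / (4
     K^2) its integral is at most e * 4 h * h, and 4^n times this is exactly eps. *)
  destruct (Hl (eps / (4 * (K * K)))%R) as [d [Hd Hdiff]].
  { apply Rdiv_lt_0_compat; nra. }
  destruct (disc_open o p R Hpd) as [d' [Hd' Hdd]].
  destruct (small (Rmin d d' / 4)%R) as [n Hn].
  { assert (0 < Rmin d d')%R by (apply Rmin_pos; assumption). lra. }
  specialize (Hp n). specialize (L n). specialize (Tn n). destruct (G n) as (G1 & G2 & G3).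
  set (h := (K * (1/2)^n)%R) in *.
  replace (2 * K * (1/2)^n)%R with (2 * h)%R in Hp by (unfold h; ring).
  assert (M1 := Rmin_l d d'). assert (M2 := Rmin_r d d').
  assert (Hh : (0 < h)%R) by (unfold h; apply Rmult_lt_0_compat; [lra|apply pow_lt; lra]).
  assert (P1 := Cmod_ge_0 (B n - A n)). assert (P2 := Cmod_ge_0 (D n - B n)).
  assert (P3 := Cmod_ge_0 (A n - D n)).
  assert (V1 : disc p (4 * h) (A n)) by (unfold disc; rewrite Cmod_sym; lra).
  assert (V2 : disc p (4 * h) (B n)).
  { unfold disc. assert (T := Cmod_minus_triangle (B n) (A n) p).
    rewrite (Cmod_sym (A n) p) in T. lra. }
  assert (V3 : disc p (4 * h) (D n)).
  { unfold disc. assert (T := Cmod_minus_triangle (D n) (A n) p).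
    rewrite (Cmod_sym (A n) p), (Cmod_sym (D n) (A n)) in T. lra. }
  assert (Hd4 : forall z, disc p (4 * h) z -> disc o R z).
  { intros z Hz. apply Hdd. unfold disc in *. lra. }
  assert (Hcp : continuous_on (disc p (4 * h)) f) by (intros z Hz; apply Hcont, Hd4, Hz).
  (* The affine approximation at p has the primitive [Lin], so it can be subtracted from f without
     changing the integral over the triangle. *)
  set (lin := fun z => f p + l * (z - p)).
  set (Lin := fun z => f p * z + l * ((z - p) * (z - p) / 2)).
  assert (HLin : forall z, is_Cderive Lin z (lin z)).
  { intros z. eapply is_Cderive_eq.
    - apply is_Cderive_plus.
      + apply is_Cderive_mult; [apply is_Cderive_const|apply is_Cderive_id].
      + apply is_Cderive_mult; [apply is_Cderive_const|].
        apply is_Cderive_div; [|apply is_Cderive_const|exact two_neq_0].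
        apply is_Cderive_mult; (apply is_Cderive_minus; [apply is_Cderive_id|apply
          is_Cderive_const]).
    - unfold lin. field. }
  assert (Hlin : forall z, is_Cderive lin z l).
  { intros z. eapply is_Cderive_eq.
    - apply is_Cderive_plus; [apply is_Cderive_const|].
      apply is_Cderive_mult; [apply is_Cderive_const|].
      apply is_Cderive_minus; [apply is_Cderive_id|apply is_Cderive_const].
    - cbv beta. ring. }
  assert (Clin : continuous_on (disc p (4 * h)) lin)
    by (intros z _; exact (is_Cderive_continuous _ _ _ (Hlin z))).
  assert (TL : tri_int lin (A n) (B n) (D n) = 0).
  { unfold tri_int. rewrite !(seg_derive p (4 * h) lin Lin) by auto. ring. }
  assert (TT : tri_int f (A n) (B n) (D n) = tri_int (fun z => f z - lin z) (A n) (B n) (D n)).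
  { transitivity (tri_int f (A n) (B n) (D n) - tri_int lin (A n) (B n) (D n)).
    - rewrite TL. ring.
    - unfold tri_int. rewrite !(seg_minus p (4 * h)) by assumption. ring. }
  assert (Bd : (Cmod (tri_int f (A n) (B n) (D n)) <= eps / (4 * (K * K)) * (4 * h) * h)%R).
  { rewrite TT. eapply Rle_trans.
    - apply (tri_int_bound _ p (4 * h)); try assumption.
      + intros z Hz. apply Ccontinuous_minus; [apply Hcp, Hz|apply Clin, Hz].
      + intros z Hz. instantiate (1 := (eps / (4 * (K * K)) * (4 * h))%R).
        replace (f z - lin z) with (f z - f p - l * (z - p)) by (unfold lin; ring).
        eapply Rle_trans; [apply Hdiff; unfold disc in *; lra|].
        apply Rmult_le_compat_l; [|unfold disc in Hz; lra].
        apply Rlt_le, Rdiv_lt_0_compat; nra.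
    - apply Rmult_le_compat_l; [|exact L].
      apply Rmult_le_pos; [|lra]. apply Rlt_le, Rdiv_lt_0_compat; nra. }
  eapply Rle_trans; [exact Tn|].
  apply Rle_trans with (4 ^ n * (eps / (4 * (K * K)) * (4 * h) * h))%R.
  - apply Rmult_le_compat_l; [apply pow_le; lra|exact Bd].
  - right. unfold h.
    replace (4 ^ n * (eps / (4 * (K * K)) * (4 * (K * (1 / 2) ^ n)) * (K * (1 / 2) ^ n)))%R
      with ((4 ^ n * ((1/2)^n * (1/2)^n)) * eps)%R by (field; lra).
    rewrite <- !Rpow_mult_distr. replace (4 * (1 / 2 * (1 / 2)))%R with 1%R by field.
    rewrite pow1. ring.
Qed.

Lemma seg_increment_bound (f : C -> C) (o : C) (r : R) (a b : C) (e : R) :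
  continuous_on (disc o r) f -> disc o r a -> disc o r b ->
  (forall t, (0 <= t <= 1)%R -> (Cmod (f (a + RtoC t * (b - a))%C - f a) <= e)%R) ->
  (Cmod (seg f a b - f a * (b - a)) <= e * Cmod (b - a))%R.
Proof.
  intros Hf Ha Hb H.
  assert (Hk : continuous_on (disc o r) (fun _ => f a)) by (intros z _; apply Ccontinuous_const).
  replace (f a * (b - a)) with (seg (fun _ => f a) a b).
  - rewrite <- (seg_minus o r) by assumption. apply (seg_bound o r); try assumption.
    intros z Hz. apply Ccontinuous_minus; [apply Hf, Hz|apply Ccontinuous_const].
  - unfold seg. rewrite Cint_const. rewrite Rminus_0_r. ring.
Qed.

(** F is the integral from the centre. On the triangle o, z, y Goursat's theorem turns F y - F z
    into the integral over the segment from z to y, which is close to f z (y - z). *)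
Theorem holomorphic_primitive (f : C -> C) (o : C) (R : R) :
  holomorphic_on (disc o R) f ->
  exists F, forall z, disc o R z -> is_Cderive F z (f z).
Proof.
  intros Hf. exists (fun z => seg f o z). intros z Hz.
  assert (Hcont := holomorphic_on_continuous _ _ Hf).
  assert (Ho : disc o R o).
  { apply disc_center. unfold disc in Hz. assert (P := Cmod_ge_0 (z - o)). lra. }
  apply is_Cderive_iff. intros eps Heps.
  assert (Hc := Hcont z Hz). rewrite Ccontinuous_iff in Hc. specialize (Hc eps Heps).
  apply locally_disc in Hc. destruct Hc as [d [Hd Hc]].
  destruct (disc_open o z R Hz) as [d' [Hd' Hdd]].
  exists (Rmin d d'). split; [apply Rmin_pos; assumption|]. intros y Hy.
  assert (Hy1 := disc_sub _ _ _ _ (Rmin_l _ _) Hy).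
  assert (Hy2 := disc_sub _ _ _ _ (Rmin_r _ _) Hy).
  assert (HyR := Hdd y Hy2).
  assert (E : seg f o y - seg f o z = seg f z y).
  { assert (G := goursat f o R o z y Hf Ho Hz HyR). unfold tri_int in G.
    rewrite (seg_rev o R f o y) in G by assumption.
    transitivity (seg f o z + seg f z y + - seg f o y + (seg f o y - seg f o z)).
    - rewrite G. ring.
    - ring. }
  rewrite E. apply (seg_increment_bound f o R); try assumption.
  intros t Ht. apply Rlt_le, Hc. apply disc_convex; [apply disc_center, Hd|exact Hy1|exact Ht].
Qed.

(** * Cauchy integrals *)

(** The summand 0 gives the exponent the shape a + t b of [path_derive_line]. *)
Definition cis (t : R) : C := Cexp (0 + RtoC t * Ci).

Lemma cis_eq (t : R) : cis t = (cos t, sin t).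
Proof.
  unfold cis, Cexp, Ci, RtoC, Cplus, Cmult, Re, Im; simpl.
  replace (0 + (t * 0 - 0 * 1))%R with 0%R by ring.
  replace (0 + (t * 1 + 0 * 0))%R with t by ring.
  rewrite exp_0, !Rmult_1_l. reflexivity.
Qed.

Lemma path_derive_cis (t : R) : is_path_derive cis t (Ci * cis t).
Proof.
  rewrite Cmult_comm. unfold cis. apply (path_derive_comp Cexp); [apply is_Cderive_Cexp|].
  apply path_derive_line.
Qed.

Lemma Cmod_cis (t : R) : Cmod (cis t) = 1%R.
Proof.
  unfold cis. rewrite Cmod_Cexp. unfold Re, Ci, RtoC, Cplus, Cmult; simpl.
  replace (0 + (t * 0 - 0 * 1))%R with 0%R by ring. apply exp_0.
Qed.

Lemma cis_plus (s t : R) : cis (s + t) = cis s * cis t.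
Proof. unfold cis. rewrite <- Cexp_plus. f_equal. rewrite RtoC_plus. ring. Qed.

Lemma cis_0 : cis 0 = 1.
Proof. rewrite cis_eq, cos_0, sin_0. reflexivity. Qed.

Lemma cis_2PI : cis (2 * PI) = 1.
Proof. rewrite cis_eq, cos_2PI, sin_2PI. reflexivity. Qed.

Definition circ (c : C) (r t : R) : C := c + RtoC r * cis t.

Lemma path_derive_circ (c : C) (r t : R) : is_path_derive (circ c r) t (Ci * (circ c r t - c)).
Proof.
  replace (Ci * (circ c r t - c)) with (r * (Ci * cis t)) by (unfold circ; ring).
  apply (path_derive_comp (fun z => c + r * z)); [|apply path_derive_cis].
  eapply is_Cderive_eq.
  - apply is_Cderive_plus; [apply is_Cderive_const|].
    apply is_Cderive_mult; [apply is_Cderive_const|apply is_Cderive_id].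
  - cbv beta. ring.
Qed.

Lemma Ccontinuous_circ (c : C) (r t : R) : Ccontinuous (circ c r) t.
Proof. exact (path_derive_continuous _ _ _ (path_derive_circ c r t)). Qed.

Lemma Cmod_circ (c : C) (r t : R) : (0 <= r)%R -> Cmod (circ c r t - c) = r.
Proof.
  intros Hr. replace (circ c r t - c) with (r * cis t) by (unfold circ; ring).
  rewrite Cmod_scal, Cmod_cis, Rabs_pos_eq by exact Hr. ring.
Qed.

Lemma circ_dist (c b : C) (r t : R) : (0 <= r)%R ->
  (r - Cmod (b - c) <= Cmod (circ c r t - b))%R.
Proof.
  intros Hr. assert (T := Cmod_minus_triangle (circ c r t) b c).
  rewrite Cmod_circ in T by exact Hr. lra.
Qed.

Lemma circ_neq (c b : C) (r t : R) : disc c r b -> circ c r t - b <> 0.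
Proof.
  intros Hb. apply Cmod_gt_0. unfold disc in Hb.
  assert (P := Cmod_ge_0 (b - c)). assert (G := circ_dist c b r t ltac:(lra)). lra.
Qed.

Lemma circ_2PI (c : C) (r : R) : circ c r (2 * PI) = circ c r 0.
Proof. unfold circ. rewrite cis_0, cis_2PI. reflexivity. Qed.

Lemma path_bounded (f : R -> C) (a b : R) : (a <= b)%R ->
  (forall t, Ccontinuous f t) ->
  exists M, (0 < M)%R /\ forall t, (a <= t <= b)%R -> (Cmod (f t) <= M)%R.
Proof.
  intros Hab H.
  destruct (continuity_ab_maj (fun t => Cmod (f t)) a b Hab) as [x [Hx _]].
  - intros t _. apply continuity_pt_filterlim. intros P [e He].
    generalize (proj1 (Ccontinuous_iff f t) (H t) e (cond_pos e)).
    unfold filtermap. apply filter_imp. intros s Hs. apply He.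
    apply Rabs_lt_between'. assert (T1 := Cmod_triangle_inv (f s) (f t)).
    assert (T2 := Cmod_triangle_inv (f t) (f s)). rewrite (Cmod_sym (f t)) in T2. lra.
  - exists (Cmod (f x) + 1)%R. split; [assert (P := Cmod_ge_0 (f x)); lra|].
    intros t Ht. specialize (Hx t Ht). lra.
Qed.

Lemma two_PI_pos : (0 < 2 * PI)%R.
Proof. assert (P := PI_RGT_0). lra. Qed.

(** Differentiation under the integral sign from a remainder that is quadratic in z - b uniformly in
    t; the Cauchy kernels supply it by explicit algebra. *)
Lemma Cint_param_derive (K : C -> R -> C) (K' : R -> C) (b : C) (M d : R) :
  (0 < d)%R -> (0 <= M)%R ->
  (forall z t, disc b d z -> Ccontinuous (K z) t) -> (forall t, Ccontinuous K' t) ->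
  (forall z t, disc b d z -> (0 <= t <= 2 * PI)%R ->
    (Cmod (K z t - K b t - K' t * (z - b)) <= M * (Cmod (z - b) * Cmod (z - b)))%R) ->
  is_Cderive (fun z => Cint (K z) 0 (2 * PI)) b (Cint K' 0 (2 * PI)).
Proof.
  intros Hd HM HK HK' H. assert (P := two_PI_pos).
  apply is_Cderive_iff. intros eps Heps.
  (* Integration multiplies the bound M |z - b|^2 by 2 pi; the added 1 keeps the divisor positive
     when M = 0. *)
  assert (Q : (0 < eps / (2 * PI * M + 1))%R) by (apply Rdiv_lt_0_compat; nra).
  exists (Rmin d (eps / (2 * PI * M + 1))). split; [apply Rmin_pos; assumption|].
  intros z Hz.
  assert (Hz1 := disc_sub _ _ _ _ (Rmin_l _ _) Hz).
  assert (Hz2 : (Cmod (z - b) < eps / (2 * PI * M + 1))%R)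
    by (unfold disc in *; eapply Rlt_le_trans; [exact Hz|apply Rmin_r]).
  assert (E1 : ex_Cint (K z) 0 (2 * PI)) by (apply ex_Cint_circle; auto).
  assert (Hb := disc_center b d Hd).
  assert (E2 : ex_Cint (K b) 0 (2 * PI)) by (apply ex_Cint_circle; auto).
  assert (E3 : ex_Cint K' 0 (2 * PI)) by (apply ex_Cint_circle; auto).
  assert (E : Cint (K z) 0 (2 * PI) - Cint (K b) 0 (2 * PI) - Cint K' 0 (2 * PI) * (z - b)
    = Cint (fun t => K z t - K b t - (z - b) * K' t) 0 (2 * PI)).
  { rewrite (Cint_minus (fun t => K z t - K b t)).
    - rewrite Cint_minus, Cint_scal by assumption. ring.
    - apply (ex_RInt_minus (V := C_R_NormedModule)); assumption.
    - eexists. apply is_Cint_scal, Cint_correct, E3. }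
  rewrite E.
  eapply Rle_trans.
  - apply (Cmod_Cint_le _ 0 (2 * PI) (M * (Cmod (z - b) * Cmod (z - b)))).
    + lra.
    + apply ex_Cint_circle. intros t.
      apply Ccontinuous_minus; [apply Ccontinuous_minus; auto|].
      apply Ccontinuous_mult; [apply Ccontinuous_const|auto].
    + intros t Ht. rewrite (Cmult_comm (z - b)). apply H; assumption.
  - apply Rmult_lt_compat_r with (r := (2 * PI * M + 1)%R) in Hz2; [|nra].
    replace (eps / (2 * PI * M + 1) * (2 * PI * M + 1))%R with eps in Hz2 by (field; nra).
    assert (G := Cmod_ge_0 (z - b)). nra.
Qed.

Lemma Cmod_inv_le (x : C) (m : R) : (0 < m)%R -> (m <= Cmod x)%R -> (Cmod (/ x) <= / m)%R.
Proof.
  intros Hm H. rewrite Cmod_inv by (apply Cmod_gt_0; lra). apply Rinv_le_contravar; lra.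
Qed.

(* The integral of phi dw / (2 i pi (w - b)) over the circle w = circ c r t, where
   dw = i (w - c) dt; its derivative in b is [cauchy_int2]. *)
Definition cauchy_int (phi : R -> C) (c : C) (r : R) (b : C) : C :=
  / RtoC (2 * PI) * Cint (fun t => phi t * (circ c r t - c) / (circ c r t - b)) 0 (2 * PI).

Definition cauchy_int2 (phi : R -> C) (c : C) (r : R) (b : C) : C :=
  / RtoC (2 * PI) *
    Cint (fun t => phi t * (circ c r t - c) / ((circ c r t - b) * (circ c r t - b))) 0 (2 * PI).

Lemma RtoC_2PI_neq_0 : RtoC (2 * PI) <> 0.
Proof. intros E. apply (f_equal fst) in E. simpl in E. assert (P := two_PI_pos). lra. Qed.

Section CauchyIntegral.

Variables (phi : R -> C) (c : C) (r : R).
Hypothesis phi_continuous : forall t, Ccontinuous phi t.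

Local Notation w := (circ c r).

Lemma Ccontinuous_circ_minus (b : C) (t : R) : Ccontinuous (fun t => w t - b) t.
Proof. apply Ccontinuous_minus; [apply Ccontinuous_circ|apply Ccontinuous_const]. Qed.

Lemma cauchy_kernel_continuous (b : C) (t : R) : disc c r b ->
  Ccontinuous (fun t => phi t * (w t - c) / (w t - b)) t.
Proof.
  intros Hb. apply Ccontinuous_div.
  - apply Ccontinuous_mult; [apply phi_continuous|apply Ccontinuous_circ_minus].
  - apply Ccontinuous_circ_minus.
  - apply circ_neq, Hb.
Qed.

Lemma cauchy_kernel2_continuous (b : C) (t : R) : disc c r b ->
  Ccontinuous (fun t => phi t * (w t - c) / ((w t - b) * (w t - b))) t.
Proof.
  intros Hb. apply Ccontinuous_div.
  - apply Ccontinuous_mult; [apply phi_continuous|apply Ccontinuous_circ_minus].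
  - apply Ccontinuous_mult; apply Ccontinuous_circ_minus.
  - apply Cmult_neq_0; apply circ_neq, Hb.
Qed.

Lemma cauchy_int_derive (b : C) : disc c r b ->
  is_Cderive (cauchy_int phi c r) b (cauchy_int2 phi c r b).
Proof.
  intros Hb.
  assert (P0 := Cmod_ge_0 (b - c)). assert (Hr : (0 < r)%R) by (unfold disc in Hb; lra).
  set (dl := (r - Cmod (b - c))%R). assert (Hdl : (0 < dl)%R) by (unfold dl, disc in *; lra).
  destruct (path_bounded phi 0 (2 * PI) (Rlt_le _ _ two_PI_pos) phi_continuous) as [P [HP HB]].
  unfold cauchy_int, cauchy_int2.
  assert (Sub : forall z, disc b (dl / 2) z -> disc c r z).
  { unfold disc, dl in *. intros z Hz. assert (T := Cmod_minus_triangle z b c). lra. }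
  eapply is_Cderive_eq.
  - apply is_Cderive_mult; [apply is_Cderive_const|].
    (* The remainder is phi (w - c) (z - b)^2 / ((w - b)^2 (w - z)), with |phi| <= P, |w - c| = r,
       |w - b| >= dl and |w - z| >= dl / 2. *)
    apply (Cint_param_derive (fun z t => phi t * (w t - c) / (w t - z))
      (fun t => phi t * (w t - c) / ((w t - b) * (w t - b)))
      b (P * r * (/ dl * / dl * / (dl / 2))) (dl / 2)).
    + lra.
    + repeat apply Rmult_le_pos; try lra; apply Rlt_le, Rinv_0_lt_compat; lra.
    + intros z t Hz. apply cauchy_kernel_continuous, Sub, Hz.
    + intros t. apply cauchy_kernel2_continuous, Hb.
    + intros z t Hz Ht.
      assert (N1 := circ_neq c b r t Hb). assert (N2 := circ_neq c z r t (Sub z Hz)).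
      replace (phi t * (w t - c) / (w t - z) - phi t * (w t - c) / (w t - b) -
        phi t * (w t - c) / ((w t - b) * (w t - b)) * (z - b))
        with (phi t * (w t - c) * (/ (w t - b) * / (w t - b) * / (w t - z))
               * ((z - b) * (z - b))) by (field; auto).
      assert (D1 := circ_dist c b r t ltac:(lra)). fold dl in D1.
      assert (D2 : (dl / 2 <= Cmod (w t - z))%R).
      { assert (T := Cmod_minus_triangle (w t) z b). unfold disc in Hz. lra. }
      assert (I1 := Cmod_inv_le _ _ Hdl D1). assert (I2 := Cmod_inv_le _ (dl / 2) ltac:(lra) D2).
      rewrite !Cmod_mult. rewrite Cmod_circ by lra.
      apply Rmult_le_compat_r; [apply Rmult_le_pos; apply Cmod_ge_0|].
      apply Rmult_le_compat.
      * apply Rmult_le_pos; [apply Cmod_ge_0|lra].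
      * repeat apply Rmult_le_pos; apply Cmod_ge_0.
      * apply Rmult_le_compat_r; [lra|apply HB, Ht].
      * apply Rmult_le_compat; try (repeat apply Rmult_le_pos; apply Cmod_ge_0); [|exact I2].
        apply Rmult_le_compat; try apply Cmod_ge_0; assumption.
  - cbv beta. ring.
Qed.

(** One more differentiation under the integral; through Cauchy's formula this makes the derivative
    of a holomorphic function holomorphic. *)
Lemma cauchy_int2_holomorphic (b : C) : disc c r b -> holomorphic_at (cauchy_int2 phi c r) b.
Proof.
  intros Hb.
  assert (P0 := Cmod_ge_0 (b - c)). assert (Hr : (0 < r)%R) by (unfold disc in Hb; lra).
  set (dl := (r - Cmod (b - c))%R). assert (Hdl : (0 < dl)%R) by (unfold dl, disc in *; lra).
  destruct (path_bounded phi 0 (2 * PI) (Rlt_le _ _ two_PI_pos) phi_continuous) as [P [HP HB]].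
  unfold cauchy_int2.
  assert (Sub : forall z, disc b (dl / 2) z -> disc c r z).
  { unfold disc, dl in *. intros z Hz. assert (T := Cmod_minus_triangle z b c). lra. }
  apply (holomorphic_mult (fun _ => / RtoC (2 * PI))
    (fun z => Cint (fun t => phi t * (w t - c) / ((w t - z) * (w t - z))) 0 (2 * PI)));
    [apply holomorphic_const|].
  eexists.
  (* The remainder is phi (w - c) ((w - b) + 2 (w - z)) (z - b)^2 / ((w - b)^3 (w - z)^2). As b, z
     and w lie in the closed disc of radius r, 8 r generously bounds the middle factor. *)
  apply (Cint_param_derive (fun z t => phi t * (w t - c) / ((w t - z) * (w t - z)))
      (fun t => 2 * (phi t * (w t - c) / ((w t - b) * (w t - b))) * / (w t - b))
      b (P * r * (/ dl * / dl * / dl * (/ (dl / 2) * / (dl / 2))) * (8 * r)) (dl / 2)).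
  - lra.
  - repeat apply Rmult_le_pos; try lra; apply Rlt_le, Rinv_0_lt_compat; lra.
  - intros z t Hz. apply cauchy_kernel2_continuous, Sub, Hz.
  - intros t. apply Ccontinuous_mult; [apply Ccontinuous_mult; [apply Ccontinuous_const|]|].
    + apply cauchy_kernel2_continuous, Hb.
    + apply Ccontinuous_inv; [apply Ccontinuous_circ_minus|apply circ_neq, Hb].
  - intros z t Hz Ht.
    assert (N1 := circ_neq c b r t Hb). assert (N2 := circ_neq c z r t (Sub z Hz)).
    replace (phi t * (w t - c) / ((w t - z) * (w t - z)) -
      phi t * (w t - c) / ((w t - b) * (w t - b)) -
      2 * (phi t * (w t - c) / ((w t - b) * (w t - b))) * / (w t - b) * (z - b))
      with (phi t * (w t - c) *
             (/ (w t - b) * / (w t - b) * / (w t - b)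
               * (/ (w t - z) * / (w t - z)))
             * ((w t - b) + 2 * (w t - z)) * ((z - b) * (z - b))) by (field; auto).
    assert (D1 := circ_dist c b r t ltac:(lra)). fold dl in D1.
    assert (D2 : (dl / 2 <= Cmod (w t - z))%R).
    { assert (T := Cmod_minus_triangle (w t) z b). unfold disc in Hz. lra. }
    assert (I1 := Cmod_inv_le _ _ Hdl D1). assert (I2 := Cmod_inv_le _ (dl / 2) ltac:(lra) D2).
    assert (I3 : (Cmod ((w t - b) + 2 * (w t - z)) <= 8 * r)%R).
    { eapply Rle_trans; [apply Cmod_triangle|]. rewrite Cmod_mult, Cmod_R, Rabs_pos_eq by lra.
      assert (T1 := Cmod_minus_triangle (w t) c b).
      assert (T2 := Cmod_minus_triangle (w t) c z).
      rewrite Cmod_circ in T1, T2 by lra.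
      assert (Sz := Sub z Hz). rewrite (Cmod_sym c) in T1, T2. unfold disc in *. lra. }
    rewrite !(Cmod_mult _ ((z - b) * (z - b))). rewrite (Cmod_mult (z - b)).
    apply Rmult_le_compat_r; [apply Rmult_le_pos; apply Cmod_ge_0|].
    rewrite (Cmod_mult _ (_ + _)).
    apply Rmult_le_compat; try apply Cmod_ge_0; [|exact I3].
    rewrite !Cmod_mult. rewrite Cmod_circ by lra.
    apply Rmult_le_compat.
    + apply Rmult_le_pos; [apply Cmod_ge_0|lra].
    + repeat apply Rmult_le_pos; apply Cmod_ge_0.
    + apply Rmult_le_compat_r; [lra|apply HB, Ht].
    + apply Rmult_le_compat; try (repeat apply Rmult_le_pos; apply Cmod_ge_0).
      * apply Rmult_le_compat; try (repeat apply Rmult_le_pos; apply Cmod_ge_0); [|exact I1].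
        apply Rmult_le_compat; try apply Cmod_ge_0; assumption.
      * apply Rmult_le_compat; try apply Cmod_ge_0; assumption.
Qed.

Lemma cauchy_int_bound (b : C) (P : R) : disc c r b ->
  (forall t, (0 <= t <= 2 * PI)%R -> (Cmod (phi t) <= P)%R) ->
  (Cmod (cauchy_int phi c r b) <= P * (r / (r - Cmod (b - c))))%R.
Proof.
  intros Hb H. unfold cauchy_int.
  assert (P0 := Cmod_ge_0 (b - c)). assert (Hr : (0 < r)%R) by (unfold disc in Hb; lra).
  assert (Hdl : (0 < r - Cmod (b - c))%R) by (unfold disc in Hb; lra).
  assert (TP := two_PI_pos).
  rewrite Cmod_mult, Cmod_inv by apply RtoC_2PI_neq_0. rewrite Cmod_R, Rabs_pos_eq by lra.
  apply Rmult_le_reg_l with (2 * PI)%R; [exact TP|].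
  rewrite <- Rmult_assoc, Rinv_r, Rmult_1_l by lra.
  replace (2 * PI)%R with (2 * PI - 0)%R at 2 by ring.
  apply Cmod_Cint_le; [lra| |].
  - apply ex_Cint_circle. intros t. apply cauchy_kernel_continuous, Hb.
  - intros t Ht. unfold Cdiv. rewrite !Cmod_mult, Cmod_circ by lra.
    unfold Rdiv. rewrite <- Rmult_assoc.
    apply Rmult_le_compat.
    + apply Rmult_le_pos; [apply Cmod_ge_0|lra].
    + apply Cmod_ge_0.
    + apply Rmult_le_compat_r; [lra|apply H, Ht].
    + apply Cmod_inv_le; [exact Hdl|]. apply circ_dist. lra.
Qed.

End CauchyIntegral.

Lemma cauchy_int_ext (phi psi : R -> C) (c : C) (r : R) (b : C) :
  (forall t, phi t = psi t) -> cauchy_int phi c r b = cauchy_int psi c r b.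
Proof.
  intros H. unfold cauchy_int. f_equal. apply Cint_ext; [apply Rlt_le, two_PI_pos|].
  intros t _. rewrite H. reflexivity.
Qed.

Lemma cauchy_int_minus (phi psi : R -> C) (c : C) (r : R) (b : C) :
  (forall t, Ccontinuous phi t) -> (forall t, Ccontinuous psi t) -> disc c r b ->
  cauchy_int (fun t => phi t - psi t) c r b = cauchy_int phi c r b - cauchy_int psi c r b.
Proof.
  intros H1 H2 Hb. unfold cauchy_int. assert (TP := two_PI_pos).
  transitivity (/ RtoC (2 * PI) * (Cint (fun t => phi t * (circ c r t - c) / (circ c r t - b)) 0 (2
    * PI)
    - Cint (fun t => psi t * (circ c r t - c) / (circ c r t - b)) 0 (2 * PI))); [|ring].
  f_equal. rewrite <- Cint_minus.
  - apply Cint_ext; [lra|]. intros t _. field. apply circ_neq, Hb.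
  - apply ex_Cint_circle. intros t. apply cauchy_kernel_continuous; assumption.
  - apply ex_Cint_circle. intros t. apply cauchy_kernel_continuous; assumption.
Qed.

Lemma Ci_neq_0 : Ci <> 0.
Proof. intros E. apply (f_equal snd) in E. simpl in E. lra. Qed.

(** The derivative in b integrates dw / (w - b)^2, which has the primitive -1 / (w - b) on the
    closed circle, so it vanishes. The value is therefore the one at the centre, where the integrand
    in t is 1. *)
Lemma cauchy_int_1 (c : C) (r : R) (b : C) : disc c r b -> cauchy_int (fun _ => 1) c r b = 1.
Proof.
  intros Hb. assert (TP := two_PI_pos).
  assert (Hr : (0 < r)%R) by (unfold disc in Hb; assert (P := Cmod_ge_0 (b - c)); lra).
  assert (Hc : disc c r c) by (apply disc_center, Hr).
  rewrite (derive_zero_const c r (cauchy_int (fun _ => 1) c r) b c); try assumption.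
  - unfold cauchy_int.
    rewrite (Cint_ext _ (fun _ => 1)).
    + rewrite Cint_const, Rminus_0_r. field. apply RtoC_2PI_neq_0.
    + lra.
    + intros t _. field. apply circ_neq, Hc.
  - intros z Hz. eapply is_Cderive_eq.
    + apply cauchy_int_derive; [|exact Hz]. intros t; apply Ccontinuous_const.
    + unfold cauchy_int2.
      rewrite (Cint_derive (fun t => - / Ci * / (circ c r t - z))).
      * rewrite circ_2PI. ring.
      * lra.
      * intros t _. assert (N := circ_neq c z r t Hz).
        assert (D : is_Cderive (fun w => - / Ci * (1 / (w - z))) (circ c r t)
          (/ Ci * / ((circ c r t - z) * (circ c r t - z)))).
        { eapply is_Cderive_eq.
          - apply is_Cderive_mult; [apply is_Cderive_const|].
            apply is_Cderive_div; [apply is_Cderive_const| |exact N].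
            apply is_Cderive_minus; [apply is_Cderive_id|apply is_Cderive_const].
          - cbv beta. field. split; [exact N|exact Ci_neq_0]. }
        assert (E := path_derive_comp _ _ _ _ _ D (path_derive_circ c r t)).
        eapply (is_derive_ext (V := C_R_NormedModule)).
        2: { replace (1 * (circ c r t - c) / ((circ c r t - z) * (circ c r t - z)))
               with (/ Ci * / ((circ c r t - z) * (circ c r t - z)) * (Ci * (circ c r t - c))).
             - exact E.
             - field. split; [exact N|exact Ci_neq_0]. }
        intros s. cbv beta. unfold Cdiv. rewrite Cmult_1_l. reflexivity.
      * intros t _. apply cauchy_kernel2_continuous; [|exact Hz].
        intros s; apply Ccontinuous_const.
Qed.

(** Uniform continuity on the closed disc, from compactness of the square around it. Centres outside
    of the disc get a radius so small that they cover none of its points. *)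
Lemma heine_disc (f : C -> C) (c : C) (r : R) :
  (forall z, (Cmod (z - c) <= r)%R -> Ccontinuous f z) ->
  forall eps, (0 < eps)%R -> exists d, (0 < d)%R /\
    forall x y, (Cmod (x - c) <= r)%R -> (Cmod (y - c) <= r)%R ->
      (Cmod (y - x) < d)%R -> (Cmod (f y - f x) < eps)%R.
Proof.
  intros Hf eps Heps.
  (* The cover consists of squares, so a point x is only within 2 delta of its centre in [Cmod], and
     y is less than a further delta away; 4 delta holds both. *)
  assert (A : forall u v : R, exists d : posreal,
    ((Cmod ((u, v) - c) <= r)%R ->
      forall y, disc (u, v) (4 * d) y -> (Cmod (f y - f (u, v)) < eps / 2)%R) /\
    (~ (Cmod ((u, v) - c) <= r)%R -> (2 * d <= Cmod ((u, v) - c) - r)%R)).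
  { intros u v. destruct (Rle_dec (Cmod ((u, v) - c)) r) as [H|H].
    - assert (G := proj1 (Ccontinuous_iff f (u, v)) (Hf _ H) (eps / 2)%R ltac:(lra)).
      apply locally_disc in G. destruct G as [d [Hd G]].
      exists (mkposreal (d / 4) ltac:(lra)). split; [|intros Q; destruct (Q H)]. intros _ y Hy.
        apply G.
      unfold disc in *. simpl in Hy. lra.
    - exists (mkposreal ((Cmod ((u, v) - c) - r) / 2) ltac:(lra)). split; [intros Q; destruct (H
      Q)|].
      intros _. simpl. lra. }
  set (delta := fun u v => proj1_sig (constructive_indefinite_description _ (A u v))).
  assert (Hdelta : forall u v,
    ((Cmod ((u, v) - c) <= r)%R ->
      forall y, disc (u, v) (4 * delta u v) y -> (Cmod (f y - f (u, v)) < eps / 2)%R) /\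
    (~ (Cmod ((u, v) - c) <= r)%R -> (2 * delta u v <= Cmod ((u, v) - c) - r)%R)).
  { intros u v. exact (proj2_sig (constructive_indefinite_description _ (A u v))). }
  clearbody delta.
  destruct (compactness_value_2d (Re c - r) (Re c + r) (Im c - r) (Im c + r) delta)
    as [d Hd].
  exists d. split; [apply cond_pos|]. intros x y Hx Hy Hxy.
  assert (Q1 := Rle_trans _ _ _ (re_le_Cmod (x - c)) Hx).
  assert (Q2 := Rle_trans _ _ _ (im_le_Cmod (x - c)) Hx).
  apply Rabs_le_between in Q1. apply Rabs_le_between in Q2.
  assert (R1 : (Re c - r <= Re x <= Re c + r)%R)
    by (unfold Re, Cminus, Cplus, Copp in *; simpl in *; lra).
  assert (R2 : (Im c - r <= Im x <= Im c + r)%R)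
    by (unfold Im, Cminus, Cplus, Copp in *; simpl in *; lra).
  destruct (NNPP _ (Hd (Re x) (Im x) R1 R2)) as (u & v & _ & _ & D1 & D2 & D3).
  assert (Dx : (Cmod (x - (u, v)) < 2 * delta u v)%R).
  { eapply Rle_lt_trans; [apply Cmod_le_abs|].
    unfold Re, Im, Cminus, Cplus, Copp in *; simpl in *.
    unfold Rminus in D1, D2. lra. }
  destruct (Hdelta u v) as [G1 G2].
  destruct (Rle_dec (Cmod ((u, v) - c)) r) as [H|H].
  - specialize (G1 H).
    assert (dp := cond_pos (delta u v)).
    assert (F1 := G1 x ltac:(unfold disc; lra)).
    assert (F2 : (Cmod (f y - f (u, v)) < eps / 2)%R).
    { apply G1. unfold disc. assert (T := Cmod_minus_triangle y x (u, v)). lra. }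
    assert (T := Cmod_minus_triangle (f y) (f (u, v)) (f x)).
    rewrite (Cmod_sym (f (u, v)) (f x)) in T. lra.
  - specialize (G2 H). exfalso.
    assert (T := Cmod_minus_triangle (u, v) x c). rewrite (Cmod_sym (u, v) x) in T. lra.
Qed.

(** * Cauchy's formula *)

Section CauchyFormula.

Variables (f F : C -> C) (c : C) (R r : R).
Hypothesis f_continuous : continuous_on (disc c R) f.
Hypothesis F_derive : forall z, disc c R z -> is_Cderive F z (f z).
Hypothesis r_pos : (0 < r)%R.
Hypothesis r_lt : (r < R)%R.

Local Notation w := (circ c r).

Lemma circ_in_disc (t : Rdefinitions.R) : disc c R (w t).
Proof. unfold disc. rewrite Cmod_circ by lra. exact r_lt. Qed.

(* For l = 1 and l = 0 the integral gives the two sides of Cauchy's formula for F.  Its derivative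
   in l is the integral of f(b + l (w - b)) (w - c), which for l <> 0 is the derivative in t of
   F(b + l (w - b)) / (i l). *)
Lemma primitive_mean_integral_constant (b : C) : disc c r b ->
  let G := fun l => Cint (fun t => F (b + RtoC l * (w t - b)) *
                         ((w t - c) / (w t - b))) 0 (2 * PI) in
  G 1%R = G 0%R.
Proof.
  intros Hb G. symmetry. apply path_derive_zero; [lra|]. intros l Hl.
  assert (TP := two_PI_pos).
  (* The points b + l (w - b) lie in the disc of radius r1, and those with s close to l in the one
     of radius r2, on whose closure f is uniformly continuous. *)
  set (r1 := ((2 * r + R) / 3)%R). set (r2 := ((r + 2 * R) / 3)%R).
  assert (Hr1 : (r < r1)%R) by (unfold r1; lra).
  assert (Hr2 : (r1 < r2)%R) by (unfold r1, r2; lra).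
  assert (Hr2R : (r2 < R)%R) by (unfold r2; lra).
  assert (Cf2 : continuous_on (disc c r2) f)
    by (intros z Hz; apply f_continuous; unfold disc in *; lra).
  assert (In1 : forall t, disc c r1 (b + RtoC l * (w t - b))).
  { intros t. apply disc_convex; [unfold disc in *; lra| |exact Hl].
    unfold disc. rewrite Cmod_circ by lra. exact Hr1. }
  assert (Len : forall t, (Cmod (w t - b) <= 2 * r)%R).
  { intros t. assert (T := Cmod_minus_triangle (w t) c b).
    rewrite Cmod_circ in T by lra. rewrite (Cmod_sym c b) in T. unfold disc in Hb. lra. }
  assert (In2 : forall s, (Rabs (s - l) * (2 * r) < r2 - r1)%R ->
    forall t, disc c r2 (b + RtoC s * (w t - b))).
  { intros s Hs t. unfold disc.
    replace (b + s * (w t - b) - c)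
      with (RtoC (s - l) * (w t - b) + (b + l * (w t - b) - c))
      by (rewrite RtoC_minus; ring).
    eapply Rle_lt_trans; [apply Cmod_triangle|]. rewrite Cmod_scal.
    assert (I := In1 t). unfold disc in I. specialize (Len t).
    assert (Rabs (s - l) * Cmod (w t - b) <= Rabs (s - l) * (2 * r))%R
      by (apply Rmult_le_compat_l; [apply Rabs_pos|exact Len]). lra. }
  set (ker := fun t => (w t - c) / (w t - b)).
  assert (Cker : forall t, Ccontinuous ker t).
  { intros t. apply Ccontinuous_div; try apply Ccontinuous_circ_minus. apply circ_neq, Hb. }
  assert (CF : forall s, (Rabs (s - l) * (2 * r) < r2 - r1)%R -> forall t,
    Ccontinuous (fun t => F (b + RtoC s * (w t - b)) * ker t) t).
  { intros s Hs t. apply Ccontinuous_mult; [|apply Cker].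
    apply (Ccontinuous_comp F).
    - apply Ccontinuous_plus; [apply Ccontinuous_const|].
      apply Ccontinuous_mult; [apply Ccontinuous_const|apply Ccontinuous_circ_minus].
    - eapply is_Cderive_continuous. apply F_derive.
      assert (I := In2 s Hs t). unfold disc in *. lra. }
  assert (Cfl : forall t, Ccontinuous (fun t => f (b + RtoC l * (w t - b)) * (w t - c)) t).
  { intros t. apply Ccontinuous_mult; [|apply Ccontinuous_circ_minus].
    apply (Ccontinuous_comp f).
    - apply Ccontinuous_plus; [apply Ccontinuous_const|].
      apply Ccontinuous_mult; [apply Ccontinuous_const|apply Ccontinuous_circ_minus].
    - apply f_continuous. assert (I := In1 t). unfold disc in *. lra. }
  (* At l = 0 the integrand is f b (w - c), and w - c has the primitive w / i in t. *)
  assert (Z : Cint (fun t => f (b + RtoC l * (w t - b)) * (w t - c)) 0 (2 * PI) = 0).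
  { destruct (Req_dec l 0) as [E|E].
    - rewrite (Cint_ext _ (fun t => f b * (w t - c))); [|lra|].
      + rewrite Cint_scal.
        * rewrite (Cint_derive (fun t => / Ci * w t)).
          -- rewrite circ_2PI. ring.
          -- lra.
          -- intros t _. replace (w t - c) with (/ Ci * (Ci * (w t - c)))
               by (field; exact Ci_neq_0).
             apply (path_derive_comp (fun z => / Ci * z)); [|apply path_derive_circ].
             eapply is_Cderive_eq.
             ++ apply is_Cderive_mult; [apply is_Cderive_const|apply is_Cderive_id].
             ++ cbv beta. ring.
          -- intros t _. apply Ccontinuous_circ_minus.
        * apply ex_Cint_circle. intros t. apply Ccontinuous_circ_minus.
      + intros t _. rewrite E. f_equal. f_equal. ring.
    - assert (El : RtoC l <> 0) by (intros Q; apply E; apply (f_equal fst) in Q; exact Q).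
      rewrite (Cint_derive (fun t => / (l * Ci) * F (b + l * (w t - b)))).
      + rewrite circ_2PI. ring.
      + lra.
      + intros t _.
        replace (f (b + l * (w t - b)) * (w t - c))
          with ((/ (l * Ci) * ((1 * l) * f (b + l * (w t - b)))) * (Ci * (w t - c)))
          by (field; split; [exact Ci_neq_0|exact El]).
        apply (path_derive_comp (fun z => / (l * Ci) * F (b + l * (z - b)))); [|apply
          path_derive_circ].
        eapply is_Cderive_eq.
        * apply is_Cderive_mult; [apply is_Cderive_const|].
          apply (is_Cderive_comp F (fun z => b + l * (z - b))).
          -- apply F_derive. assert (I := In1 t). unfold disc in *. lra.
          -- apply is_Cderive_plus; [apply is_Cderive_const|].
             apply is_Cderive_mult; [apply is_Cderive_const|].
             apply is_Cderive_minus; [apply is_Cderive_id|apply is_Cderive_const].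
        * cbv beta. ring.
      + intros t _. apply Cfl. }
  set (dl := (r - Cmod (b - c))%R). assert (Hdl : (0 < dl)%R) by (unfold dl, disc in *; lra).
  apply is_path_derive_iff. intros eps Heps.
  assert (PP := PI_RGT_0).
  (* Chosen so that 2 pi * e * 2 r * r / dl = eps: the length of the interval, the bound 2 r on |w -
     b| and the bound r / dl on the kernel. *)
  set (e := (eps * dl / (2 * PI * (2 * r) * r))%R).
  assert (He : (0 < e)%R).
  { apply Rdiv_lt_0_compat; [nra|]. assert (0 < r * r)%R by nra. nra. }
  destruct (heine_disc f c r2) with (eps := e) as [d [Hd Hunif]]; [|exact He|].
  { intros z Hz. apply f_continuous. unfold disc. lra. }
  exists (Rmin d (r2 - r1) / (2 * r))%R.
  split; [apply Rdiv_lt_0_compat; [apply Rmin_pos; lra|lra]|].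
  intros s Hs.
  assert (Hs' : (Rabs (s - l) * (2 * r) < Rmin d (r2 - r1))%R).
  { apply Rmult_lt_compat_r with (r := (2 * r)%R) in Hs; [|lra].
    replace (Rmin d (r2 - r1) / (2 * r) * (2 * r))%R with (Rmin d (r2 - r1)) in Hs by (field; lra).
    exact Hs. }
  assert (Hs1 := Rlt_le_trans _ _ _ Hs' (Rmin_l _ _)).
  assert (Hs2 := Rlt_le_trans _ _ _ Hs' (Rmin_r _ _)).
  assert (H0 : (Rabs (l - l) * (2 * r) < r2 - r1)%R) by (rewrite Rminus_diag, Rabs_R0; lra).
  assert (E : G s - G l - 0 * RtoC (s - l) =
    Cint (fun t => (F (b + RtoC s * (w t - b)) * ker t - F (b + RtoC l * (w t - b)) * ker t)
      - RtoC (s - l) * (f (b + RtoC l * (w t - b)) * (w t - c))) 0 (2 * PI)).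
  { rewrite Cint_minus.
    - rewrite Cint_minus, Cint_scal.
      + rewrite Z. unfold G, ker. ring.
      + apply ex_Cint_circle. intros t. apply Cfl.
      + apply ex_Cint_circle. intros t. apply CF, Hs2.
      + apply ex_Cint_circle. intros t. apply CF, H0.
    - apply ex_Cint_circle. intros t.
      apply Ccontinuous_minus; apply CF; assumption.
    - apply ex_Cint_circle. intros t.
      apply Ccontinuous_mult; [apply Ccontinuous_const|apply Cfl]. }
  rewrite E.
  replace (eps * Rabs (s - l))%R with ((2 * PI - 0) * (e * (Rabs (s - l) * (2 * r)) * (r * / dl)))%R
    by (unfold e; field; lra).
  apply Cmod_Cint_le; [lra| |].
  - apply ex_Cint_circle. intros t.
    apply Ccontinuous_minus; [apply Ccontinuous_minus; apply CF; assumption|].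
    apply Ccontinuous_mult; [apply Ccontinuous_const|apply Cfl].
  - intros t _.
    assert (N := circ_neq c b r t Hb).
    set (x := b + RtoC l * (w t - b)). set (y := b + RtoC s * (w t - b)).
    assert (Exy : y - x = RtoC (s - l) * (w t - b)) by (unfold x, y; rewrite RtoC_minus; ring).
    replace (F y * ker t - F x * ker t - RtoC (s - l) * (f x * (w t - c)))
      with ((F y - F x - f x * (y - x)) * ker t)
      by (rewrite Exy; unfold ker; field; exact N).
    assert (Hxy : (Cmod (y - x) <= Rabs (s - l) * (2 * r))%R).
    { rewrite Exy, Cmod_scal. apply Rmult_le_compat_l; [apply Rabs_pos|apply Len]. }
    assert (Ix : disc c r2 x) by (assert (I := In1 t); fold x in I; unfold disc in *; lra).
    assert (Iy : disc c r2 y) by (apply In2, Hs2).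
    rewrite Cmod_mult. apply Rmult_le_compat; try apply Cmod_ge_0.
    + rewrite <- (seg_derive c r2 f F x y); try assumption.
      2: { intros z Hz. apply F_derive. unfold disc in *; lra. }
      eapply Rle_trans; [apply (seg_increment_bound f c r2 x y e Cf2 Ix Iy)|].
      * intros u Hu. apply Rlt_le, Hunif.
        -- apply Rlt_le, Ix.
        -- apply Rlt_le, disc_convex; assumption.
        -- replace (x + u * (y - x) - x) with (u * (y - x)) by ring.
           rewrite Cmod_scal, Rabs_pos_eq by lra.
           assert (0 <= Cmod (y - x))%R by apply Cmod_ge_0. nra.
      * apply Rmult_le_compat_l; lra.
    + unfold ker, Cdiv. rewrite Cmod_mult, Cmod_circ by lra. apply Rmult_le_compat_l; [lra|].
      apply Cmod_inv_le; [exact Hdl|]. apply circ_dist. lra.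
Qed.

Lemma Ccontinuous_on_circ (g : C -> C) (t : Rdefinitions.R) :
  continuous_on (disc c R) g -> Ccontinuous (fun t => g (w t)) t.
Proof.
  intros Hg. apply (Ccontinuous_comp g); [apply Ccontinuous_circ|]. apply Hg, circ_in_disc.
Qed.

Lemma primitive_continuous : continuous_on (disc c R) F.
Proof. intros z Hz. exact (is_Cderive_continuous F z _ (F_derive z Hz)). Qed.

Lemma cauchy_formula_primitive (b : C) : disc c r b ->
  cauchy_int (fun t => F (w t)) c r b = F b.
Proof.
  intros Hb. assert (TP := two_PI_pos).
  assert (G := primitive_mean_integral_constant b Hb). cbv zeta beta in G.
  rewrite (Cint_ext _ (fun t => F (w t) * (w t - c) / (w t - b))) in G; [|lra|].
  2: { intros t _. replace (b + 1 * (w t - b)) with (w t) by ring.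
       unfold Cdiv. ring. }
  unfold cauchy_int. rewrite G.
  assert (O := cauchy_int_1 c r b Hb). unfold cauchy_int in O.
  rewrite (Cint_ext _ (fun t => F b * (1 * (w t - c) / (w t - b)))); [|lra|].
  2: { intros t _. replace (b + 0 * (w t - b)) with b by ring. unfold Cdiv. ring. }
  rewrite Cint_scal.
  - transitivity (F b * (/ RtoC (2 * PI) * Cint (fun t => 1 * (w t - c) / (w t - b)) 0 (2 * PI)));
      [ring|]. rewrite O. ring.
  - apply ex_Cint_circle. intros t.
    apply (cauchy_kernel_continuous (fun _ => 1)); [|exact Hb]. intros; apply Ccontinuous_const.
Qed.

(** Differentiating the formula for F gives f b as the integral of F against the squared kernel, and
    the difference to the integral of f is that of the derivative of F / (w - b) along the circle.
    The detour through F is made because at this stage the derivative of F, unlike that of f, is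
    known to be continuous. *)
Lemma cauchy_formula_of_primitive (b : C) : disc c r b ->
  cauchy_int (fun t => f (w t)) c r b = f b.
Proof.
  intros Hb. assert (TP := two_PI_pos).
  assert (CF : forall t, Ccontinuous (fun t => F (w t)) t)
    by (intros t; apply Ccontinuous_on_circ, primitive_continuous).
  assert (Cf : forall t, Ccontinuous (fun t => f (w t)) t)
    by (intros t; apply Ccontinuous_on_circ, f_continuous).
  assert (E : f b = cauchy_int2 (fun t => F (w t)) c r b).
  { apply (is_Cderive_unique F b).
    - apply F_derive. unfold disc in *. lra.
    - destruct (disc_open c b r Hb) as [d [Hd Hs]].
      apply (is_Cderive_ext_disc (cauchy_int (fun t => F (w t)) c r) F b _ d Hd).
      + intros y Hy. apply cauchy_formula_primitive, Hs, Hy.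
      + apply cauchy_int_derive; assumption. }
  rewrite E. unfold cauchy_int, cauchy_int2. f_equal.
  assert (K1 : forall t, Ccontinuous (fun t => f (w t) * (w t - c) / (w t - b)) t)
    by (intros t; apply (cauchy_kernel_continuous (fun t => f (w t))); assumption).
  assert (K2 : forall t, Ccontinuous (fun t => F (w t) * (w t - c) / ((w t - b) * (w t - b))) t)
    by (intros t; apply (cauchy_kernel2_continuous (fun t => F (w t))); assumption).
  assert (Z : Cint (fun t => f (w t) * (w t - c) / (w t - b) -
    F (w t) * (w t - c) / ((w t - b) * (w t - b))) 0 (2 * PI) = 0).
  { rewrite (Cint_derive (fun t => / Ci * (F (w t) / (w t - b)))).
    - rewrite circ_2PI. ring.
    - lra.
    - intros t _. assert (N := circ_neq c b r t Hb).
      replace (f (w t) * (w t - c) / (w t - b) -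
        F (w t) * (w t - c) / ((w t - b) * (w t - b)))
        with ((0 * (F (w t) / (w t - b)) + / Ci * ((f (w t) * (w t - b) - F (w t) * (1 - 0)) /
          ((w t - b) * (w t - b)))) * (Ci * (w t - c)))
        by (field; split; [exact N|exact Ci_neq_0]).
      apply (path_derive_comp (fun z => / Ci * (F z / (z - b)))); [|apply path_derive_circ].
      apply (is_Cderive_mult (fun _ => / Ci) (fun z => F z / (z - b))); [apply is_Cderive_const|].
      apply (is_Cderive_div F (fun z => z - b)); [apply F_derive, circ_in_disc| |exact N].
      apply is_Cderive_minus; [apply is_Cderive_id|apply is_Cderive_const].
    - intros t _. apply Ccontinuous_minus; auto. }
  rewrite Cint_minus in Z by (apply ex_Cint_circle; auto).
  set (A := Cint (fun t => f (w t) * (w t - c) / (w t - b)) 0 (2 * PI)) in *.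
  set (B := Cint (fun t => F (w t) * (w t - c) / ((w t - b) * (w t - b))) 0 (2 * PI)) in *.
  change (@eq C A B).
  transitivity ((A - B) + B); [ring|]. rewrite Z. ring.
Qed.

End CauchyFormula.

Theorem cauchy_formula (f : C -> C) (c : C) (R r : R) (b : C) :
  holomorphic_on (disc c R) f -> (r < R)%R -> disc c r b ->
  cauchy_int (fun t => f (circ c r t)) c r b = f b.
Proof.
  intros Hf Hr Hb.
  destruct (holomorphic_primitive f c R Hf) as [F HF].
  assert (P := Cmod_ge_0 (b - c)).
  apply (cauchy_formula_of_primitive f F c R r); try assumption.
  - apply holomorphic_on_continuous, Hf.
  - unfold disc in Hb. lra.
Qed.

Lemma holomorphic_on_circ_continuous (f : C -> C) (c : C) (R r t : R) :
  holomorphic_on (disc c R) f -> (0 <= r < R)%R -> Ccontinuous (fun t => f (circ c r t)) t.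
Proof.
  intros Hf Hr. apply (Ccontinuous_comp f); [apply Ccontinuous_circ|].
  apply holomorphic_continuous, Hf. unfold disc. rewrite Cmod_circ; lra.
Qed.

Lemma disc_radius (c z : C) (R : R) : disc c R z -> exists r, (0 < r < R)%R /\ disc c r z.
Proof.
  unfold disc. intros H. assert (P := Cmod_ge_0 (z - c)).
  exists ((Cmod (z - c) + R) / 2)%R. lra.
Qed.

(** By Cauchy's formula f is a Cauchy integral near each point, so its derivative is [cauchy_int2]
    there. *)
Theorem holomorphic_derivative (f : C -> C) (c : C) (R : R) :
  holomorphic_on (disc c R) f ->
  exists f', holomorphic_on (disc c R) f' /\ forall z, disc c R z -> is_Cderive f z (f' z).
Proof.
  intros Hf. exists (C_derive f).
  assert (D : forall z, disc c R z -> is_Cderive f z (C_derive f z)).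
  { intros z Hz. destruct (Hf z Hz) as [l Hl].
    rewrite (is_C_derive_unique f z l Hl). exact Hl. }
  split; [|exact D]. intros z Hz.
  destruct (disc_radius c z R Hz) as [r [Hr Hzr]].
  assert (Cc : forall t, Ccontinuous (fun t => f (circ c r t)) t).
  { intros t. apply (holomorphic_on_circ_continuous f c R); [exact Hf|lra]. }
  destruct (disc_open c z r Hzr) as [d [Hd Hs]].
  apply (holomorphic_ext_disc (cauchy_int2 (fun t => f (circ c r t)) c r) _ z d Hd).
  - intros y Hy. specialize (Hs y Hy).
    apply (is_Cderive_unique f y).
    + destruct (disc_open c y r Hs) as [d' [Hd' Hs']].
      apply (is_Cderive_ext_disc (cauchy_int (fun t => f (circ c r t)) c r) f y _ d' Hd').
      * intros x Hx. apply (cauchy_formula f c R); [exact Hf|lra|apply Hs', Hx].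
      * apply cauchy_int_derive; assumption.
    + apply D. unfold disc in *. lra.
  - apply cauchy_int2_holomorphic; assumption.
Qed.

(** Cauchy's formula survives the uniform limit, and a Cauchy integral of a continuous function is
    holomorphic. *)
Theorem holomorphic_uniform_limit (u : nat -> C -> C) (f : C -> C) (c : C) (R : R) :
  (forall n, holomorphic_on (disc c R) (u n)) ->
  (forall eps, (0 < eps)%R -> exists n, forall z, disc c R z -> (Cmod (u n z - f z) <= eps)%R) ->
  holomorphic_on (disc c R) f.
Proof.
  intros Hu Hlim.
  assert (Cf : continuous_on (disc c R) f).
  { intros z Hz. apply Ccontinuous_iff. intros eps Heps.
    destruct (Hlim (eps / 3)%R ltac:(lra)) as [n Hn].
    assert (G := proj1 (Ccontinuous_iff (u n) z) (holomorphic_continuous _ _ (Hu n z Hz)) (eps /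
      3)%R ltac:(lra)).
    apply locally_disc in G. destruct G as [d [Hd G]].
    destruct (disc_open c z R Hz) as [d' [Hd' Hs]].
    apply locally_disc. exists (Rmin d d'). split; [apply Rmin_pos; assumption|].
    intros y Hy.
    assert (Hy1 := disc_sub _ _ _ _ (Rmin_l _ _) Hy).
    assert (Hy2 := disc_sub _ _ _ _ (Rmin_r _ _) Hy).
    specialize (G y Hy1). assert (A1 := Hn y (Hs y Hy2)). assert (A2 := Hn z Hz).
    assert (T1 := Cmod_minus_triangle (f y) (u n y) (f z)).
    assert (T2 := Cmod_minus_triangle (u n y) (u n z) (f z)).
    rewrite (Cmod_sym (f y) (u n y)) in T1. lra. }
  intros z Hz.
  destruct (disc_radius c z R Hz) as [r [Hr Hzr]].
  assert (Cc : forall t, Ccontinuous (fun t => f (circ c r t)) t).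
  { intros t. apply (Ccontinuous_comp f); [apply Ccontinuous_circ|]. apply Cf.
    unfold disc. rewrite Cmod_circ; lra. }
  assert (Cu : forall n t, Ccontinuous (fun t => u n (circ c r t)) t).
  { intros n t. apply (holomorphic_on_circ_continuous (u n) c R); [apply Hu|lra]. }
  destruct (disc_open c z r Hzr) as [d [Hd Hs]].
  apply (holomorphic_ext_disc (cauchy_int (fun t => f (circ c r t)) c r) _ z d Hd).
  2: { eexists. apply cauchy_int_derive; assumption. }
  intros y Hy. specialize (Hs y Hy).
  assert (Z : Cmod (cauchy_int (fun t => f (circ c r t)) c r y - f y) = 0%R).
  2: { apply Cminus_eq_0, Cmod_eq_0, Z. }
  apply Rle_antisym; [|apply Cmod_ge_0]. apply le_epsilon. intros eps Heps. rewrite Rplus_0_l.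
  set (q := (r / (r - Cmod (y - c)))%R).
  assert (Hq : (0 < q)%R) by (apply Rdiv_lt_0_compat; unfold disc in Hs; lra).
  destruct (Hlim (eps / (q + 1))%R ltac:(apply Rdiv_lt_0_compat; lra)) as [n Hn].
  assert (A1 : (Cmod (u n y - f y) <= eps / (q + 1))%R) by (apply Hn; unfold disc in *; lra).
  assert (A2 : (Cmod (cauchy_int (fun t => f (circ c r t)) c r y - u n y) <= eps / (q + 1) * q)%R).
  { rewrite <- (cauchy_formula (u n) c R r y (Hu n)) by (exact Hs || lra).
    rewrite <- cauchy_int_minus by auto.
    apply cauchy_int_bound.
    - intros t. apply Ccontinuous_minus; auto.
    - exact Hs.
    - intros t _. rewrite Cmod_sym. apply Hn. unfold disc. rewrite Cmod_circ; lra. }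
  assert (T := Cmod_minus_triangle (cauchy_int (fun t => f (circ c r t)) c r y) (u n y) (f y)).
  replace eps with (eps / (q + 1) * q + eps / (q + 1))%R by (field; lra). lra.
Qed.

(** * Taylor expansion and logarithms *)

Lemma Cpow_neq_0 (x : C) (n : nat) : x <> 0 -> x ^ n <> 0.
Proof.
  intros Hx. apply Cmod_gt_0. rewrite Cmod_pow. apply pow_lt. apply Cmod_gt_0, Hx.
Qed.

(** One step of the geometric expansion of the kernel: 1 / (w - b) = 1 / (w - c) + (b - c) / ((w -
    c) (w - b)). *)
Lemma cauchy_int_taylor (phi : R -> C) (c : C) (r : R) (b : C) :
  (forall t, Ccontinuous phi t) -> disc c r b ->
  cauchy_int phi c r b = cauchy_int phi c r c
    + (b - c) * cauchy_int (fun t => phi t / (circ c r t - c)) c r b.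
Proof.
  intros Hphi Hb. assert (TP := two_PI_pos).
  assert (Hr : (0 < r)%R) by (unfold disc in Hb; assert (P := Cmod_ge_0 (b - c)); lra).
  assert (Hc : disc c r c) by (apply disc_center, Hr).
  assert (E : forall t, Ccontinuous (fun t => phi t / (circ c r t - c)) t).
  { intros t. apply Ccontinuous_div; [apply Hphi|apply Ccontinuous_circ_minus|apply circ_neq, Hc]. }
  unfold cauchy_int.
  rewrite (Cint_ext (fun t => phi t * (circ c r t - c) / (circ c r t - b))
    (fun t => phi t * (circ c r t - c) / (circ c r t - c) +
      (b - c) * (phi t / (circ c r t - c) * (circ c r t - c) / (circ c r t - b)))); [|lra|].
  - rewrite Cint_plus, Cint_scal.
    + ring.
    + apply ex_Cint_circle. intros t.
      apply (cauchy_kernel_continuous (fun t => phi t / (circ c r t - c))); assumption.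
    + apply ex_Cint_circle. intros t. apply cauchy_kernel_continuous; assumption.
    + apply ex_Cint_circle. intros t.
      apply Ccontinuous_mult; [apply Ccontinuous_const|].
      apply (cauchy_kernel_continuous (fun t => phi t / (circ c r t - c))); assumption.
  - intros t _. field. split; apply circ_neq; assumption.
Qed.

Section Taylor.

Variables (f : C -> C) (c : C) (R r : R).
Hypothesis f_holomorphic : holomorphic_on (disc c R) f.
Hypothesis r_pos : (0 < r)%R.
Hypothesis r_lt : (r < R)%R.

Local Notation w := (circ c r).

(* f(z) is the sum of the (z - c)^k taylor_rem k c, k < n, and of (z - c)^n taylor_rem n z. *)
Definition taylor_rem (n : nat) : C -> C :=
  cauchy_int (fun t => f (w t) / (w t - c) ^ n) c r.

Lemma taylor_kernel_continuous (n : nat) (t : Rdefinitions.R) :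
  Ccontinuous (fun t => f (w t) / (w t - c) ^ n) t.
Proof.
  apply Ccontinuous_div.
  - apply (holomorphic_on_circ_continuous f c R); [assumption|lra].
  - apply (Ccontinuous_comp (fun z => (z - c) ^ n)); [apply Ccontinuous_circ|].
    apply holomorphic_continuous, (holomorphic_pow (fun z => z - c)).
    apply holomorphic_minus; [apply holomorphic_id|apply holomorphic_const].
  - apply Cpow_neq_0, circ_neq, disc_center, r_pos.
Qed.

Lemma taylor_rem_holomorphic (n : nat) : holomorphic_on (disc c r) (taylor_rem n).
Proof.
  intros z Hz. exact (ex_intro _ _ (cauchy_int_derive _ c r (taylor_kernel_continuous n) z Hz)).
Qed.

Lemma taylor_rem_0 (z : C) : disc c r z -> taylor_rem 0 z = f z.
Proof.
  intros Hz. rewrite <- (cauchy_formula f c R r z) by assumption.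
  unfold taylor_rem. apply cauchy_int_ext. intros t. simpl. field.
Qed.

Lemma taylor_rem_S (n : nat) (z : C) : disc c r z ->
  taylor_rem n z = taylor_rem n c + (z - c) * taylor_rem (S n) z.
Proof.
  intros Hz. unfold taylor_rem.
  rewrite (cauchy_int_taylor (fun t => f (w t) / (w t - c) ^ n) c r z
    (taylor_kernel_continuous n) Hz). do 2 f_equal.
  apply cauchy_int_ext. intros t. simpl. field.
  assert (N := circ_neq c c r t (disc_center c r r_pos)).
  split; [apply Cpow_neq_0, N|exact N].
Qed.

Lemma taylor_rem_bound : exists M, (0 < M)%R /\ forall n z, disc c r z ->
  (Cmod (taylor_rem n z) <= M / r ^ n * (r / (r - Cmod (z - c))))%R.
Proof.
  destruct (path_bounded (fun t => f (w t)) 0 (2 * PI) (Rlt_le _ _ two_PI_pos)) as [M [HM H]].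
  { intros t. apply (holomorphic_on_circ_continuous f c R); [assumption|lra]. }
  exists M. split; [exact HM|]. intros n z Hz.
  apply (cauchy_int_bound (fun t => f (w t) / (w t - c) ^ n) c r
    (taylor_kernel_continuous n) z _ Hz).
  intros t Ht. rewrite Cmod_div by (apply Cpow_neq_0, circ_neq, disc_center, r_pos).
  rewrite Cmod_pow, Cmod_circ by lra. apply Rmult_le_compat_r; [|apply H, Ht].
  apply Rlt_le, Rinv_0_lt_compat, pow_lt, r_pos.
Qed.

(** On the smaller disc the remainder is at most M (r / (r - rho)) (rho / r)^N. *)
Lemma taylor_rem_pow_bound (eps : Rdefinitions.R) (rho : Rdefinitions.R) :
  (0 < eps)%R -> (0 < rho < r)%R ->
  exists N, forall z, disc c rho z -> (Cmod ((z - c) ^ N * taylor_rem N z) <= eps)%R.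
Proof.
  intros He Hrho. destruct taylor_rem_bound as [M [HM HB]].
  destruct (geometric_small (M * (r / (r - rho))) (rho / r) eps) as [N HN].
  - apply Rmult_le_pos; [lra|]. apply Rlt_le, Rdiv_lt_0_compat; lra.
  - split; [apply Rlt_le, Rdiv_lt_0_compat; lra|].
    apply Rmult_lt_reg_r with r; [exact r_pos|]. unfold Rdiv. rewrite Rmult_assoc, Rinv_l; lra.
  - exact He.
  - exists N. intros z Hz. rewrite Cmod_mult, Cmod_pow.
    assert (Hz' : disc c r z) by (unfold disc in *; lra).
    assert (B := HB N z Hz'). unfold disc in Hz, Hz'.
    assert (P := Cmod_ge_0 (z - c)).
    apply Rle_trans with (rho ^ N * (M / r ^ N * (r / (r - rho))))%R.
    + apply Rmult_le_compat.
      * apply pow_le, P.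
      * apply Cmod_ge_0.
      * apply pow_incr. lra.
      * eapply Rle_trans; [exact B|]. apply Rmult_le_compat_l.
        -- apply Rlt_le, Rdiv_lt_0_compat; [exact HM|apply pow_lt, r_pos].
        -- apply Rmult_le_compat_l; [lra|]. apply Rinv_le_contravar; lra.
    + left. replace (rho ^ N * (M / r ^ N * (r / (r - rho))))%R
        with (M * (r / (r - rho)) * (rho / r) ^ N)%R; [exact HN|].
      unfold Rdiv. rewrite Rpow_mult_distr, pow_inv. ring.
Qed.

(** q is the Taylor polynomial of degree below N; what is passed on is that it is defined on the
    whole plane. *)
Lemma taylor_expansion (N : nat) : exists q, entire q /\
  forall z, disc c r z -> f z = q z + (z - c) ^ N * taylor_rem N z.
Proof.
  induction N as [|N [q [Hq IH]]].
  - exists (fun _ => RtoC 0). split; [intros z; apply holomorphic_const|].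
    intros z Hz. rewrite taylor_rem_0 by exact Hz. simpl. ring.
  - exists (fun z => q z + (z - c) ^ N * taylor_rem N c). split.
    + intros z. apply (holomorphic_plus q (fun z => (z - c) ^ N * taylor_rem N c)); [apply Hq|].
      apply (holomorphic_mult (fun z => (z - c) ^ N) (fun _ => taylor_rem N c)); [|apply
        holomorphic_const].
      apply (holomorphic_pow (fun z => z - c)).
      apply holomorphic_minus; [apply holomorphic_id|apply holomorphic_const].
    + intros z Hz. rewrite (IH z Hz), (taylor_rem_S N z Hz). simpl. ring.
Qed.

End Taylor.

Theorem polynomial_approximation (f : C -> C) (c : C) (R rho eps : R) :
  holomorphic_on (disc c R) f -> (0 < rho < R)%R -> (0 < eps)%R ->
  exists q, entire q /\ forall z, disc c rho z -> (Cmod (f z - q z) <= eps)%R.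
Proof.
  intros Hf Hrho He. set (r := ((rho + R) / 2)%R).
  assert (Hr : (rho < r < R)%R) by (unfold r; lra).
  destruct (taylor_rem_pow_bound f c R r Hf ltac:(lra) ltac:(lra) eps rho He ltac:(lra)) as [N HN].
  destruct (taylor_expansion f c R r Hf ltac:(lra) ltac:(lra) N) as [q [Hq E]].
  exists q. split; [exact Hq|]. intros z Hz.
  rewrite (E z) by (unfold disc in *; lra).
  replace (q z + (z - c) ^ N * taylor_rem f c r N z - q z)
    with ((z - c) ^ N * taylor_rem f c r N z) by ring.
  apply HN, Hz.
Qed.

(** The Taylor coefficients are the numbers [taylor_rem n c]. For the first nonzero one, h is the
    remainder of that order; if all vanish, f equals every remainder term (z - c)^N
    [taylor_rem N z], and these tend to 0. *)
Theorem zero_order (f : C -> C) (c : C) (R : R) :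
  (0 < R)%R -> holomorphic_on (disc c R) f ->
  exists d, (0 < d)%R /\
  ((forall z, disc c d z -> f z = 0) \/
   exists n h, holomorphic_on (disc c d) h /\ (forall z, disc c d z -> h z <> 0) /\
     forall z, disc c d z -> f z = (z - c) ^ n * h z).
Proof.
  intros HR Hf. set (r := (R / 2)%R).
  assert (Hr : (0 < r)%R) by (unfold r; lra). assert (HrR : (r < R)%R) by (unfold r; lra).
  assert (Hc := disc_center c r Hr).
  destruct (classic (exists n, taylor_rem f c r n c <> 0)) as [H|H].
  - destruct (dec_inh_nat_subset_has_unique_least_element
      (fun n => taylor_rem f c r n c <> 0)) as [n [[Hn Hmin] _]].
    { intros n. apply classic. }
    { exact H. }
    assert (E : forall k, (k <= n)%nat -> forall z, disc c r z ->
      f z = (z - c) ^ k * taylor_rem f c r k z).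
    { intros k. induction k as [|k IH]; intros Hk z Hz.
      - rewrite (taylor_rem_0 f c R) by assumption. simpl. ring.
      - rewrite (IH ltac:(lia) z Hz), (taylor_rem_S f c R r Hf Hr HrR k z Hz).
        assert (Z : taylor_rem f c r k c = 0).
        { apply NNPP. intros Q. specialize (Hmin k Q). lia. }
        rewrite Z. simpl. ring. }
    assert (Hh := taylor_rem_holomorphic f c R r Hf Hr HrR n).
    assert (NB := Ccontinuous_neq0 _ _ (holomorphic_continuous _ _ (Hh c Hc)) Hn).
    apply locally_disc in NB. destruct NB as [d [Hd NB]].
    exists (Rmin d r). split; [apply Rmin_pos; assumption|]. right.
    assert (M1 := Rmin_l d r). assert (M2 := Rmin_r d r).
    assert (S1 : forall z, disc c (Rmin d r) z -> disc c d z) by (unfold disc; intros; lra).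
    assert (S2 : forall z, disc c (Rmin d r) z -> disc c r z) by (unfold disc; intros; lra).
    exists n, (taylor_rem f c r n). repeat split.
    + intros z Hz. apply Hh, S2, Hz.
    + intros z Hz. apply NB, S1, Hz.
    + intros z Hz. apply E; auto.
  - assert (Z : forall n, taylor_rem f c r n c = 0).
    { intros n. apply NNPP. intros Q. apply H. exists n. exact Q. }
    assert (E : forall k z, disc c r z -> f z = (z - c) ^ k * taylor_rem f c r k z).
    { intros k. induction k as [|k IH]; intros z Hz.
      - rewrite (taylor_rem_0 f c R) by assumption. simpl. ring.
      - rewrite (IH z Hz), (taylor_rem_S f c R r Hf Hr HrR k z Hz), Z. simpl. ring. }
    exists (r / 2)%R. split; [lra|]. left. intros z Hz. apply Cmod_eq_0.
    apply Rle_antisym; [|apply Cmod_ge_0]. apply le_epsilon. intros eps He. rewrite Rplus_0_l.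
    destruct (taylor_rem_pow_bound f c R r Hf Hr HrR eps (r / 2) He ltac:(lra)) as [N HN].
    rewrite (E N z) by (unfold disc in *; lra). apply HN, Hz.
Qed.

(** For a primitive L of k' / k the quotient k / exp L has derivative zero; an additive constant l
    in the exponent adjusts its value at z0. *)
Theorem holomorphic_log (k : C -> C) (c : C) (R : R) :
  holomorphic_on (disc c R) k -> (forall z, disc c R z -> k z <> 0) ->
  exists L, holomorphic_on (disc c R) L /\ forall z, disc c R z -> k z = Cexp (L z).
Proof.
  intros Hk N.
  destruct (holomorphic_derivative k c R Hk) as [k' [Hk' Dk]].
  destruct (holomorphic_primitive (fun z => k' z / k z) c R) as [L HL].
  { intros z Hz. apply holomorphic_div; auto. }
  (* For R <= 0 the disc is empty and any L will do. *)
  destruct (classic (exists z, disc c R z)) as [[z0 Hz0]|E].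
  2: { exists L. split; intros z Hz; destruct E; exists z; exact Hz. }
  destruct (Cexp_surj (k z0 / Cexp (L z0))) as [l Hl].
  { intros Q. apply (N z0 Hz0).
    transitivity (k z0 / Cexp (L z0) * Cexp (L z0)); [field; apply Cexp_neq_0|].
    rewrite Q. ring. }
  exists (fun z => L z + l). split.
  - intros z Hz. apply holomorphic_plus; [|apply holomorphic_const].
    eexists. apply HL, Hz.
  - intros z Hz.
    assert (E : k z / Cexp (L z) = k z0 / Cexp (L z0)).
    { apply (derive_zero_const c R (fun z => k z / Cexp (L z))); try assumption.
      intros x Hx. eapply is_Cderive_eq.
      - apply is_Cderive_div; [apply Dk, Hx| |apply Cexp_neq_0].
        apply (is_Cderive_comp Cexp L); [apply is_Cderive_Cexp|apply HL, Hx].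
      - cbv beta. field. split; [apply N, Hx|apply Cexp_neq_0]. }
    rewrite Cexp_plus, Hl, <- E. field. apply Cexp_neq_0.
Qed.

(** * Meromorphic functions as quotients of entire functions *)

(* x = [a : b] in homogeneous coordinates. *)
Definition quotient_at (x : P1) (a b : C) : Prop :=
  match x with
  | aff w => b <> 0 /\ a = w * b
  | infty => b = 0 /\ a <> 0
  end.

(** [quotient_at] excludes a = b = 0, so f and g have no common zero on U. *)
Definition represents (s : C -> P1) (U : C -> Prop) (f g : C -> C) : Prop :=
  forall z, U z -> holomorphic_at f z /\ holomorphic_at g z /\ quotient_at (s z) (f z) (g z).

Lemma quotient_at_scale (x : P1) (a b k : C) :
  k <> 0 -> quotient_at x a b -> quotient_at x (k * a) (k * b).
Proof.
  intros Hk. destruct x as [w|]; simpl; intros [H1 H2].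
  - split; [apply Cmult_neq_0; assumption|]. rewrite H2. ring.
  - split; [rewrite H1; ring|]. apply Cmult_neq_0; assumption.
Qed.

Lemma quotient_at_infty (x : P1) (a b : C) : quotient_at x a b -> (x = infty <-> b = 0).
Proof.
  destruct x as [w|]; simpl; intros [H1 H2]; split; intros H; try tauto; discriminate.
Qed.

Lemma quotient_at_not_both (x : P1) (a b : C) : quotient_at x a b -> b = 0 -> a <> 0.
Proof. destruct x as [w|]; simpl; intros [H1 H2] H; tauto. Qed.

Lemma quotient_at_cross (x : P1) (a b a' b' : C) :
  quotient_at x a b -> quotient_at x a' b' -> a * b' = a' * b.
Proof.
  destruct x as [w|]; simpl; intros [H1 H2] [H3 H4].
  - rewrite H2, H4. ring.
  - rewrite H1, H3. ring.
Qed.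

(** s is w / 1 near a finite value and 1 / v near a pole. In the second case, the derivative at a
    nearby finite value is given in the coordinate w and has to be converted to v. *)
Lemma meromorphic_local (s : C -> P1) (c : C) : meromorphic s ->
  exists d f g, (0 < d)%R /\ represents s (disc c d) f g.
Proof.
  intros Hs. destruct (Hs c) as [b Hb]. unfold is_derive_P1 in Hb.
  destruct (s c) as [w|] eqn:Ec; destruct Hb as [Hl _]; apply locally_disc in Hl;
    destruct Hl as [d [Hd Hl]].
  - exists d, (fun z => coord_w (s z)), (fun _ => RtoC 1). split; [exact Hd|].
    intros z Hz. split; [|split; [apply holomorphic_const|]].
    + destruct (Hs z) as [b' Hb']. unfold is_derive_P1 in Hb'.
      destruct (s z) eqn:E; [|destruct (Hl z Hz E)]. exists b'. apply Hb'.
    + destruct (s z) eqn:E; [|destruct (Hl z Hz E)]. simpl. split; [|ring].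
      exact C1_nz.
  - exists d, (fun _ => RtoC 1), (fun z => coord_v (s z)). split; [exact Hd|].
    intros z Hz. split; [apply holomorphic_const|split].
    + destruct (Hs z) as [b' Hb']. unfold is_derive_P1 in Hb'.
      destruct (s z) as [w|] eqn:E.
      * assert (Hw : w <> 0) by (intros Q; subst w; exact (Hl z Hz E)).
        destruct Hb' as [Hl' Hb']. apply locally_disc in Hl'. destruct Hl' as [d' [Hd' Hl']].
        apply (holomorphic_ext_disc (fun t => / coord_w (s t)) _ z d' Hd').
        -- intros y Hy. destruct (s y) eqn:Ey; [reflexivity|destruct (Hl' y Hy Ey)].
        -- apply (holomorphic_comp Cinv (fun t => coord_w (s t))).
           ++ eexists. apply is_Cderive_inv. rewrite E. exact Hw.
           ++ exists b'. exact Hb'.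
      * exists b'. apply Hb'.
    + destruct (s z) as [w|] eqn:E; simpl.
      * assert (Hw : w <> 0) by (intros Q; subst w; exact (Hl z Hz E)).
        split; [apply Cinv_neq_0, Hw|field; exact Hw].
      * split; [reflexivity|exact C1_nz].
Qed.

(** The denominator of a local quotient has finite order at c. Otherwise s is identically infinite
    near c, and the points with this property form a clopen set, hence the whole plane. *)
Lemma meromorphic_order (s : C -> P1) (c : C) :
  meromorphic s -> (exists z, s z <> infty) ->
  exists d f h n, (0 < d)%R /\ represents s (disc c d) f (fun z => (z - c) ^ n * h z) /\
    holomorphic_on (disc c d) h /\ (forall z, disc c d z -> h z <> 0).
Proof.
  intros Hs [z0 Hz0].
  assert (A : forall a, (exists d, (0 < d)%R /\ forall z, disc a d z -> s z = infty) \/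
    exists d f h n, (0 < d)%R /\ represents s (disc a d) f (fun z => (z - a) ^ n * h z) /\
    holomorphic_on (disc a d) h /\ (forall z, disc a d z -> h z <> 0)).
  { intros a. destruct (meromorphic_local s a Hs) as (d & f & g & Hd & Hrep).
    destruct (zero_order g a d Hd) as [d' [Hd' H]].
    { intros z Hz. apply Hrep, Hz. }
    assert (M1 := Rmin_l d d'). assert (M2 := Rmin_r d d').
    assert (M0 : (0 < Rmin d d')%R) by (apply Rmin_pos; assumption).
    destruct H as [H|(n & h & Hh & Nh & E)].
    - left. exists (Rmin d d'). split; [exact M0|]. intros z Hz.
      destruct (Hrep z (disc_sub _ _ _ _ M1 Hz)) as (_ & _ & Q).
      apply (quotient_at_infty _ _ _ Q). apply H, (disc_sub _ _ _ _ M2 Hz).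
    - right. exists (Rmin d d'), f, h, n. split; [exact M0|]. split; [|split].
      + intros z Hz. destruct (Hrep z (disc_sub _ _ _ _ M1 Hz)) as (Hf & Hg & Q).
        split; [exact Hf|split].
        * destruct (disc_open _ _ _ Hz) as [e [He Hs']].
          apply (holomorphic_ext_disc g _ z e He); [|exact Hg].
          intros y Hy. apply E, (disc_sub _ _ _ _ M2), Hs', Hy.
        * rewrite <- E by (apply (disc_sub _ _ _ _ M2), Hz). exact Q.
      + intros z Hz. apply Hh, (disc_sub _ _ _ _ M2), Hz.
      + intros z Hz. apply Nh, (disc_sub _ _ _ _ M2), Hz. }
  destruct (A c) as [Hc|H]; [exfalso|exact H].
  apply Hz0.
  assert (Q : exists d, (0 < d)%R /\ forall z, disc z0 d z -> s z = infty).
  { apply (clopen_plane (fun a => exists d, (0 < d)%R /\ forall z, disc a d z -> s z = infty) c z0);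
      [| |exact Hc].
    - intros a [d [Hd H]]. apply locally_disc. exists d. split; [exact Hd|]. intros y Hy.
      destruct (disc_open a y d Hy) as [d' [Hd' Hs']]. exists d'. split; [exact Hd'|]. auto.
    (* Where the order is finite, the denominator can vanish only at the centre a, so no nearby y
       has a neighbourhood of poles. *)
    - intros a Na. destruct (A a) as [H|(d & f & h & n & Hd & Hrep & _ & Nh)]; [tauto|].
      apply locally_disc. exists d. split; [exact Hd|]. intros y Hy Py.
      destruct (Ceq_dec y a) as [E|E]; [subst y; tauto|].
      destruct Py as [d' [Hd' H']].
      destruct (Hrep y Hy) as (_ & _ & Q).
      apply (Cmult_neq_0 ((y - a) ^ n) (h y)).
      + apply Cpow_neq_0, Cminus_neq_0, E.
      + apply Nh, Hy.
      + apply (quotient_at_infty _ _ _ Q), H', disc_center, Hd'. }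
  destruct Q as [d [Hd H]]. apply H, disc_center, Hd.
Qed.

Lemma poles_isolated (s : C -> P1) (c : C) :
  meromorphic s -> (exists z, s z <> infty) ->
  exists d, (0 < d)%R /\ forall z, disc c d z -> z <> c -> s z <> infty.
Proof.
  intros Hs H0. destruct (meromorphic_order s c Hs H0) as (d & f & h & n & Hd & Hrep & _ & Nh).
  exists d. split; [exact Hd|]. intros z Hz Nz E.
  destruct (Hrep z Hz) as (_ & _ & Q). apply (quotient_at_infty _ _ _ Q) in E.
  apply (Cmult_neq_0 ((z - c) ^ n) (h z)); [|apply Nh, Hz|exact E].
  apply Cpow_neq_0, Cminus_neq_0, Nz.
Qed.

(** The square around the disc is covered by finitely many squares in each of which only the centre
    can be a pole. *)
Lemma poles_finite (s : C -> P1) (r : R) :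
  meromorphic s -> (exists z, s z <> infty) ->
  exists l : list C, forall z, disc 0 r z -> s z = infty -> In z l.
Proof.
  intros Hs H0.
  (* An element of [Tn 2 R] is a pair of reals followed by [tt]. A square of half-side delta lies in
     the disc of radius 2 delta, whence the factor. *)
  assert (A : forall t : Compactness.Tn 2 R, exists d : posreal,
    forall z, disc (fst t, fst (snd t)) (2 * d) z -> z <> (fst t, fst (snd t)) -> s z <> infty).
  { intros t. destruct (poles_isolated s (fst t, fst (snd t)) Hs H0) as [d [Hd H]].
    exists (mkposreal (d / 2) ltac:(lra)). intros z Hz. apply H. unfold disc in *. simpl in Hz.
      lra. }
  set (delta := fun t => proj1_sig (constructive_indefinite_description _ (A t))).
  assert (Hdelta : forall t z, disc (fst t, fst (snd t)) (2 * delta t) z ->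
    z <> (fst t, fst (snd t)) -> s z <> infty)
    by (intros t; exact (proj2_sig (constructive_indefinite_description _ (A t)))).
  clearbody delta.
  destruct (NNPP _ (compactness_list 2 ((- r)%R, ((- r)%R, tt)) (r, (r, tt)) delta)) as [l Hl].
  exists (map (fun t : Compactness.Tn 2 R => ((fst t, fst (snd t)) : C)) l).
  intros z Hz E. unfold disc in Hz. replace (z - 0) with z in Hz by ring.
  assert (Q1 := Rle_lt_trans _ _ _ (re_le_Cmod z) Hz). apply Rabs_lt_between in Q1.
  assert (Q2 := Rle_lt_trans _ _ _ (im_le_Cmod z) Hz). apply Rabs_lt_between in Q2.
  destruct (Hl (Re z, (Im z, tt))) as [t [Ht [_ Hc]]].
  { simpl. repeat split; lra. }
  assert (D : (Rabs (Re z - fst t) < delta t /\ Rabs (Im z - fst (snd t)) < delta t)%R)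
    by (clear - Hc; destruct t as [t1 [t2 t3]]; simpl in *; tauto).
  destruct D as [D1 D2].
  destruct (Ceq_dec z (fst t, fst (snd t))) as [Ez|Nz].
  - rewrite Ez. apply (in_map (fun t : Compactness.Tn 2 R => ((fst t, fst (snd t)) : C))), Ht.
  - exfalso. apply (Hdelta t z); [|exact Nz|exact E].
    unfold disc. eapply Rle_lt_trans; [apply Cmod_le_abs|].
    unfold Re, Im, Cminus, Cplus, Copp in *; simpl in *. unfold Rminus in *. lra.
Qed.

Lemma neq_disc (x a : C) : x <> a -> exists d, (0 < d)%R /\ forall y, disc x d y -> y <> a.
Proof.
  intros N. exists (Cmod (a - x)). split.
  - apply Cmod_gt_0, Cminus_neq_0. auto.
  - intros y Hy E. subst y. unfold disc in Hy. lra.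
Qed.

(* Outside of [l] the function [f] is only [g * s], which may still have poles. *)
Lemma represents_near_list (s : C -> P1) (l : list C) :
  meromorphic s -> (exists z, s z <> infty) ->
  exists f g, entire g /\ (forall z, ~ In z l -> g z <> 0) /\
    forall z, (s z = infty -> In z l) ->
      holomorphic_at f z /\ quotient_at (s z) (f z) (g z).
Proof.
  intros Hs H0. induction l as [|a l (f & g & Hg & Ng & H)].
  - exists (fun z => coord_w (s z)), (fun _ => RtoC 1).
    split; [intros z; apply holomorphic_const|]. split; [intros; exact C1_nz|].
    intros z Hz. destruct (Hs z) as [b Hb]. unfold is_derive_P1 in Hb.
    destruct (s z) as [w|]; [|destruct (Hz eq_refl)]. split; [exists b; apply Hb|].
    simpl. split; [exact C1_nz|ring].
  - destruct (classic (s a = infty /\ ~ In a l)) as [[Ea Na]|N].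
    (* If a is no pole, or is already listed, the pair for l serves unchanged. *)
    2: { exists f, g. split; [exact Hg|]. split.
         - intros z Hz. apply Ng. intros Q. apply Hz. right. exact Q.
         - intros z Hz. apply H. intros E. destruct (Hz E) as [Q|Q]; [|exact Q].
           subst z. apply NNPP. intros Q. apply N. tauto. }
    destruct (meromorphic_order s a Hs H0) as (d & f0 & h & n & Hd & Hrep & Hh & Nh).
    (* Near a, off a itself, f / g and f0 / ((z - a)^n h) both represent s, so (z - a)^n f = f0 g /
       h; the right-hand side gives the value at a. *)
    set (f' := fun z => if Ceq_dec z a then f0 a * g a / h a else (z - a) ^ n * f z).
    exists f', (fun z => (z - a) ^ n * g z).
    assert (Hp : forall z, holomorphic_at (fun z => (z - a) ^ n) z).
    { intros z. apply (holomorphic_pow (fun z => z - a)).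
      apply holomorphic_minus; [apply holomorphic_id|apply holomorphic_const]. }
    split; [|split].
    + intros z. apply (holomorphic_mult (fun z => (z - a) ^ n) g); [apply Hp|apply Hg].
    + intros z Hz. apply Cmult_neq_0.
      * apply Cpow_neq_0, Cminus_neq_0. intros E. apply Hz. left. auto.
      * apply Ng. intros Q. apply Hz. right. exact Q.
    + intros z Hz. destruct (Ceq_dec z a) as [E|E].
      * subst z. destruct (poles_isolated s a Hs H0) as [d' [Hd' Hiso]].
        assert (Ha := disc_center a d Hd). destruct (Hrep a Ha) as (Hf0 & Hg0 & Q0).
        rewrite Ea in Q0. destruct Q0 as [Z0 N0].
        assert (Zp : (a - a) ^ n = 0).
        { apply NNPP. intros Q. apply (Cmult_neq_0 _ _ Q (Nh a Ha)). exact Z0. }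
        split.
        -- apply (holomorphic_ext_disc (fun z => f0 z * g z / h z) f' a (Rmin d d')).
           ++ apply Rmin_pos; assumption.
           ++ intros y Hy. unfold f'. destruct (Ceq_dec y a) as [E|E]; [subst y; reflexivity|].
              assert (Hy1 := disc_sub _ _ _ _ (Rmin_l d d') Hy).
              assert (Hy2 := disc_sub _ _ _ _ (Rmin_r d d') Hy).
              assert (Ny := Hiso y Hy2 E).
              destruct (H y ltac:(tauto)) as [_ Q1]. destruct (Hrep y Hy1) as (_ & _ & Q2).
              assert (K := quotient_at_cross _ _ _ _ _ Q1 Q2).
              assert (Nhy := Nh y Hy1).
              transitivity ((f0 y * g y) / h y); [reflexivity|].
              rewrite <- K. field. exact Nhy.
           ++ apply (holomorphic_div (fun z => f0 z * g z) h).
              ** apply holomorphic_mult; [exact Hf0|apply Hg].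
              ** apply Hh, Ha.
              ** apply Nh, Ha.
        -- rewrite Ea. split.
           ++ rewrite Zp. ring.
           ++ unfold f'. destruct (Ceq_dec a a) as [_|Q]; [|tauto].
              apply Cmult_neq_0; [apply Cmult_neq_0; [exact N0|apply Ng, Na]|].
              apply Cinv_neq_0, Nh, Ha.
      * assert (Hz' : s z = infty -> In z l).
        { intros Q. destruct (Hz Q) as [Q'|Q']; [|exact Q']. destruct E. auto. }
        destruct (H z Hz') as [Hf Q]. split.
        -- destruct (neq_disc z a E) as [e [He Hne]].
           apply (holomorphic_ext_disc (fun z => (z - a) ^ n * f z) f' z e He).
           ++ intros y Hy. unfold f'. destruct (Ceq_dec y a) as [Ey|_]; [|reflexivity].
              destruct (Hne y Hy Ey).
           ++ apply (holomorphic_mult (fun z => (z - a) ^ n) f); [apply Hp|exact Hf].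
        -- unfold f'. destruct (Ceq_dec z a) as [Ez|_]; [tauto|].
           apply quotient_at_scale; [|exact Q]. apply Cpow_neq_0, Cminus_neq_0, E.
Qed.

Lemma represents_on_disc (s : C -> P1) (r : R) :
  meromorphic s -> (exists z, s z <> infty) -> exists f g, represents s (disc 0 r) f g.
Proof.
  intros Hs H0. destruct (poles_finite s r Hs H0) as [l Hl].
  destruct (represents_near_list s l Hs H0) as (f & g & Hg & _ & H).
  exists f, g. intros z Hz. destruct (H z (Hl z Hz)) as [Hf Q].
  split; [exact Hf|split; [apply Hg|exact Q]].
Qed.

(** k is G / g, or F / f at the zeros of g. By cross-multiplication the two agree where both are
    defined, and since neither pair has common zeros, k is holomorphic and nowhere zero. *)
Lemma represents_ratio (s : C -> P1) (c : C) (r : R) (f g F G : C -> C) :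
  represents s (disc c r) f g -> represents s (disc c r) F G ->
  exists k, holomorphic_on (disc c r) k /\ (forall z, disc c r z -> k z <> 0) /\
    forall z, disc c r z -> F z = k z * f z /\ G z = k z * g z.
Proof.
  intros H1 H2.
  set (k := fun z => if Ceq_dec (g z) 0 then F z / f z else G z / g z).
  assert (E : forall z, disc c r z -> f z <> 0 -> k z = F z / f z).
  { intros z Hz N. unfold k. destruct (Ceq_dec (g z) 0) as [Q|Q]; [reflexivity|].
    destruct (H1 z Hz) as (_ & _ & Q1). destruct (H2 z Hz) as (_ & _ & Q2).
    assert (K := quotient_at_cross _ _ _ _ _ Q1 Q2).
    transitivity ((f z * G z) / (f z * g z)); [field; auto|]. rewrite K. field; auto. }
  assert (P : forall z, disc c r z -> F z = k z * f z /\ G z = k z * g z).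
  { intros z Hz. destruct (H1 z Hz) as (_ & _ & Q1). destruct (H2 z Hz) as (_ & _ & Q2).
    assert (K := quotient_at_cross _ _ _ _ _ Q1 Q2).
    unfold k. destruct (Ceq_dec (g z) 0) as [Q|Q].
    - assert (Nf := quotient_at_not_both _ _ _ Q1 Q). split; [field; exact Nf|].
      assert (Es := proj2 (quotient_at_infty _ _ _ Q1) Q).
      apply (quotient_at_infty _ _ _ Q2) in Es. rewrite Q, Es. ring.
    - split; [|field; exact Q]. transitivity ((F z * g z) / g z); [field; exact Q|].
      rewrite <- K. field. exact Q. }
  exists k. split; [|split; [|exact P]].
  - intros z Hz. destruct (H1 z Hz) as (Hf & Hg & Q1). destruct (H2 z Hz) as (HF & HG & Q2).
    destruct (disc_open _ _ _ Hz) as [d [Hd Hs]].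
    destruct (Ceq_dec (g z) 0) as [Q|Q].
    + assert (Nf := quotient_at_not_both _ _ _ Q1 Q).
      assert (L := Ccontinuous_neq0 f z (holomorphic_continuous f z Hf) Nf).
      apply locally_disc in L. destruct L as [e [He L]].
      apply (holomorphic_ext_disc (fun z => F z / f z) k z (Rmin d e)).
      * apply Rmin_pos; assumption.
      * intros y Hy. symmetry. apply E.
        -- apply Hs, (disc_sub _ _ _ _ (Rmin_l d e)), Hy.
        -- apply L, (disc_sub _ _ _ _ (Rmin_r d e)), Hy.
      * apply holomorphic_div; assumption.
    + assert (L := Ccontinuous_neq0 g z (holomorphic_continuous g z Hg) Q).
      apply locally_disc in L. destruct L as [e [He L]].
      apply (holomorphic_ext_disc (fun z => G z / g z) k z e He).
      * intros y Hy. unfold k. destruct (Ceq_dec (g y) 0) as [Z|_]; [|reflexivity].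
        destruct (L y Hy Z).
      * apply holomorphic_div; assumption.
  - intros z Hz Z. destruct (P z Hz) as [E1 E2]. destruct (H2 z Hz) as (_ & _ & Q2).
    rewrite Z in E1, E2. apply (quotient_at_not_both _ _ _ Q2).
    + rewrite E2. ring.
    + rewrite E1. ring.
Qed.

(** As q is entire, the factor exp (-q) may be applied on the whole larger disc; on the old one exp
    (L - q) is left, with L - q small on the disc of radius r1. *)
Lemma represents_correction (s : C -> P1) (r1 r2 r3 eps : R) (f g : C -> C) :
  meromorphic s -> (exists z, s z <> infty) ->
  (0 < r1 < r2)%R -> (r2 <= r3)%R -> (0 < eps)%R ->
  represents s (disc 0 r2) f g ->
  exists F G e, represents s (disc 0 r3) F G /\ holomorphic_on (disc 0 r2) e /\
    (forall z, disc 0 r1 z -> (Cmod (e z) <= eps)%R) /\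
    forall z, disc 0 r2 z -> F z = Cexp (e z) * f z /\ G z = Cexp (e z) * g z.
Proof.
  intros Hs H0 Hr Hr3 Heps H.
  destruct (represents_on_disc s r3 Hs H0) as (F & G & HFG).
  destruct (represents_ratio s 0 r2 f g F G H) as (k & Hk & Nk & E).
  { intros z Hz. apply HFG, (disc_sub _ _ _ _ Hr3), Hz. }
  destruct (holomorphic_log k 0 r2 Hk Nk) as [L [HL EL]].
  destruct (polynomial_approximation L 0 r2 r1 eps HL Hr Heps) as [q [Hq Bq]].
  exists (fun z => Cexp (- q z) * F z), (fun z => Cexp (- q z) * G z), (fun z => L z - q z).
  assert (He : forall z, holomorphic_at (fun z => Cexp (- q z)) z).
  { intros z. apply (holomorphic_Cexp (fun z => - q z)), holomorphic_opp, Hq. }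
  split; [|split; [|split; [exact Bq|]]].
  - intros z Hz. destruct (HFG z Hz) as (A1 & A2 & A3). split; [|split].
    + apply (holomorphic_mult (fun z => Cexp (- q z)) F); [apply He|exact A1].
    + apply (holomorphic_mult (fun z => Cexp (- q z)) G); [apply He|exact A2].
    + apply quotient_at_scale; [apply Cexp_neq_0|exact A3].
  - intros z Hz. apply holomorphic_minus; [apply HL, Hz|apply Hq].
  - intros z Hz. destruct (E z Hz) as [E1 E2]. unfold Cminus. rewrite Cexp_plus, <- (EL z Hz), E1,
    E2.
    split; ring.
Qed.

(** Consecutive pairs are both defined on the disc of radius n + 2; the approximation of the
    logarithm loses 1 in the radius, so e n is small on the disc of radius n + 1. *)
Lemma weierstrass_sequence (s : C -> P1) :
  meromorphic s -> (exists z, s z <> infty) ->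
  exists f g e : nat -> C -> C, forall n,
    represents s (disc 0 (INR n + 2)) (f n) (g n) /\
    holomorphic_on (disc 0 (INR n + 2)) (e n) /\
    (forall z, disc 0 (INR n + 1) z -> (Cmod (e n z) <= (1 / 2) ^ n)%R) /\
    forall z, disc 0 (INR n + 2) z ->
      f (S n) z = Cexp (e n z) * f n z /\ g (S n) z = Cexp (e n z) * g n z.
Proof.
  intros Hs H0.
  (* The index belongs to the state, so that the next choice knows the disc on which the current
     pair is valid. *)
  set (good := fun t : nat * (C -> C) * (C -> C) =>
    represents s (disc 0 (INR (fst (fst t)) + 2)) (snd (fst t)) (snd t)).
  destruct (represents_on_disc s (INR 0 + 2) Hs H0) as (f0 & g0 & H).
  destruct (dependent_choice (A := {t | good t})
    (fun a b => let n := fst (fst (proj1_sig a)) in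
      fst (fst (proj1_sig b)) = S n /\ exists e,
        holomorphic_on (disc 0 (INR n + 2)) e /\
        (forall z, disc 0 (INR n + 1) z -> (Cmod (e z) <= (1 / 2) ^ n)%R) /\
        forall z, disc 0 (INR n + 2) z ->
          snd (fst (proj1_sig b)) z = Cexp (e z) * snd (fst (proj1_sig a)) z /\
          snd (proj1_sig b) z = Cexp (e z) * snd (proj1_sig a) z)
    (exist good (0%nat, f0, g0) H)) as [u [Hu0 Hu]].
  { intros [[[n f] g] Hn]. simpl. unfold good in Hn. simpl in Hn.
    assert (Pn := pos_INR n).
    destruct (represents_correction s (INR n + 1) (INR n + 2) (INR (S n) + 2) ((1 / 2) ^ n) f g)
      as (F & G & e & H1 & H2); try assumption.
    - lra.
    - rewrite S_INR. lra.
    - apply pow_lt. lra.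
    - exists (exist good (S n, F, G) H1). simpl. split; [reflexivity|]. exists e. exact H2. }
  assert (N : forall n, fst (fst (proj1_sig (u n))) = n).
  { intros n. induction n as [|n IH]; [rewrite Hu0; reflexivity|].
    destruct (Hu n) as [E _]. rewrite E, IH. reflexivity. }
  set (e := fun n => proj1_sig (constructive_indefinite_description _ (proj2 (Hu n)))).
  exists (fun n => snd (fst (proj1_sig (u n)))), (fun n => snd (proj1_sig (u n))), e.
  intros n. split.
  - assert (G := proj2_sig (u n)). unfold good in G. rewrite N in G. exact G.
  - assert (G := proj2_sig (constructive_indefinite_description _ (proj2 (Hu n)))).
    cbv beta zeta in G. fold (e n) in G. clearbody e. rewrite N in G. exact G.
Qed.

(** * Convergence of the corrections *)

Fixpoint partial_sum (e : nat -> C -> C) (m N : nat) (z : C) : C :=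
  match N with
  | O => 0
  | S N => partial_sum e m N z + e (m + N)%nat z
  end.

(** The definition splits off the last term; the recursion between consecutive tails needs the first
    one. *)
Lemma partial_sum_S (e : nat -> C -> C) (m N : nat) (z : C) :
  partial_sum e m (S N) z = e m z + partial_sum e (S m) N z.
Proof.
  induction N as [|N IH].
  - simpl. rewrite Nat.add_0_r. ring.
  - change (partial_sum e m (S N) z + e (m + S N)%nat z
      = e m z + (partial_sum e (S m) N z + e (S m + N)%nat z)).
    rewrite IH. replace (m + S N)%nat with (S m + N)%nat by lia. ring.
Qed.

Lemma Rle_geometric_0 (x K : R) : (forall N, (x <= K * (1 / 2) ^ N)%R) -> (x <= 0)%R.
Proof.
  intros H. apply le_epsilon. intros eps He. rewrite Rplus_0_l.
  destruct (geometric_small (Rabs K) (1/2) eps) as [N HN]; [apply Rabs_pos|lra|exact He|].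
  specialize (H N). assert (P : (0 <= (1/2)^N)%R) by (apply pow_le; lra).
  assert (Q := Rle_abs K). nra.
Qed.

(** H m is the tail e m + e (m + 1) + ..., a uniform limit of its partial sums on the disc of radius
    m + 1, where all of its terms are defined and small. *)
Lemma geometric_series_holomorphic (e : nat -> C -> C) :
  (forall n, holomorphic_on (disc 0 (INR n + 1)) (e n)) ->
  (forall n z, disc 0 (INR n + 1) z -> (Cmod (e n z) <= (1 / 2) ^ n)%R) ->
  exists H : nat -> C -> C, (forall m, holomorphic_on (disc 0 (INR m + 1)) (H m)) /\
    forall m z, disc 0 (INR m + 1) z -> H m z = e m z + H (S m) z.
Proof.
  intros He B.
  assert (Mono : forall m k z, disc 0 (INR m + 1) z -> disc 0 (INR (m + k) + 1) z).
  { intros m k z. apply disc_sub. rewrite plus_INR. assert (P := pos_INR k). lra. }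
  assert (A : forall m z, exists p, disc 0 (INR m + 1) z ->
    forall N, (Cmod (p - partial_sum e m N z) <= 2 * (1 / 2) ^ m * (1 / 2) ^ N)%R).
  { intros m z. destruct (classic (disc 0 (INR m + 1) z)) as [Hz|Hz]; [|exists (RtoC 0); tauto].
    destruct (geometric_limit (fun N => partial_sum e m N z) ((1 / 2) ^ m)) as [p Hp].
    - intros N. simpl.
      replace (partial_sum e m N z + e (m + N)%nat z - partial_sum e m N z) with (e (m + N)%nat z)
        by ring.
      rewrite <- pow_add. apply B, Mono, Hz.
    - exists p. intros _. exact Hp. }
  set (H := fun m z => proj1_sig (constructive_indefinite_description _ (A m z))).
  assert (HH : forall m z, disc 0 (INR m + 1) z ->
    forall N, (Cmod (H m z - partial_sum e m N z) <= 2 * (1 / 2) ^ m * (1 / 2) ^ N)%R)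
    by (intros m z; exact (proj2_sig (constructive_indefinite_description _ (A m z)))).
  clearbody H. exists H. split.
  - intros m. apply (holomorphic_uniform_limit (fun N => partial_sum e m N)).
    + intros N z Hz. induction N as [|N IH]; simpl; [apply holomorphic_const|].
      apply (holomorphic_plus (partial_sum e m N)); [exact IH|]. apply He, Mono, Hz.
    + intros eps Heps.
      destruct (geometric_small (2 * (1/2) ^ m) (1/2) eps) as [N HN].
      * assert (0 < (1/2)^m)%R by (apply pow_lt; lra). lra.
      * lra.
      * exact Heps.
      * exists N. intros z Hz. rewrite Cmod_sym. specialize (HH m z Hz N). lra.
  - intros m z Hz.
    assert (Z : (Cmod (H m z - (e m z + H (S m) z)) <= 0)%R).
    { apply (Rle_geometric_0 _ (2 * (1/2)^m + 2 * (1/2)^(S m))). intros N.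
      assert (Hz' : disc 0 (INR (S m) + 1) z).
      { replace (S m) with (m + 1)%nat by lia. apply Mono, Hz. }
      assert (B1 := HH m z Hz (S N)). assert (B2 := HH (S m) z Hz' N).
      rewrite partial_sum_S in B1.
      replace (H m z - (e m z + H (S m) z))
        with ((H m z - (e m z + partial_sum e (S m) N z)) - (H (S m) z - partial_sum e (S m) N z))
          by ring.
      eapply Rle_trans; [apply Cmod_minus_le|].
      assert (P1 : (0 < (1/2)^m)%R) by (apply pow_lt; lra).
      assert (P2 : (0 < (1/2)^N)%R) by (apply pow_lt; lra).
      simpl in *. nra. }
    assert (Z' : Cmod (H m z - (e m z + H (S m) z)) = 0%R).
    { apply Rle_antisym; [exact Z|apply Cmod_ge_0]. }
    apply Cminus_eq_0, Cmod_eq_0, Z'.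
Qed.

(** From f (m + 1) = exp (e m) f m and H m = e m + H (m + 1) it follows that exp (H m) f m does not
    depend on m where it is defined, and likewise for g. The pieces glue to entire functions. *)
Theorem meromorphic_quotient (s : C -> P1) :
  meromorphic s -> (exists z, s z <> infty) ->
  exists f g, entire f /\ entire g /\ forall z, quotient_at (s z) (f z) (g z).
Proof.
  intros Hs H0. destruct (weierstrass_sequence s Hs H0) as (f & g & e & W).
  destruct (geometric_series_holomorphic e) as (H & HH & EH).
  { intros n z Hz. apply (W n). apply (disc_sub _ (INR n + 1)); [lra|exact Hz]. }
  { intros n. apply (W n). }
  assert (V : forall m k z, disc 0 (INR m + 1) z ->
    Cexp (H (m + k)%nat z) * f (m + k)%nat z = Cexp (H m z) * f m z /\
    Cexp (H (m + k)%nat z) * g (m + k)%nat z = Cexp (H m z) * g m z).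
  { intros m k z Hz. induction k as [|k [IH1 IH2]]; [rewrite Nat.add_0_r; auto|].
    rewrite <- IH1, <- IH2, Nat.add_succ_r.
    assert (Hz' : disc 0 (INR (m + k) + 1) z).
    { apply (disc_sub _ (INR m + 1)); [|exact Hz]. rewrite plus_INR. assert (P := pos_INR k). lra. }
    destruct (W (m + k)%nat) as (_ & _ & _ & E).
    destruct (E z) as [E1 E2]; [apply (disc_sub _ (INR (m + k) + 1)); [lra|exact Hz']|].
    rewrite E1, E2, (EH _ _ Hz'), Cexp_plus. split; ring. }
  (* F and G use an index chosen separately for each z; [V'] replaces it by one index valid on a
     neighbourhood, where holomorphy can be read off. *)
  assert (A : forall z : C, exists n : nat, (Cmod z < INR n)%R) by (intros z; apply INR_unbounded).
  set (N := fun z => proj1_sig (constructive_indefinite_description _ (A z))).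
  assert (HN : forall z, (Cmod z < INR (N z))%R)
    by (intros z; exact (proj2_sig (constructive_indefinite_description _ (A z)))).
  clearbody N.
  set (F := fun z => Cexp (H (N z) z) * f (N z) z).
  set (G := fun z => Cexp (H (N z) z) * g (N z) z).
  assert (D : forall m (z : C), (Cmod z < INR m)%R -> disc 0 (INR m + 1) z).
  { intros m z Hz. unfold disc. replace (z - 0) with z by ring. lra. }
  assert (V' : forall m z, (Cmod z < INR m)%R ->
    F z = Cexp (H m z) * f m z /\ G z = Cexp (H m z) * g m z).
  { intros m z Hz.
    destruct (V m (N z) z (D _ _ Hz)) as [P1 P2].
    destruct (V (N z) m z (D _ _ (HN z))) as [P3 P4].
    rewrite (Nat.add_comm m) in P1, P2. unfold F, G. split; congruence. }
  assert (HF : forall z, holomorphic_at F z /\ holomorphic_at G z /\ quotient_at (s z) (F z) (G z)).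
  { intros z. assert (Hz := HN z).
    destruct (W (N z)) as (Rm & _ & _ & _).
    destruct (Rm z) as (Hf & Hg & Q); [apply (disc_sub _ (INR (N z) + 1)); [lra|apply D, Hz]|].
    assert (HE : holomorphic_at (fun y => Cexp (H (N z) y)) z)
      by (apply (holomorphic_Cexp (H (N z))), HH, D, Hz).
    assert (Dm : disc 0 (INR (N z)) z) by (unfold disc; replace (z - 0) with z by ring; exact Hz).
    destruct (disc_open _ _ _ Dm) as [d [Hd Hsub]].
    assert (Hsub' : forall y, disc z d y -> (Cmod y < INR (N z))%R).
    { intros y Hy. specialize (Hsub y Hy). unfold disc in Hsub.
      replace (y - 0) with y in Hsub by ring. exact Hsub. }
    split; [|split].
    - apply (holomorphic_ext_disc (fun y => Cexp (H (N z) y) * f (N z) y) F z d Hd).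
      + intros y Hy. symmetry. apply V', Hsub', Hy.
      + apply holomorphic_mult; assumption.
    - apply (holomorphic_ext_disc (fun y => Cexp (H (N z) y) * g (N z) y) G z d Hd).
      + intros y Hy. symmetry. apply V', Hsub', Hy.
      + apply holomorphic_mult; assumption.
    - apply quotient_at_scale; [apply Cexp_neq_0|exact Q]. }
  exists F, G. split; [|split]; intros z; apply HF.
Qed.

(** * Plurisubharmonicity of log |Phi| *)

Fixpoint rotation_product (F : C -> C) (h : R) (n : nat) (l : C) : C :=
  match n with
  | O => 1
  | S n => rotation_product F h n l * F (cis (INR n * h) * l)
  end.

Lemma rotation_product_entire (F : C -> C) (h : R) (n : nat) :
  entire F -> entire (rotation_product F h n).
Proof.
  intros HF. induction n as [|n IH]; intros z; simpl; [apply holomorphic_const|].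
  apply (holomorphic_mult (rotation_product F h n)); [apply IH|].
  apply (holomorphic_comp F (fun l => cis (INR n * h) * l)); [apply HF|].
  apply holomorphic_mult; [apply holomorphic_const|apply holomorphic_id].
Qed.

Lemma rotation_product_0 (F : C -> C) (h : R) (n : nat) :
  rotation_product F h n 0 = F 0 ^ n.
Proof.
  induction n as [|n IH]; simpl; [reflexivity|]. rewrite IH.
  replace (cis (INR n * h) * 0) with (RtoC 0) by ring. ring.
Qed.

Lemma rotation_product_S (F : C -> C) (h : R) (n : nat) (l : C) :
  rotation_product F h (S n) l = F l * rotation_product F h n (cis h * l).
Proof.
  induction n as [|n IH].
  - simpl. rewrite Rmult_0_l, cis_0, !Cmult_1_l, Cmult_1_r. reflexivity.
  - change (rotation_product F h (S n) l * F (cis (INR (S n) * h) * l) =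
      F l * (rotation_product F h n (cis h * l) * F (cis (INR n * h) * (cis h * l)))).
    rewrite IH, S_INR, Rmult_plus_distr_r, Rmult_1_l, cis_plus, !Cmult_assoc. reflexivity.
Qed.

(** Rotation by h permutes the n + 1 factors cyclically, as their angles fill a full turn. *)
Lemma rotation_product_shift (F : C -> C) (h : R) (n : nat) (l : C) :
  (INR (S n) * h = 2 * PI)%R ->
  rotation_product F h (S n) (cis h * l) = rotation_product F h (S n) l.
Proof.
  intros E. rewrite rotation_product_S at 1. rewrite (rotation_product_S F h n l).
  transitivity (rotation_product F h (S n) (cis h * l)).
  - rewrite rotation_product_S. reflexivity.
  - change (rotation_product F h n (cis h * l) * F (cis (INR n * h) * (cis h * l)) =
      F l * rotation_product F h n (cis h * l)).
    rewrite (Cmult_assoc (cis (INR n * h))), <- cis_plus.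
    replace (INR n * h + h)%R with (2 * PI)%R by (rewrite S_INR in E; lra).
    rewrite cis_2PI, Cmult_1_l. ring.
Qed.

Lemma rotation_product_shift_iter (F : C -> C) (h : R) (n j : nat) (l : C) :
  (INR (S n) * h = 2 * PI)%R ->
  rotation_product F h (S n) (cis (INR j * h) * l) = rotation_product F h (S n) l.
Proof.
  intros E. induction j as [|j IH].
  - simpl INR. rewrite Rmult_0_l, cis_0, Cmult_1_l. reflexivity.
  - rewrite S_INR, Rmult_plus_distr_r, Rmult_1_l, Rplus_comm, cis_plus, <- Cmult_assoc.
    rewrite rotation_product_shift by exact E. exact IH.
Qed.

Lemma exp_le (x y : R) : (x <= y)%R -> (exp x <= exp y)%R.
Proof.
  intros [H|H]; [left; apply exp_increasing, H|right; f_equal; exact H].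
Qed.

(** The angles t, t + h, ... fall one into each interval of length h. As psi varies by at most eps
    over such an interval, h psi at the tag exceeds the integral of psi over it by at most eps h. *)
Lemma rotation_product_bound (F : C -> C) (psi : R -> R) (h eps t : R) (n : nat) :
  (forall x, continuous psi x) -> (0 < h)%R -> (0 <= t <= h)%R ->
  (forall x, (0 <= x <= INR n * h)%R -> (Cmod (F (cis x)) <= exp (psi x))%R) ->
  (forall x y, (0 <= x <= INR n * h)%R -> (0 <= y <= INR n * h)%R -> (Rabs (x - y) <= h)%R ->
    (Rabs (psi x - psi y) <= eps)%R) ->
  (Cmod (rotation_product F h n (cis t)) <= exp ((RInt psi 0 (INR n * h) + eps * (INR n * h)) /
    h))%R.
Proof.
  intros Hpsi Hh Ht. induction n as [|n IH]; intros HF Hu.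
  - simpl. rewrite Cmod_1, Rmult_0_l, RInt_point.
    apply Rle_trans with (exp 0); [rewrite exp_0; lra|]. right. f_equal.
    change (0 = (0 + eps * 0) / h)%R. field. lra.
  - assert (Pn := pos_INR n). rewrite S_INR in *.
    assert (Hn : (0 <= INR n * h)%R) by (apply Rmult_le_pos; lra).
    assert (IH' := IH (fun x Hx => HF x ltac:(nra))
      (fun x y Hx Hy => Hu x y ltac:(nra) ltac:(nra))).
    simpl rotation_product. rewrite Cmod_mult, <- cis_plus.
    assert (EI : forall a b, ex_RInt psi a b).
    { intros a b. apply (ex_RInt_continuous (V := R_CompleteNormedModule)). auto. }
    set (a := (INR n * h)%R) in *.
    replace ((INR n + 1) * h)%R with (a + h)%R in * by (unfold a; ring).
    assert (I : (h * psi (a + t) <= RInt psi a (a + h) + eps * h)%R).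
    { assert (L : (RInt (fun _ => psi (a + t) - eps) a (a + h) <= RInt psi a (a + h))%R).
      { apply RInt_le; [lra|apply ex_RInt_const|apply EI|]. intros x Hx.
        assert (G := Hu (a + t)%R x ltac:(lra) ltac:(lra)
          ltac:(apply Rabs_le; lra)).
        assert (G' := Rle_abs (psi (a + t) - psi x)%R). lra. }
      rewrite RInt_const in L. unfold scal in L; simpl in L; unfold mult in L; simpl in L. lra. }
    assert (Ch : (RInt psi 0 (a + h) = RInt psi 0 a + RInt psi a (a + h))%R).
    { symmetry. apply (RInt_Chasles (V := R_CompleteNormedModule)); apply EI. }
    rewrite Ch.
    replace ((RInt psi 0 a + RInt psi a (a + h) + eps * (a + h)) / h)%R
      with ((RInt psi 0 a + eps * a) / h + (RInt psi a (a + h) + eps * h) / h)%R by (field; lra).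
    rewrite exp_plus. apply Rmult_le_compat; try apply Cmod_ge_0; [exact IH'|].
    eapply Rle_trans; [apply HF; lra|]. apply exp_le.
    apply Rmult_le_reg_l with h; [exact Hh|].
    replace (h * ((RInt psi a (a + h) + eps * h) / h))%R with (RInt psi a (a + h) + eps * h)%R by
      (field; lra).
    exact I.
Qed.

(* The product of the N rotates F(w^k l), w = exp(2 i pi / N), is entire with value F(0)^N at the
   origin, and on the unit circle it is at most exp of N times a Riemann sum of psi with tags in
   consecutive intervals.  The mean value property then gives the inequality as N grows. *)
Theorem log_modulus_submean (F : C -> C) (psi : R -> R) :
  entire F -> (forall x, continuous psi x) ->
  (forall x, (0 <= x <= 2 * PI)%R -> (Cmod (F (cis x)) <= exp (psi x))%R) ->
  F 0 <> 0 -> (ln (Cmod (F 0)) <= RInt psi 0 (2 * PI) / (2 * PI))%R.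
Proof.
  intros HF Hpsi HB N0. assert (TP := two_PI_pos).
  apply le_epsilon. intros eps Heps.
  assert (Hpt : forall x, (0 <= x <= 2 * PI)%R -> continuity_pt psi x)
    by (intros x _; apply continuity_pt_filterlim, Hpsi).
  destruct (Heine_cor2 Hpt (mkposreal eps Heps)) as [d Hd].
  simpl in Hd.
  destruct (INR_unbounded (2 * PI / d)) as [N HN].
  assert (dp := cond_pos d).
  assert (N1 : (0 < INR (S N))%R) by apply lt_0_INR, Nat.lt_0_succ.
  set (h := (2 * PI / INR (S N))%R).
  assert (Hh : (0 < h)%R) by (apply Rdiv_lt_0_compat; assumption).
  assert (Eh : (INR (S N) * h = 2 * PI)%R) by (unfold h; field; lra).
  assert (Hhd : (h < d)%R).
  { apply Rmult_lt_reg_l with (INR (S N)); [exact N1|]. rewrite Eh.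
    apply Rmult_lt_compat_r with (r := d) in HN; [|exact dp].
    replace (2 * PI / d * d)%R with (2 * PI)%R in HN by (field; lra).
    rewrite S_INR. lra. }
  set (P := rotation_product F h (S N)).
  assert (HP : entire P) by (apply rotation_product_entire, HF).
  set (B := exp ((RInt psi 0 (2 * PI) + eps * (2 * PI)) / h)).
  assert (Bd : forall x, (0 <= x <= 2 * PI)%R -> (Cmod (P (cis x)) <= B)%R).
  { intros x Hx.
    (* Rotation by j h leaves the product unchanged, so x may be replaced by t in [0, h]. Then all
       tags stay in [0, 2 pi], where psi is known to be a majorant. *)
    destruct (nfloor_ex (x / h)) as [j Hj].
    { apply Rmult_le_pos; [lra|]. apply Rlt_le, Rinv_0_lt_compat, Hh. }
    set (t := (x - INR j * h)%R).
    assert (Ht : (0 <= t <= h)%R).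
    { assert (Ex : (x = x / h * h)%R) by (field; lra). unfold t. nra. }
    replace (cis x) with (cis (INR j * h) * cis t)
      by (rewrite <- cis_plus; f_equal; unfold t; ring).
    unfold P, B. rewrite rotation_product_shift_iter by exact Eh. rewrite <- Eh.
    apply rotation_product_bound; try assumption.
    - rewrite Eh. exact HB.
    - rewrite Eh. intros y z Hy Hz Hyz. apply Rlt_le, Hd; auto. lra. }
  assert (M : (Cmod (P 0) <= B)%R).
  { rewrite <- (cauchy_formula P 0 2 1 0).
    - replace B with (B * (1 / (1 - Cmod (0 - 0))))%R
        by (rewrite Cmod_minus_self; field).
      apply cauchy_int_bound.
      + intros t. apply (holomorphic_on_circ_continuous P 0 2); [intros z _; apply HP|lra].
      + apply disc_center. lra.
      + intros t Ht. replace (circ 0 1 t) with (cis t) by (unfold circ; ring). apply Bd, Ht.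
    - intros z _. apply HP.
    - lra.
    - apply disc_center. lra. }
  unfold P in M. rewrite rotation_product_0, Cmod_pow in M.
  assert (P0 := proj1 (Cmod_gt_0 _) N0).
  assert (L : (INR (S N) * ln (Cmod (F 0)) <= (RInt psi 0 (2 * PI) + eps * (2 * PI)) / h)%R).
  { rewrite <- ln_pow by exact P0. rewrite <- (ln_exp ((RInt psi 0 (2 * PI) + eps * (2 * PI)) / h)).
    apply ln_le; [apply pow_lt, P0|exact M]. }
  apply Rmult_le_reg_l with (INR (S N)); [exact N1|].
  eapply Rle_trans; [exact L|]. right. unfold h. field. lra.
Qed.

Definition log_modulus (x : C) : Rbar :=
  if Ceq_dec x 0 then m_infty else Finite (ln (Cmod x)).

Lemma log_modulus_lt (x : C) (c : R) : Rbar_lt (log_modulus x) c <-> (Cmod x < exp c)%R.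
Proof.
  unfold log_modulus. destruct (Ceq_dec x 0) as [E|E]; simpl.
  - rewrite E, Cmod_0. split; intros _; [apply exp_pos|exact I].
  - apply Cmod_gt_0 in E. split; intros H.
    + rewrite <- (exp_ln (Cmod x)) by exact E. apply exp_increasing, H.
    + rewrite <- (ln_exp c). apply ln_increasing; assumption.
Qed.

Lemma log_modulus_le (x : C) (c : R) : Rbar_le (log_modulus x) c <-> (Cmod x <= exp c)%R.
Proof.
  unfold log_modulus. destruct (Ceq_dec x 0) as [E|E]; simpl.
  - rewrite E, Cmod_0. split; intros _; [apply Rlt_le, exp_pos|exact I].
  - apply Cmod_gt_0 in E. split; intros H.
    + rewrite <- (exp_ln (Cmod x)) by exact E. apply exp_le, H.
    + rewrite <- (ln_exp c). apply ln_le; assumption.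
Qed.

(** Along a complex line Phi is an entire function F of one variable, to which [log_modulus_submean]
    applies; where F 0 = 0 the left-hand side is -oo. *)
Theorem log_modulus_plurisubharmonic (D : C * C -> Prop) (Phi : C * C -> C) :
  (forall a, continuous (T := C2_NormedModule) (U := C_UniformSpace) Phi a) ->
  (forall a b : C * C, entire (fun l => Phi (fst a + l * fst b, snd a + l * snd b))) ->
  plurisubharmonic D (fun x => log_modulus (Phi x)).
Proof.
  intros Hc He. split; [|split].
  - intros a _. unfold log_modulus. destruct Ceq_dec; discriminate.
  - intros a _ c H. apply log_modulus_lt in H.
    generalize (proj1 (Ccontinuous_iff (T := C2_NormedModule) Phi a) (Hc a)
      (exp c - Cmod (Phi a))%R ltac:(lra)).
    apply filter_imp. intros x Hx. apply log_modulus_lt.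
    assert (T := Cmod_triangle_inv (Phi x) (Phi a)). lra.
  - intros a b _ psi Hpsi H.
    set (F := fun l => Phi (fst a + l * fst b, snd a + l * snd b)).
    assert (E : Phi a = F 0).
    { unfold F. destruct a as [a1 a2]. simpl. f_equal. f_equal; ring. }
    rewrite E. unfold log_modulus at 1. destruct (Ceq_dec (F 0) 0) as [Z|Z]; [exact I|].
    simpl. apply log_modulus_submean; [apply He|exact Hpsi| |exact Z].
    intros x Hx. rewrite cis_eq. apply log_modulus_le. apply H, Hx.
Qed.

(** * Differentiability in two variables *)

Lemma locally_polydisc (a : C * C) (P : C * C -> Prop) :
  locally (T := C2_NormedModule) a P <->
  exists d, (0 < d)%R /\ forall x, polydisc a d x -> P x.
Proof.
  split.
  - intros [d H]. exists d. split; [apply cond_pos|]. intros x [H1 H2]. apply H.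
    split; split; simpl.
    + eapply Rle_lt_trans; [apply (re_le_Cmod (fst x - fst a))|exact H1].
    + eapply Rle_lt_trans; [apply (im_le_Cmod (fst x - fst a))|exact H1].
    + eapply Rle_lt_trans; [apply (re_le_Cmod (snd x - snd a))|exact H2].
    + eapply Rle_lt_trans; [apply (im_le_Cmod (snd x - snd a))|exact H2].
  - intros [d [Hd H]]. exists (mkposreal (d / 2) ltac:(lra)). intros x [[H1 H2] [H3 H4]].
    simpl in *. unfold ball in *; simpl in *. unfold AbsRing_ball, abs, minus, plus, opp in *;
      simpl in *.
    apply H. split; (eapply Rle_lt_trans; [apply Cmod_le_abs|]);
      unfold Re, Im, Cminus, Cplus, Copp; simpl; lra.
Qed.

(** Frechet differentiability with the partial derivatives p and q written out, so that products can
    be estimated with [Cmod]; [ex_diff2_holomorphic] translates back. *)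
Definition ex_diff2 (P : C * C -> C) (a : C * C) : Prop :=
  exists p q : C, forall eps, (0 < eps)%R -> exists d, (0 < d)%R /\
    forall x, polydisc a d x ->
      (Cmod (P x - P a - (p * (fst x - fst a) + q * (snd x - snd a)))
       <= eps * (Cmod (fst x - fst a) + Cmod (snd x - snd a)))%R.

Lemma polydisc_sub (a x : C * C) (r r' : R) : (r <= r')%R -> polydisc a r x -> polydisc a r' x.
Proof. unfold polydisc. intros H [H1 H2]. split; lra. Qed.

Lemma ex_diff2_fst (h : C -> C) (a : C * C) :
  holomorphic_at h (fst a) -> ex_diff2 (fun x => h (fst x)) a.
Proof.
  intros [l Hl]. exists l, (RtoC 0). intros eps He. rewrite is_Cderive_iff in Hl.
  destruct (Hl eps He) as [d [Hd H]]. exists d. split; [exact Hd|]. intros x [H1 _].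
  replace (h (fst x) - h (fst a) - (l * (fst x - fst a) + 0 * (snd x - snd a)))
    with (h (fst x) - h (fst a) - l * (fst x - fst a)) by ring.
  eapply Rle_trans; [apply H, H1|]. assert (P := Cmod_ge_0 (snd x - snd a)). nra.
Qed.

Lemma ex_diff2_snd (a : C * C) : ex_diff2 (fun x => snd x) a.
Proof.
  exists (RtoC 0), (RtoC 1). intros eps He. exists 1%R. split; [lra|]. intros x _.
  replace (snd x - snd a - (0 * (fst x - fst a) + 1 * (snd x - snd a))) with (RtoC 0) by ring.
  rewrite Cmod_0. assert (P := Cmod_ge_0 (snd x - snd a)). assert (Q := Cmod_ge_0 (fst x - fst a)).
    nra.
Qed.

Lemma ex_diff2_minus (P Q : C * C -> C) (a : C * C) :
  ex_diff2 P a -> ex_diff2 Q a -> ex_diff2 (fun x => P x - Q x) a.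
Proof.
  intros (p1 & q1 & H1) (p2 & q2 & H2). exists (p1 - p2), (q1 - q2). intros eps He.
  destruct (H1 (eps / 2)%R ltac:(lra)) as [d1 [Hd1 K1]].
  destruct (H2 (eps / 2)%R ltac:(lra)) as [d2 [Hd2 K2]].
  exists (Rmin d1 d2). split; [apply Rmin_pos; assumption|]. intros x Hx.
  specialize (K1 x (polydisc_sub _ _ _ _ (Rmin_l d1 d2) Hx)).
  specialize (K2 x (polydisc_sub _ _ _ _ (Rmin_r d1 d2) Hx)).
  set (h := fst x - fst a) in *. set (k := snd x - snd a) in *.
  replace (P x - Q x - (P a - Q a) - ((p1 - p2) * h + (q1 - q2) * k))
    with ((P x - P a - (p1 * h + q1 * k)) - (Q x - Q a - (p2 * h + q2 * k))) by ring.
  eapply Rle_trans; [apply Cmod_minus_le|]. lra.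
Qed.

Lemma diff2_lipschitz (P : C * C -> C) (a : C * C) : ex_diff2 P a ->
  exists K d, (0 < K)%R /\ (0 < d)%R /\ forall x, polydisc a d x ->
    (Cmod (P x - P a) <= K * (Cmod (fst x - fst a) + Cmod (snd x - snd a)))%R.
Proof.
  intros (p & q & H). destruct (H 1%R Rlt_0_1) as [d [Hd K]].
  assert (Pp := Cmod_ge_0 p). assert (Pq := Cmod_ge_0 q).
  exists (Cmod p + Cmod q + 1)%R, d. split; [lra|]. split; [exact Hd|]. intros x Hx.
  specialize (K x Hx). set (h := fst x - fst a) in *. set (k := snd x - snd a) in *.
  replace (P x - P a) with ((P x - P a - (p * h + q * k)) + (p * h + q * k)) by ring.
  eapply Rle_trans; [apply Cmod_triangle|].
  assert (T := Cmod_triangle (p * h) (q * k)). rewrite !Cmod_mult in T.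
  assert (Ph := Cmod_ge_0 h). assert (Pk := Cmod_ge_0 k). nra.
Qed.

Lemma ex_diff2_mult (P Q : C * C -> C) (a : C * C) :
  ex_diff2 P a -> ex_diff2 Q a -> ex_diff2 (fun x => P x * Q x) a.
Proof.
  intros HP HQ. destruct (diff2_lipschitz P a HP) as (K1 & e1 & HK1 & He1 & L1).
  destruct (diff2_lipschitz Q a HQ) as (K2 & e2 & HK2 & He2 & L2).
  destruct HP as (p1 & q1 & H1). destruct HQ as (p2 & q2 & H2).
  exists (p1 * Q a + P a * p2), (q1 * Q a + P a * q2). intros eps He.
  assert (A1 := Cmod_ge_0 (P a)). assert (A2 := Cmod_ge_0 (Q a)).
  set (e := (eps / (2 * (Cmod (P a) + Cmod (Q a) + 1)))%R).
  assert (Hep : (0 < e)%R) by (apply Rdiv_lt_0_compat; lra).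
  assert (Ee : (e * (Cmod (P a) + Cmod (Q a) + 1) = eps / 2)%R) by (unfold e; field; lra).
  destruct (H1 e Hep) as [d1 [Hd1 M1]]. destruct (H2 e Hep) as [d2 [Hd2 M2]].
  assert (Hk : (0 < K1 * K2)%R) by nra.
  set (d3 := (eps / (4 * (K1 * K2)))%R).
  assert (Hd3 : (0 < d3)%R) by (apply Rdiv_lt_0_compat; lra).
  set (d := Rmin (Rmin (Rmin e1 e2) (Rmin d1 d2)) d3).
  exists d. split; [repeat apply Rmin_pos; assumption|]. intros x Hx.
  assert (S0 : (d <= Rmin (Rmin e1 e2) (Rmin d1 d2))%R) by apply Rmin_l.
  assert (S1 := Rmin_l (Rmin e1 e2) (Rmin d1 d2)). assert (S2 := Rmin_r (Rmin e1 e2) (Rmin d1 d2)).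
  assert (S3 := Rmin_l e1 e2). assert (S4 := Rmin_r e1 e2).
  assert (S5 := Rmin_l d1 d2). assert (S6 := Rmin_r d1 d2).
  assert (S7 : (d <= d3)%R) by apply Rmin_r.
  specialize (L1 x (polydisc_sub _ _ d e1 ltac:(lra) Hx)).
  specialize (L2 x (polydisc_sub _ _ d e2 ltac:(lra) Hx)).
  specialize (M1 x (polydisc_sub _ _ d d1 ltac:(lra) Hx)).
  specialize (M2 x (polydisc_sub _ _ d d2 ltac:(lra) Hx)).
  destruct Hx as [X1 X2].
  set (h := fst x - fst a) in *. set (k := snd x - snd a) in *.
  set (m := (Cmod h + Cmod k)%R) in *.
  assert (Hm : (0 <= m)%R) by (unfold m; assert (U := Cmod_ge_0 h); assert (V := Cmod_ge_0 k); lra).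
  assert (Hm2 : (m <= 2 * d3)%R) by (unfold m; lra).
  replace (P x * Q x - P a * Q a - ((p1 * Q a + P a * p2) * h + (q1 * Q a + P a * q2) * k))
    with ((P x - P a - (p1 * h + q1 * k)) * Q a + P a * (Q x - Q a - (p2 * h + q2 * k))
          + (P x - P a) * (Q x - Q a)) by ring.
  eapply Rle_trans; [apply Cmod_triangle|].
  eapply Rle_trans; [apply Rplus_le_compat_r, Cmod_triangle|]. rewrite !Cmod_mult.
  assert (B1 : (Cmod (P x - P a - (p1 * h + q1 * k)) * Cmod (Q a) <= e * m * Cmod (Q a))%R)
    by (apply Rmult_le_compat_r; assumption).
  assert (B2 : (Cmod (P a) * Cmod (Q x - Q a - (p2 * h + q2 * k)) <= Cmod (P a) * (e * m))%R)
    by (apply Rmult_le_compat_l; assumption).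
  assert (B3 : (Cmod (P x - P a) * Cmod (Q x - Q a) <= (K1 * m) * (K2 * m))%R)
    by (apply Rmult_le_compat; try apply Cmod_ge_0; assumption).
  assert (B4 : ((K1 * m) * (K2 * m) <= eps / 2 * m)%R).
  { replace (K1 * m * (K2 * m))%R with (K1 * K2 * m * m)%R by ring.
    apply Rmult_le_compat_r; [exact Hm|].
    apply Rle_trans with (K1 * K2 * (2 * d3))%R; [apply Rmult_le_compat_l; lra|].
    right. unfold d3. field. split; apply Rgt_not_eq; assumption. }
  assert (B5 : (0 <= e * m)%R) by (apply Rmult_le_pos; lra).
  assert (B6 : (e * (Cmod (P a) + Cmod (Q a) + 1) * m = eps / 2 * m)%R) by (rewrite Ee;
    reflexivity).
  nra.
Qed.

Lemma ex_diff2_affine_w (f g : C -> C) (a : C * C) :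
  entire f -> entire g -> ex_diff2 (fun x => g (fst x) * snd x - f (fst x)) a.
Proof.
  intros Hf Hg. apply ex_diff2_minus; [|apply ex_diff2_fst, Hf].
  apply ex_diff2_mult; [apply ex_diff2_fst, Hg|apply ex_diff2_snd].
Qed.

(** The same component seen from infinity: -v^2 (g / v - f) = -v (g - f v). *)
Lemma ex_diff2_affine_v (f g : C -> C) (a : C * C) :
  entire f -> entire g -> ex_diff2 (fun x => snd x * (g (fst x) - f (fst x) * snd x)) a.
Proof.
  intros Hf Hg. apply ex_diff2_mult; [apply ex_diff2_snd|].
  apply ex_diff2_minus; [apply ex_diff2_fst, Hg|].
  apply ex_diff2_mult; [apply ex_diff2_fst, Hf|apply ex_diff2_snd].
Qed.

Lemma ex_diff2_continuous (P : C * C -> C) (a : C * C) :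
  ex_diff2 P a -> continuous (T := C2_NormedModule) (U := C_UniformSpace) P a.
Proof.
  intros HP. destruct (diff2_lipschitz P a HP) as (K & d & HK & Hd & L).
  apply (Ccontinuous_iff (T := C2_NormedModule)). intros eps He. apply locally_polydisc.
  assert (Q : (0 < eps / (2 * K))%R) by (apply Rdiv_lt_0_compat; lra).
  exists (Rmin d (eps / (2 * K))). split; [apply Rmin_pos; assumption|]. intros x Hx.
  eapply Rle_lt_trans; [apply L, (polydisc_sub _ _ _ _ (Rmin_l _ _) Hx)|].
  destruct (polydisc_sub _ _ _ _ (Rmin_r _ _) Hx) as [X1 X2].
  apply Rlt_le_trans with (K * (eps / (2 * K) + eps / (2 * K)))%R.
  - apply Rmult_lt_compat_l; lra.
  - right. field. lra.
Qed.

Lemma ex_diff2_holomorphic (P : C * C -> C) (a : C * C) :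
  ex_diff2 P a -> holomorphic2_at (fun x => (RtoC 0, P x)) a.
Proof.
  intros (p & q & H).
  assert (Nf : forall x : C2_NormedModule, (Cmod (fst x) + Cmod (snd x) <= 2 * norm x)%R).
  { intros [x1 x2]. assert (N := proj1 (norm_prod (U := C_NormedModule) (V := C_NormedModule) x1
    x2)).
    assert (M1 := Rle_trans _ _ _ (Rmax_l _ _) N). assert (M2 := Rle_trans _ _ _ (Rmax_r _ _) N).
    change (Cmod x1 <= norm (K := C_AbsRing) (V := C2_NormedModule) (x1, x2))%R in M1.
    change (Cmod x2 <= norm (K := C_AbsRing) (V := C2_NormedModule) (x1, x2))%R in M2.
    simpl fst; simpl snd. lra. }
  assert (N0 : forall y : C, (norm (K := C_AbsRing) (V := C2_NormedModule) (RtoC 0, y) <= 2 * Cmod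
    y)%R).
  { intros y. assert (N := proj2 (norm_prod (U := C_NormedModule) (V := C_NormedModule) (RtoC 0)
    y)).
    assert (E : Rmax (norm (K := C_AbsRing) (V := C_NormedModule) (RtoC 0)) (norm (K := C_AbsRing)
      (V := C_NormedModule) y) = Cmod y).
    { change (Rmax (Cmod 0) (Cmod y) = Cmod y). rewrite Cmod_0. apply Rmax_right, Cmod_ge_0. }
    rewrite E in N. eapply Rle_trans; [exact N|]. apply Rmult_le_compat_r; [apply Cmod_ge_0|].
    assert (S := sqrt_lt_1 2 4 ltac:(lra) ltac:(lra) ltac:(lra)).
    replace 4%R with (Rsqr 2) in S by (unfold Rsqr; ring). rewrite sqrt_Rsqr in S; lra. }
  exists (fun h : C2_NormedModule => (RtoC 0, p * fst h + q * snd h) : C2_NormedModule).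
  split.
  - split.
    + intros [x1 x2] [y1 y2]. unfold plus; simpl. unfold prod_plus; simpl.
      unfold plus; simpl. f_equal; ring.
    + intros k [x1 x2]. unfold scal; simpl. unfold prod_scal; simpl.
      unfold scal; simpl. unfold mult; simpl. f_equal; ring.
    + assert (Pp := Cmod_ge_0 p). assert (Pq := Cmod_ge_0 q).
      exists (4 * (Cmod p + Cmod q) + 1)%R. split; [lra|]. intros x.
      eapply Rle_trans; [apply N0|]. assert (B := Nf x).
      assert (T := Cmod_triangle (p * fst x) (q * snd x)). rewrite !Cmod_mult in T.
      assert (U := Cmod_ge_0 (fst x)). assert (V := Cmod_ge_0 (snd x)).
      assert (W := norm_ge_0 (K := C_AbsRing) (V := C2_NormedModule) x).
      set (nx := norm x) in *.
      assert (Cmod p * Cmod (fst x) <= Cmod p * (2 * nx))%R by (apply Rmult_le_compat_l; lra).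
      assert (Cmod q * Cmod (snd x) <= Cmod q * (2 * nx))%R by (apply Rmult_le_compat_l; lra).
      change (2 * Cmod (p * fst x + q * snd x) <= (4 * (Cmod p + Cmod q) + 1) * nx)%R. nra.
  - intros x Hx.
    assert (E := is_filter_lim_locally_unique (V := C2_NormedModule) a x Hx). subst x.
    (* The comparisons [Nf] and [N0] of the product norm with [Cmod] cost a factor 2 each. *)
    intros eps. destruct (H (eps / 4)%R) as [d [Hd K]].
    { assert (P0 := cond_pos eps). lra. }
    apply locally_polydisc. exists d. split; [exact Hd|]. intros x Hxa. specialize (K x Hxa).
    assert (B := Nf (minus x a)).
    change (Cmod (fst x - fst a) + Cmod (snd x - snd a) <= 2 * norm (minus x a))%R in B.
    assert (E : minus (minus (G := C2_NormedModule) (RtoC 0, P x) (RtoC 0, P a))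
        (RtoC 0, p * fst (minus (G := C2_NormedModule) x a) + q * snd (minus (G := C2_NormedModule)
          x a))
      = (RtoC 0, P x - P a - (p * (fst x - fst a) + q * (snd x - snd a)))).
    { unfold minus, plus, opp; simpl. unfold prod_plus, prod_opp, plus, opp; simpl. f_equal; ring. }
    rewrite E. eapply Rle_trans; [apply N0|]. assert (P0 := cond_pos eps). simpl in K.
    eapply Rle_trans; [apply Rmult_le_compat_l; [lra|exact K]|].
    apply Rle_trans with (eps / 2 * (Cmod (fst x - fst a) + Cmod (snd x - snd a)))%R; [right;
      field|].
    apply Rle_trans with (eps / 2 * (2 * norm (minus x a)))%R; [apply Rmult_le_compat_l; lra|].
    right. rewrite <- Rmult_assoc. replace (eps / 2 * 2)%R with (pos eps) by field. reflexivity.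
Qed.

(** * The vertical fields *)

(** The value at infinity is the limit at v = 0 of the d/dv component - e^u v (g - f v). *)
Definition vertical_field (f g u : C -> C) : vector_field :=
  fun p => match snd p with
           | aff w => (RtoC 0, Cexp (u (fst p)) * (g (fst p) * w - f (fst p)))
           | infty => (RtoC 0, RtoC 0)
           end.

Lemma vertical_field_holomorphic (f g u : C -> C) (M : surface -> Prop) :
  entire f -> entire g -> entire u -> holomorphic_field M (vertical_field f g u).
Proof.
  intros Hf Hg Hu.
  assert (He : entire (fun z => Cexp (u z))) by (intros z; apply holomorphic_Cexp, Hu).
  split; intros a _.
  - replace (field_in_w (vertical_field f g u))
      with (fun x : C * C => (RtoC 0, Cexp (u (fst x)) * (g (fst x) * snd x - f (fst x))))
      by reflexivity.
    apply ex_diff2_holomorphic.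
    apply (ex_diff2_mult (fun x => Cexp (u (fst x)))).
    + apply (ex_diff2_fst (fun z => Cexp (u z))), He.
    + apply ex_diff2_affine_w; assumption.
  - replace (field_in_v (vertical_field f g u))
      with (fun x : C * C =>
        (RtoC 0, - Cexp (u (fst x)) * (snd x * (g (fst x) - f (fst x) * snd x)))).
    + apply ex_diff2_holomorphic.
      apply (ex_diff2_mult (fun x => - Cexp (u (fst x)))).
      * apply (ex_diff2_fst (fun z => - Cexp (u z))), holomorphic_opp, He.
      * apply ex_diff2_affine_v; assumption.
    + apply functional_extensionality. intros [z v].
      unfold field_in_v, vertical_field, chart_v; simpl.
      destruct (Ceq_dec v 0) as [E|E]; simpl; f_equal.
      * rewrite E. ring.
      * field. exact E.
Qed.

(* The solution of x' = A x - B with x(0) = w. *)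
Definition affine_flow (A B w t : C) : C :=
  if Ceq_dec A 0 then w - B * t else B / A + (w - B / A) * Cexp (A * t).

Lemma affine_flow_0 (A B w : C) : affine_flow A B w 0 = w.
Proof.
  unfold affine_flow. destruct (Ceq_dec A 0) as [E|E]; [ring|].
  replace (A * 0) with (RtoC 0) by ring. rewrite Cexp_0. ring.
Qed.

Lemma is_Cderive_scal_exp (A t : C) : is_Cderive (fun t => Cexp (A * t)) t (A * Cexp (A * t)).
Proof.
  apply (is_Cderive_comp Cexp (fun t => A * t)); [apply is_Cderive_Cexp|].
  eapply is_Cderive_eq.
  - apply is_Cderive_mult; [apply is_Cderive_const|apply is_Cderive_id].
  - cbv beta. ring.
Qed.

Lemma affine_flow_derive (A B w t : C) :
  is_Cderive (affine_flow A B w) t (A * affine_flow A B w t - B).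
Proof.
  unfold affine_flow. destruct (Ceq_dec A 0) as [E|E].
  - eapply is_Cderive_eq.
    + apply is_Cderive_minus; [apply is_Cderive_const|].
      apply is_Cderive_mult; [apply is_Cderive_const|apply is_Cderive_id].
    + cbv beta. rewrite E. ring.
  - eapply is_Cderive_eq.
    + apply is_Cderive_plus; [apply is_Cderive_const|].
      apply is_Cderive_mult; [apply is_Cderive_const|apply is_Cderive_scal_exp].
    + cbv beta. field. exact E.
Qed.

(** The difference of two solutions times exp (- A t) has derivative zero. *)
Lemma affine_ode_unique (A B w : C) (x : C -> C) :
  (forall t, is_Cderive x t (A * x t - B)) -> x 0 = w -> forall t, x t = affine_flow A B w t.
Proof.
  intros Hx H0 t.
  set (d := fun t => (x t - affine_flow A B w t) * Cexp (- A * t)).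
  assert (E : d t = d 0).
  { apply entire_derive_zero_const. intros s. unfold d. eapply is_Cderive_eq.
    - apply is_Cderive_mult; [apply is_Cderive_minus; [apply Hx|apply affine_flow_derive]|].
      apply is_Cderive_scal_exp.
    - cbv beta. ring. }
  unfold d in E. rewrite H0, affine_flow_0 in E.
  apply Cminus_eq_0, (Cmult_Cexp_eq_0 _ (- A * t)). rewrite E. ring.
Qed.

(** * Solutions of the vertical field *)

Section Solutions.

Variables (f g u : C -> C).

Let Y := vertical_field f g u.
Let A (z : C) := Cexp (u z) * g z.
Let B (z : C) := Cexp (u z) * f z.

Definition fibre_flow (z w t : C) : C :=
  affine_flow (Cexp (u z) * g z) (Cexp (u z) * f z) w t.

Lemma fibre_flow_solution (M : surface -> Prop) (z w : C) :
  (forall t, M (z, aff (fibre_flow z w t))) ->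
  global_solution M Y (fun t => (z, aff (fibre_flow z w t))).
Proof.
  intros HM t. split; [apply HM|]. split; simpl.
  - apply is_Cderive_const.
  - unfold is_derive_P1. simpl. split.
    + apply filter_forall. intros t' E. discriminate E.
    + eapply is_Cderive_eq; [apply affine_flow_derive|]. unfold fibre_flow. ring.
Qed.

Lemma infty_solution (M : surface -> Prop) (z : C) :
  M (z, infty) -> global_solution M Y (fun _ => (z, infty)).
Proof.
  intros HM t. split; [exact HM|]. split; simpl.
  - apply is_Cderive_const.
  - unfold is_derive_P1. simpl. split.
    + apply filter_forall. intros t' E. discriminate E.
    + apply is_Cderive_const.
Qed.

(** The field has no d/dz component, so the first coordinate has derivative zero. *)
Lemma solution_fst (M : surface -> Prop) (p : C -> surface) :
  global_solution M Y p -> forall t, fst (p t) = fst (p 0).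
Proof.
  intros H t. apply (entire_derive_zero_const (fun t => fst (p t))). intros s.
  destruct (H s) as [_ [H1 _]]. eapply is_Cderive_eq; [exact H1|].
  unfold Y, vertical_field. destruct (snd (p s)); reflexivity.
Qed.

(** At finite nonzero points this is the chain rule for 1 / w; at infinity both sides are 0. *)
Lemma inverse_coordinate_derive (M : surface -> Prop) (p : C -> surface) (t : C) :
  global_solution M Y p -> snd (p t) <> aff 0 ->
  let v := fun t => coord_v (snd (p t)) in
  is_Cderive v t (v t * (B (fst (p 0)) * v t - A (fst (p 0)))).
Proof.
  intros H N v. destruct (H t) as [_ [_ H2]]. unfold Y, vertical_field, is_derive_P1 in H2.
  rewrite (solution_fst M p H t) in H2.
  destruct (snd (p t)) as [w|] eqn:E; destruct H2 as [Hl H2].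
  - assert (Hw : w <> 0) by (intros Q; apply N; rewrite Q; reflexivity).
    apply locally_disc in Hl. destruct Hl as [d [Hd Hl]].
    apply (is_Cderive_ext_disc (fun t => / coord_w (snd (p t))) v t _ d Hd).
    + intros y Hy. unfold v. destruct (snd (p y)) eqn:Ey; [reflexivity|].
      destruct (Hl y Hy Ey).
    + eapply is_Cderive_eq.
      * apply (is_Cderive_comp Cinv (fun t => coord_w (snd (p t)))); [|exact H2].
        apply is_Cderive_inv. rewrite E. exact Hw.
      * unfold v, A, B. rewrite E. simpl. field. exact Hw.
  - eapply is_Cderive_eq; [exact H2|]. unfold v. rewrite E. simpl. ring.
Qed.

(* In the coordinate v = 1/w the field is v (B v - A), so a solution with v = 0 somewhere solves
   a linear equation v' = c(t) v and vanishes identically. *)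
Lemma solution_infty_open (M : surface -> Prop) (p : C -> surface) (t0 : C) :
  global_solution M Y p -> snd (p t0) = infty -> locally t0 (fun t => snd (p t) = infty).
Proof.
  intros H E0. destruct (H t0) as [_ [_ H2]]. unfold is_derive_P1 in H2. rewrite E0 in H2.
  destruct H2 as [Hl _]. apply locally_disc in Hl. destruct Hl as [d [Hd Hl]].
  set (v := fun t => coord_v (snd (p t))).
  assert (Dv : forall t, disc t0 d t ->
    is_Cderive v t (v t * (B (fst (p 0)) * v t - A (fst (p 0))))).
  { intros t Ht. apply (inverse_coordinate_derive M p t H), Hl, Ht. }
  destruct (holomorphic_primitive (fun t => B (fst (p 0)) * v t - A (fst (p 0))) t0 d) as [c Hc].
  { intros t Ht. apply holomorphic_minus; [|apply holomorphic_const].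
    apply holomorphic_mult; [apply holomorphic_const|]. eexists. apply Dv, Ht. }
  assert (V0 : v t0 = 0) by (unfold v; rewrite E0; reflexivity).
  apply locally_disc. exists d. split; [exact Hd|]. intros t Ht.
  assert (Ev : v t * Cexp (- c t) = v t0 * Cexp (- c t0)).
  { apply (derive_zero_const t0 d (fun t => v t * Cexp (- c t))); [|exact Ht|apply disc_center, Hd].
    intros s Hs. eapply is_Cderive_eq.
    - apply is_Cderive_mult; [apply Dv, Hs|].
      apply (is_Cderive_comp Cexp (fun t => - c t)); [apply is_Cderive_Cexp|].
      apply is_Cderive_opp, Hc, Hs.
    - cbv beta. ring. }
  assert (Vt : v t = 0).
  { apply (Cmult_Cexp_eq_0 _ (- c t)). rewrite Ev, V0. ring. }
  unfold v in Vt. assert (Nt := Hl t Ht). destruct (snd (p t)) as [w|]; [exfalso|reflexivity].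
  simpl in Vt. assert (Hw : w <> 0) by (intros Q; apply Nt; rewrite Q; reflexivity).
  exact (Cinv_neq_0 w Hw Vt).
Qed.

(** The times at infinity form a clopen set: they are open by [solution_infty_open], and so are the
    finite times, because differentiability at a finite value includes finiteness nearby. *)
Lemma solution_infty (M : surface -> Prop) (p : C -> surface) (t1 t2 : C) :
  global_solution M Y p -> snd (p t1) = infty -> snd (p t2) = infty.
Proof.
  intros H. apply (clopen_plane (fun t => snd (p t) = infty)).
  - intros t. apply (solution_infty_open M p t H).
  - intros t N. destruct (H t) as [_ [_ H2]]. unfold is_derive_P1 in H2.
    destruct (snd (p t)) as [w|] eqn:E; [apply H2|destruct (N eq_refl)].
Qed.

(** Such a solution stays in its fibre and never reaches infinity, so its coordinate w solves the
    scalar affine equation for all times. *)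
Lemma solution_aff (M : surface -> Prop) (p : C -> surface) (z w : C) :
  global_solution M Y p -> p 0 = (z, aff w) -> forall t, p t = (z, aff (fibre_flow z w t)).
Proof.
  intros H E0.
  assert (Ef : forall t, fst (p t) = z) by (intros t; rewrite (solution_fst M p H t), E0;
    reflexivity).
  assert (Nf : forall t, snd (p t) <> infty).
  { intros t Q. assert (Q0 := solution_infty M p t 0 H Q). rewrite E0 in Q0. discriminate Q0. }
  set (x := fun t => coord_w (snd (p t))).
  assert (Ex : forall t, p t = (z, aff (x t))).
  { intros t. rewrite (surjective_pairing (p t)), Ef. f_equal. unfold x.
    specialize (Nf t). destruct (snd (p t)); [reflexivity|destruct (Nf eq_refl)]. }
  assert (Dx : forall t, is_Cderive x t (Cexp (u z) * g z * x t - Cexp (u z) * f z)).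
  { intros t. destruct (H t) as [_ [_ H2]]. unfold is_derive_P1 in H2. rewrite Ex in H2.
    simpl in H2. destruct H2 as [_ H2]. eapply is_Cderive_eq; [exact H2|]. ring. }
  intros t. rewrite Ex. f_equal. f_equal. apply affine_ode_unique; [exact Dx|].
  unfold x. rewrite E0. reflexivity.
Qed.

End Solutions.

(** * Zeros, completeness and type of the field *)

Section Proposition.

Variables (s : C -> P1) (f g u : C -> C).
Hypothesis s_meromorphic : meromorphic s.
Hypothesis s_not_infty : exists z, s z <> infty.
Hypothesis f_entire : entire f.
Hypothesis g_entire : entire g.
Hypothesis s_quotient : forall z, quotient_at (s z) (f z) (g z).

Let Y := vertical_field f g u.

(** Off the poles the left-hand side is g z (w - s z). At a pole g z = 0 and f z <> 0, so both sides
    fail for every finite w. *)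
Lemma fibre_zero (z w : C) : g z * w - f z = 0 <-> aff w = s z.
Proof.
  assert (Q := s_quotient z). destruct (s z) as [c|]; destruct Q as [Q1 Q2].
  - replace (g z * w - f z) with (g z * (w - c)) by (rewrite Q2; ring). split; intros H.
    + f_equal. apply NNPP. intros N. apply (Cmult_neq_0 _ _ Q1 (Cminus_neq_0 _ _ N)). exact H.
    + injection H as E. rewrite E. ring.
  - split; intros H; [exfalso|discriminate H]. apply Q2.
    rewrite Q1 in H. transitivity (- (0 * w - f z)); [ring|]. rewrite H. ring.
Qed.

Lemma fibre_flow_fixed (z c t : C) : aff c = s z -> fibre_flow f g u z c t = c.
Proof.
  intros E. assert (Q := s_quotient z). rewrite <- E in Q. destruct Q as [Q1 Q2].
  unfold fibre_flow, affine_flow. assert (N := Cexp_neq_0 (u z)).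
  destruct (Ceq_dec (Cexp (u z) * g z) 0) as [Z|Z].
  - destruct (Cmult_neq_0 _ _ N Q1 Z).
  - rewrite Q2. field. split; assumption.
Qed.

Lemma fibre_flow_eq (z c w t : C) : aff c = s z ->
  fibre_flow f g u z w t = c + (w - c) * Cexp (Cexp (u z) * g z * t).
Proof.
  intros E. assert (Q := s_quotient z). rewrite <- E in Q. destruct Q as [Q1 Q2].
  unfold fibre_flow, affine_flow. assert (N := Cexp_neq_0 (u z)).
  destruct (Ceq_dec (Cexp (u z) * g z) 0) as [Z|Z].
  - destruct (Cmult_neq_0 _ _ N Q1 Z).
  - replace (Cexp (u z) * f z / (Cexp (u z) * g z)) with c; [reflexivity|].
    rewrite Q2. field. split; assumption.
Qed.

Lemma fibre_flow_avoids (z w t : C) : aff w <> s z -> aff (fibre_flow f g u z w t) <> s z.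
Proof.
  intros N. destruct (s z) as [c|] eqn:E; [|discriminate].
  rewrite (fibre_flow_eq z c w t (eq_sym E)). intros Q. injection Q as Q.
  assert (Nw : w <> c) by (intros K; apply N; rewrite K; reflexivity).
  apply (Cmult_neq_0 _ _ (Cminus_neq_0 _ _ Nw) (Cexp_neq_0 (Cexp (u z) * g z * t))).
  transitivity (c + (w - c) * Cexp (Cexp (u z) * g z * t) - c); [ring|]. rewrite Q. ring.
Qed.

Lemma vertical_field_zero (p : surface) :
  Y p = (RtoC 0, RtoC 0) <-> graph s p \/ graph s_infty p.
Proof.
  destruct p as [z [w|]]; unfold Y, vertical_field, graph, s_infty; simpl.
  - rewrite <- fibre_zero. split.
    + intros H. left. apply (Cmult_Cexp_eq_0 _ (u z)).
      rewrite Cmult_comm. exact (f_equal snd H).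
    + intros [H|H]; [|discriminate H]. rewrite H. f_equal. ring.
  - tauto.
Qed.

(* In the complement of the graph of s only the fibres over the poles of s remain. *)
Definition exceptional_set (M : surface -> Prop) : surface -> Prop :=
  fun p => M p /\ (s (fst p) = infty \/ graph s p \/ graph s_infty p).

(** [M] will be the whole surface or the complement of the graph of s; they share stability under
    the fibrewise flow and, further on, openness in both charts. *)
Variable M : surface -> Prop.
Hypothesis M_stable : forall z w t, M (z, aff w) -> M (z, aff (fibre_flow f g u z w t)).

Lemma vertical_field_complete : complete M Y.
Proof.
  intros [z [w|]] Hp.
  - exists (fun t => (z, aff (fibre_flow f g u z w t))). split.
    + apply fibre_flow_solution. intros t. apply M_stable, Hp.
    + unfold fibre_flow. rewrite affine_flow_0. reflexivity.
  - exists (fun _ => (z, infty)). split; [|reflexivity]. apply infty_solution, Hp.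
Qed.

Lemma trajectory_vertical (p q : surface) : trajectory M Y p q -> fst q = fst p.
Proof.
  intros (x & Hx & E0 & t & Et). rewrite <- Et, <- E0.
  apply (solution_fst f g u M x Hx).
Qed.

(** Solutions stay in their fibre, and the points of both graphs are equilibria. *)
Lemma exceptional_set_invariant : flow_invariant M Y (exceptional_set M).
Proof.
  intros p [_ Hp] q Hq. assert (Ev := trajectory_vertical p q Hq).
  destruct Hq as (x & Hx & E0 & t & Et).
  split; [rewrite <- Et; apply Hx|].
  destruct p as [z [w|]].
  - assert (Eq := solution_aff f g u M x z w Hx E0 t). rewrite Et in Eq.
    destruct Hp as [Hp|[Hp|Hp]].
    + left. rewrite Ev. exact Hp.
    + right. left. unfold graph in *. simpl in Hp. rewrite Eq. simpl.
      rewrite fibre_flow_fixed by exact Hp. exact Hp.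
    + discriminate Hp.
  - right. right. unfold graph, s_infty. rewrite <- Et.
    apply (solution_infty f g u M x 0 t Hx). rewrite E0. reflexivity.
Qed.

(** The trajectory is c + (w - c) exp (a t) in one fibre, with c = s z and a <> 0. Subtracting c
    maps it onto C^* because exp is onto; a local inverse of the solution is a logarithm divided by
    a. *)
Lemma trajectory_Cstar (p : surface) :
  M p -> ~ exceptional_set M p -> trajectory_of_type Cstar M Y p.
Proof.
  intros Hp NE.
  assert (N1 : s (fst p) <> infty) by (intros Q; apply NE; split; auto).
  assert (N2 : ~ graph s p) by (intros Q; apply NE; split; auto).
  assert (N3 : snd p <> infty) by (intros Q; apply NE; split; auto).
  destruct p as [z [w|]]; [|destruct (N3 eq_refl)]. unfold graph in N2. simpl in N1, N2.
  destruct (s z) as [c|] eqn:Es; [|destruct (N1 eq_refl)].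
  assert (Nw : w - c <> 0).
  { apply Cminus_neq_0. intros Q. apply N2. rewrite Q. reflexivity. }
  set (a := Cexp (u z) * g z).
  assert (Na : a <> 0).
  { apply Cmult_neq_0; [apply Cexp_neq_0|]. assert (Q := s_quotient z). rewrite Es in Q. apply Q. }
  assert (Fl : forall t, fibre_flow f g u z w t = c + (w - c) * Cexp (a * t))
    by (intros t; apply (fibre_flow_eq z c w t (eq_sym Es))).
  set (x := fun t => (z, aff (fibre_flow f g u z w t))).
  assert (Hx : global_solution M Y x).
  { apply fibre_flow_solution. intros t. apply M_stable, Hp. }
  assert (Hx0 : x 0 = (z, aff w)) by (unfold x, fibre_flow; rewrite affine_flow_0; reflexivity).
  exists x, (fun q => match snd q with aff y => y - c | infty => RtoC 0 end),
    (fun y => (z, aff (c + y))).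
  split; [exact Hx|]. split; [exact Hx0|]. split; [|split; [|split]].
  - intros q (x' & Hx' & E0 & t & Et).
    rewrite (solution_aff f g u M x' z w Hx' E0 t) in Et. subst q. simpl. rewrite Fl. split.
    + unfold Cstar. replace (c + (w - c) * Cexp (a * t) - c) with ((w - c) * Cexp (a * t)) by ring.
      apply Cmult_neq_0; [exact Nw|apply Cexp_neq_0].
    + f_equal. f_equal. ring.
  - intros y Hy. split; [|simpl; ring].
    exists x. split; [exact Hx|]. split; [exact Hx0|].
    destruct (Cexp_surj (y / (w - c))) as [l Hl].
    { intros Q. apply Hy. transitivity (y / (w - c) * (w - c)); [field; exact Nw|]. rewrite Q.
      ring. }
    exists (l / a). unfold x. rewrite Fl. f_equal. f_equal. f_equal.
    replace (a * (l / a)) with l by (field; exact Na). rewrite Hl. field. exact Nw.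
  - intros t. unfold x. simpl.
    apply (holomorphic_ext (fun t => (w - c) * Cexp (a * t))).
    + intros y. rewrite Fl. ring.
    + apply (holomorphic_mult (fun _ => w - c)); [apply holomorphic_const|].
      eexists. apply is_Cderive_scal_exp.
  - intros y Hy.
    assert (Hd : (0 < Cmod y)%R) by (apply Cmod_gt_0, Hy).
    (* The disc of radius |y| around y misses 0, so y / (w - c) has a logarithm L there, and tau = L
       / a. *)
    destruct (holomorphic_log (fun y => y / (w - c)) y (Cmod y)) as [L [HL EL]].
    + intros v _. apply holomorphic_div; [apply holomorphic_id|apply holomorphic_const|exact Nw].
    + intros v Hv Q.
      assert (Ev : v = 0) by (transitivity (v / (w - c) * (w - c)); [field; exact Nw|]; rewrite Q;
        ring).
      rewrite Ev in Hv. unfold disc in Hv. rewrite Cmod_sym in Hv.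
      replace (y - 0) with y in Hv by ring. lra.
    + exists (fun y => L y / a). apply locally_disc. exists (Cmod y). split; [exact Hd|].
      intros v Hv. split.
      * apply holomorphic_div; [apply HL, Hv|apply holomorphic_const|exact Na].
      * unfold x. rewrite Fl. f_equal. f_equal. f_equal.
        replace (a * (L v / a)) with (L v) by (field; exact Na).
        rewrite <- EL by exact Hv. field. exact Nw.
Qed.

(** * Pluripolarity of the exceptional set *)

Hypothesis M_open_w : forall a, M (chart_w a) ->
  locally (T := C2_NormedModule) a (fun x => M (chart_w x)).
Hypothesis M_open_v : forall a, M (chart_v a) ->
  locally (T := C2_NormedModule) a (fun x => M (chart_v x)).

(** Among three distinct points of the disc at least one is neither a nor b. *)
Lemma disc_avoid_two (c a b : C) (r : R) : (0 < r)%R -> exists w, disc c r w /\ w <> a /\ w <> b.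
Proof.
  intros Hr.
  assert (D : forall k : R, (0 <= k < 1)%R -> disc c r (c + RtoC (k * r))).
  { intros k Hk. unfold disc. replace (c + RtoC (k * r) - c) with (RtoC (k * r)) by ring.
    rewrite Cmod_R, Rabs_pos_eq; nra. }
  assert (I : forall k l : R, k <> l -> c + RtoC (k * r) <> c + RtoC (l * r)).
  { intros k l N Q. apply N. apply (f_equal fst) in Q. simpl in Q. nra. }
  set (w0 := c + RtoC (0 * r)). set (w1 := c + RtoC (1/2 * r)). set (w2 := c + RtoC (1/4 * r)).
  assert (I01 : w0 <> w1) by (apply I; lra).
  assert (I02 : w0 <> w2) by (apply I; lra).
  assert (I12 : w1 <> w2) by (apply I; lra).
  assert (D0 : disc c r w0) by (apply D; lra).
  assert (D1 : disc c r w1) by (apply D; lra).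
  assert (D2 : disc c r w2) by (apply D; lra).
  clearbody w0 w1 w2.
  destruct (classic (w0 <> a /\ w0 <> b)) as [?|N0]; [exists w0; tauto|].
  destruct (classic (w1 <> a /\ w1 <> b)) as [?|N1]; [exists w1; tauto|].
  exists w2. split; [exact D2|].
  split; intros Q; apply N0; split; intros Q0; apply N1; split; intros Q1; congruence.
Qed.

(** Zeros of g are poles of s, and these are isolated. *)
Lemma polydisc_regular_point (a : C * C) (r : R) : (0 < r)%R ->
  exists z, disc (fst a) r z /\ g z <> 0.
Proof.
  intros Hr. destruct (poles_isolated s (fst a) s_meromorphic s_not_infty) as [d [Hd H]].
  assert (Hm : (0 < Rmin d r)%R) by (apply Rmin_pos; assumption).
  destruct (disc_avoid_two (fst a) (fst a) (fst a) (Rmin d r) Hm) as (z & Hz & N & _).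
  exists z. split; [apply (disc_sub _ _ _ _ (Rmin_r d r)), Hz|].
  intros Q. apply (H z); [apply (disc_sub _ _ _ _ (Rmin_l d r)), Hz|exact N|].
  apply (quotient_at_infty _ _ _ (s_quotient z)), Q.
Qed.

Lemma entire_line (h : C -> C) (a b : C) : entire h -> entire (fun l => h (a + l * b)).
Proof.
  intros Hh l. apply (holomorphic_comp h (fun l => a + l * b)); [apply Hh|].
  apply holomorphic_plus; [apply holomorphic_const|].
  apply holomorphic_mult; [apply holomorphic_id|apply holomorphic_const].
Qed.

(** log |Phi| is the required function: it is -oo exactly at the zeros of Phi, which contain E but
    fill no polydisc. *)
Lemma pluripolar_in_chart_log (chart : C * C -> surface) (Phi : C * C -> C) (E : surface -> Prop) :
  (forall a, M (chart a) -> locally (T := C2_NormedModule) a (fun x => M (chart x))) ->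
  (forall a, ex_diff2 Phi a) ->
  (forall a b : C * C, entire (fun l => Phi (fst a + l * fst b, snd a + l * snd b))) ->
  (forall a r, (0 < r)%R -> exists x, polydisc a r x /\ Phi x <> 0) ->
  (forall x, E (chart x) -> Phi x = 0) ->
  pluripolar_in_chart chart M E.
Proof.
  intros Ho Hd He Hn HE a Ha.
  destruct (proj1 (locally_polydisc a _) (Ho a Ha)) as [r [Hr Hsub]].
  exists r, (fun x => log_modulus (Phi x)). split; [exact Hr|]. split; [exact Hsub|].
  split; [|split].
  - apply log_modulus_plurisubharmonic; [|exact He]. intros b. apply ex_diff2_continuous, Hd.
  - destruct (Hn a r Hr) as [x [Hx N]]. exists x. split; [exact Hx|].
    unfold log_modulus. destruct (Ceq_dec (Phi x) 0); [tauto|discriminate].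
  - intros x _ Hx. unfold log_modulus. destruct (Ceq_dec (Phi x) 0) as [_|N]; [reflexivity|].
    destruct (N (HE x Hx)).
Qed.

Lemma exceptional_set_pluripolar : pluripolar M (exceptional_set M).
Proof.
  split; [intros p Hp; apply Hp|]. split.
  - apply (pluripolar_in_chart_log chart_w (fun x => g (fst x) * (g (fst x) * snd x - f (fst x))));
      [exact M_open_w| | | |].
    + intros a. apply (ex_diff2_mult (fun x => g (fst x))); [apply ex_diff2_fst, g_entire|].
      apply ex_diff2_affine_w; assumption.
    + intros a b l. simpl. assert (Gl := entire_line g (fst a) (fst b) g_entire).
      apply (holomorphic_mult (fun l => g (fst a + l * fst b))); [apply Gl|].
      apply holomorphic_minus; [|apply (entire_line f (fst a) (fst b) f_entire)].
      apply holomorphic_mult; [apply Gl|]. apply (entire_line (fun x => x)).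
      intros x; apply holomorphic_id.
    + intros a r Hr. destruct (polydisc_regular_point a r Hr) as [z [Hz Nz]].
      destruct (disc_avoid_two (snd a) (f z / g z) (f z / g z) r Hr) as (w & Hw & N & _).
      exists (z, w). split; [split; assumption|]. simpl. apply Cmult_neq_0; [exact Nz|].
      intros Q. apply N. transitivity ((f z + (g z * w - f z)) / g z); [field; exact Nz|].
      rewrite Q. field. exact Nz.
    + intros x [_ Hx]. unfold graph, s_infty, chart_w in Hx. simpl in Hx.
      destruct Hx as [Hx|[Hx|Hx]].
      * apply (quotient_at_infty _ _ _ (s_quotient (fst x))) in Hx. rewrite Hx. ring.
      * apply fibre_zero in Hx. rewrite Hx. ring.
      * discriminate Hx.
  - apply (pluripolar_in_chart_log chart_v
      (fun x => g (fst x) * (snd x * (g (fst x) - f (fst x) * snd x)))); [exact M_open_v| | | |].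
    + intros a. apply (ex_diff2_mult (fun x => g (fst x))); [apply ex_diff2_fst, g_entire|].
      apply ex_diff2_affine_v; assumption.
    + intros a b l. simpl. assert (Gl := entire_line g (fst a) (fst b) g_entire).
      assert (Il : holomorphic_at (fun l => snd a + l * snd b) l)
        by (apply (entire_line (fun x => x)); intros x; apply holomorphic_id).
      apply (holomorphic_mult (fun l => g (fst a + l * fst b))); [apply Gl|].
      apply holomorphic_mult; [exact Il|]. apply holomorphic_minus; [apply Gl|].
      apply holomorphic_mult; [apply (entire_line f (fst a) (fst b) f_entire)|exact Il].
    + intros a r Hr. destruct (polydisc_regular_point a r Hr) as [z [Hz Nz]].
      (* If f z = 0 the second value to avoid is junk, but then g z - f z * v = g z is nonzero
         anyway. *)
      destruct (disc_avoid_two (snd a) 0 (g z / f z) r Hr) as (v & Hv & N0 & N).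
      exists (z, v). split; [split; assumption|]. simpl. apply Cmult_neq_0; [exact Nz|].
      apply Cmult_neq_0; [exact N0|]. intros Q.
      assert (Eg : g z = f z * v) by (transitivity ((g z - f z * v) + f z * v); [ring|]; rewrite Q;
        ring).
      apply N. rewrite Eg. field. intros Z. apply Nz. rewrite Eg, Z. ring.
    + intros x [_ Hx]. unfold graph, s_infty, chart_v in Hx. simpl in Hx.
      destruct (Ceq_dec (snd x) 0) as [Z|Z]; [rewrite Z; ring|].
      destruct Hx as [Hx|[Hx|Hx]].
      * apply (quotient_at_infty _ _ _ (s_quotient (fst x))) in Hx. rewrite Hx. ring.
      * apply fibre_zero in Hx.
        replace (g (fst x) - f (fst x) * snd x)
          with ((g (fst x) * / snd x - f (fst x)) * snd x) by (field; exact Z).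
        rewrite Hx. ring.
      * discriminate Hx.
Qed.

Lemma vertical_field_of_type : of_type Cstar M Y.
Proof.
  split; [apply vertical_field_complete|].
  exists (exceptional_set M). split; [apply exceptional_set_pluripolar|].
  split; [apply exceptional_set_invariant|apply trajectory_Cstar].
Qed.

End Proposition.

(** * The complement of the graph *)

Lemma C2_minus_graph_stable (s : C -> P1) (f g u : C -> C) :
  (forall z, quotient_at (s z) (f z) (g z)) ->
  forall z w t, C2_minus_graph s (z, aff w) -> C2_minus_graph s (z, aff (fibre_flow f g u z w t)).
Proof.
  intros Q z w t [_ H]. split; [discriminate|]. apply fibre_flow_avoids; assumption.
Qed.

(** By [fibre_zero] the complement is given by g w - f <> 0 in this chart, an open condition. *)
Lemma C2_minus_graph_open_w (s : C -> P1) (f g : C -> C) :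
  entire f -> entire g -> (forall z, quotient_at (s z) (f z) (g z)) ->
  forall a, C2_minus_graph s (chart_w a) ->
    locally (T := C2_NormedModule) a (fun x => C2_minus_graph s (chart_w x)).
Proof.
  intros Hf Hg Q a [_ H].
  assert (E : forall x : C * C, C2_minus_graph s (chart_w x) <-> g (fst x) * snd x - f (fst x) <>
    0).
  { intros x. unfold C2_minus_graph, graph, chart_w; simpl.
    rewrite (fibre_zero s f g Q (fst x) (snd x)). split; [tauto|]. split;
      [discriminate|assumption]. }
  assert (Hc := ex_diff2_affine_w f g a Hf Hg).
  assert (N : g (fst a) * snd a - f (fst a) <> 0) by (apply E; split; [discriminate|exact H]).
  generalize (Ccontinuous_neq0 (T := C2_NormedModule) _ a (ex_diff2_continuous _ a Hc) N).
  apply filter_imp. intros x. apply E.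
Qed.

(** The condition is v (g - f v) <> 0: the factor v excludes infinity, and g - f v = v (g w - f)
    excludes the graph. *)
Lemma C2_minus_graph_open_v (s : C -> P1) (f g : C -> C) :
  entire f -> entire g -> (forall z, quotient_at (s z) (f z) (g z)) ->
  forall a, C2_minus_graph s (chart_v a) ->
    locally (T := C2_NormedModule) a (fun x => C2_minus_graph s (chart_v x)).
Proof.
  intros Hf Hg Q a H.
  assert (E : forall x : C * C, C2_minus_graph s (chart_v x) <->
    snd x * (g (fst x) - f (fst x) * snd x) <> 0).
  { intros x. unfold C2_minus_graph, graph, chart_v; simpl.
    destruct (Ceq_dec (snd x) 0) as [Z|Z].
    - split; [intros [K _]; destruct (K eq_refl)|]. intros K. exfalso. apply K. rewrite Z. ring.
    - rewrite <- (fibre_zero s f g Q (fst x) (/ snd x)).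
      assert (R : snd x * (g (fst x) - f (fst x) * snd x)
        = snd x * snd x * (g (fst x) * / snd x - f (fst x))) by (field; exact Z).
      rewrite R. split.
      + intros [_ K]. apply Cmult_neq_0; [apply Cmult_neq_0; exact Z|exact K].
      + intros K. split; [discriminate|]. intros K'. apply K. rewrite K'. ring. }
  assert (Hc := ex_diff2_affine_v f g a Hf Hg).
  generalize (Ccontinuous_neq0 (T := C2_NormedModule) _ a (ex_diff2_continuous _ a Hc) (proj1 (E a)
    H)).
  apply filter_imp. intros x. apply E.
Qed.

Theorem proposition1 :
  forall s : C -> P1,
    meromorphic s ->
    (exists z : C, s z <> infty) ->
    exists Z : entire_function -> vector_field,
      forall u : entire_function,
        holomorphic_field (C2_minus_graph s) (Z u) /\
        complete (C2_minus_graph s) (Z u) /\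
        of_type Cstar (C2_minus_graph s) (Z u) /\
        (forall p q : surface,
            C2_minus_graph s p ->
            trajectory (C2_minus_graph s) (Z u) p q -> fst q = fst p) /\
        (exists Y : vector_field,
            (forall p : surface, C2_minus_graph s p -> Y p = Z u p) /\
            holomorphic_field whole Y /\
            complete whole Y /\
            of_type Cstar whole Y /\
            (forall p : surface,
                Y p = (RtoC 0, RtoC 0) <-> graph s p \/ graph s_infty p)).
Proof.
  intros s Hs H0. destruct (meromorphic_quotient s Hs H0) as (f & g & Hf & Hg & Q).
  (* The same formula is used on both surfaces, so the extension agrees with the field by
     definition. *)
  exists (fun u => vertical_field f g (proj1_sig u)). intros [u Hu]. simpl.
  assert (St := C2_minus_graph_stable s f g u Q).
  assert (Sw : forall z w t, whole (z, aff w) -> whole (z, aff (fibre_flow f g u z w t)))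
    by (intros; exact I).
  split; [apply vertical_field_holomorphic; assumption|].
  split; [apply vertical_field_complete; assumption|].
  split; [apply (vertical_field_of_type s f g u Hs H0 Hf Hg Q (C2_minus_graph s) St
    (C2_minus_graph_open_w s f g Hf Hg Q) (C2_minus_graph_open_v s f g Hf Hg Q))|].
  split; [intros p q _; apply trajectory_vertical|].
  exists (vertical_field f g u). split; [reflexivity|].
  split; [apply vertical_field_holomorphic; assumption|].
  split; [apply vertical_field_complete; assumption|].
  split; [|apply vertical_field_zero; assumption].
  apply (vertical_field_of_type s f g u Hs H0 Hf Hg Q whole Sw);
    intros a _; apply filter_forall; intros x; exact I.
Qed.
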